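(* Let $\boldsymbol\rho=(\rho_1,\dots,\rho_k)$ with $\rho_i>0$ and let $F$ be a free holomorphic function on the polydomain $\boldsymbol\rho\mathbf D_{\mathbf q}$, with representation $$F(\mathbf X):=\sum_{(p_1,\dots,p_k)\in\mathbb Z_+^k}\sum_{\boldsymbol\alpha\in\Lambda_{\mathbf p}}A_{(\boldsymbol\alpha)}\otimes\mathbf X_{\boldsymbol\alpha},\qquad\mathbf X\in\boldsymbol\rho\mathbf D_{\mathbf q}(\mathcal H),$$ where $A_{(\boldsymbol\alpha)}\in B(\mathcal K)$. Let $\mathbf r:=(r_1,\dots,r_k)$ be such that $0<r_i<\rho_i$ and define $M(\mathbf r):=\sup\|F(\mathbf X)\|$, where the supremum is taken over all $\mathbf X\in\mathbf r\mathbf D_{\mathbf q}(\mathcal H)^-$ and any Hilbert space $\mathcal H$. Then, for each $\mathbf p=(p_1,\dots,p_k)\in\mathbb Z_+^k$, $$\left\|\sum_{\boldsymbol\alpha=(\alpha_1,\dots,\alpha_k)\in\Lambda_{\mathbf p}}\frac1{b_{1,\alpha_1}\cdots b_{k,\alpha_k}}A_{(\boldsymbol\alpha)}^*A_{(\boldsymbol\alpha)}\right\|^{1/2}\le\frac1{r_1^{p_1}\cdots r_k^{p_k}}M(\mathbf r).$$ Moreover, $M(\mathbf r)=\|F(\mathbf r\mathbf W)\|$, where $\mathbf W$ is the universal model of the regular polydomain $\mathbf D_{\mathbf q}$.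
   Context: Polydomains. Fix $k\in\mathbb N=\{1,2,\dots\}$ and $n_1,\dots,n_k\in\mathbb N$. Hilbert spaces are complex; $A>0$ means that the operator $A$ is positive and invertible. $\mathbb F_{n_i}^+$ is the unital free semigroup on generators $g^i_1,\dots,g^i_{n_i}$ with identity $g^i_0$, and $|\alpha|$ is the length of $\alpha$. For $X_i=(X_{i,1},\dots,X_{i,n_i})\in B(\mathcal H)^{n_i}$ put $X_{i,\alpha}:=X_{i,j_1}\cdots X_{i,j_p}$ if $\alpha=g^i_{j_1}\cdots g^i_{j_p}$, and $X_{i,g_0^i}:=I$. Fix $\mathbf q=(q_1,\dots,q_k)$, where each $q_i=\sum_{\alpha\in\mathbb F_{n_i}^+}a_{i,\alpha}Z_\alpha$ is a positive regular polynomial in $n_i$ noncommuting indeterminates: a finite sum with $a_{i,\alpha}\ge0$, $a_{i,g_0^i}=0$ and $a_{i,g_j^i}>0$ for $j=1,\dots,n_i$. Define $\Phi_{q_i,X_i}(Y):=\sum_\alpha a_{i,\alpha}X_{i,\alpha}YX_{i,\alpha}^*$ for $Y\in B(\mathcal H)$. $B(\mathcal H)^{n_1}\times_c\cdots\times_cB(\mathcal H)^{n_k}$ is the set of $\mathbf X=(X_1,\dots,X_k)\in B(\mathcal H)^{n_1}\times\cdots\times B(\mathcal H)^{n_k}$ such that, for $s\ne t$, every entry of $X_s$ commutes with every entry of $X_t$. For $\mathbf p\in\{0,1\}^k$ let $\mathbf\Delta^{\mathbf p}_{\mathbf q,\mathbf X}:=(\mathrm{id}-\Phi_{q_1,X_1})^{p_1}\circ\cdots\circ(\mathrm{id}-\Phi_{q_k,X_k})^{p_k}$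 and $\mathbf\Delta_{\mathbf q,\mathbf X}:=\mathbf\Delta^{(1,\dots,1)}_{\mathbf q,\mathbf X}$. Set $\mathbf D^-_{\mathbf q}(\mathcal H):=\{\mathbf X\in B(\mathcal H)^{n_1}\times_c\cdots\times_cB(\mathcal H)^{n_k}:\mathbf\Delta^{\mathbf p}_{\mathbf q,\mathbf X}(I)\ge0\text{ for all }\mathbf p\in\{0,1\}^k\}$ and $\mathbf D_{\mathbf q}(\mathcal H):=\{\mathbf X\in\mathbf D^-_{\mathbf q}(\mathcal H):\mathbf\Delta_{\mathbf q,\mathbf X}(I)>0\}$; $\mathbf D_{\mathbf q}(\mathcal H)^-$ is the operator norm closure of $\mathbf D_{\mathbf q}(\mathcal H)$. For $\mathbf r=(r_1,\dots,r_k)$ with $r_i\ge0$, $\mathbf r\mathbf X:=(r_1X_1,\dots,r_kX_k)$ and $\mathbf rG:=\{\mathbf r\mathbf X:\mathbf X\in G\}$. Universal model. $b_{i,g_0^i}:=1$ and, for $|\alpha|\ge1$, $b_{i,\alpha}:=\sum_{p=1}^{|\alpha|}\sum a_{i,\gamma_1}\cdots a_{i,\gamma_p}$, the inner sum over $\gamma_1,\dots,\gamma_p\in\mathbb F_{n_i}^+$ with $\gamma_1\cdots\gamma_p=\alpha$ and all $|\gamma_l|\ge1$. $F^2(H_{n_i})$ is the full Fock space of $\mathbb C^{n_i}$, with orthonormal basis $\{e^i_\alpha\}_{\alpha\in\mathbb F_{n_i}^+}$, and $W_{i,j}e^i_\alpha:=\sqrt{b_{i,\alpha}/b_{i,g^i_j\alpha}}\,e^i_{g^i_j\alpha}$.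 On $F^2(H_{n_1})\otimes\cdots\otimes F^2(H_{n_k})$ let $\mathbf W_{i,j}:=I\otimes\cdots\otimes W_{i,j}\otimes\cdots\otimes I$ ($W_{i,j}$ in position $i$); $\mathbf W=(\mathbf W_1,\dots,\mathbf W_k)$, $\mathbf W_i=(\mathbf W_{i,1},\dots,\mathbf W_{i,n_i})$, is the universal model; it belongs to $\mathbf D_{\mathbf q}^-(\bigotimes_iF^2(H_{n_i}))$. Free holomorphic functions. For $\boldsymbol\alpha=(\alpha_1,\dots,\alpha_k)\in\mathbb F_{n_1}^+\times\cdots\times\mathbb F_{n_k}^+$, $\mathbf X_{\boldsymbol\alpha}:=X_{1,\alpha_1}\cdots X_{k,\alpha_k}$. $\Lambda_{\mathbf p}:=\{\boldsymbol\alpha:|\alpha_i|=p_i,\ i=1,\dots,k\}$ for $\mathbf p\in\mathbb Z_+^k$ ($\mathbb Z_+$ the nonnegative integers). A formal power series $\sum A_{(\boldsymbol\alpha)}\otimes\mathbf Z_{\boldsymbol\alpha}$ with $A_{(\boldsymbol\alpha)}\in B(\mathcal K)$ is a free holomorphic function on $\boldsymbol\rho\mathbf D_{\mathbf q}$ if $\sum_{\mathbf p\in\mathbb Z_+^k}\sum_{\boldsymbol\alpha\in\Lambda_{\mathbf p}}A_{(\boldsymbol\alpha)}\otimes\mathbf X_{\boldsymbol\alpha}$ converges in the operator norm for every $\mathbf X\in\boldsymbol\rho\mathbf D_{\mathbf q}(\mathcal H)$ and every Hilbert space $\mathcal H$ (series over $\mathbb Z_+^k$ being unordered sums). *)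

(* Defs.v *)
From HB Require Import structures.
From mathcomp Require Import all_boot all_order all_algebra finmap.
From mathcomp Require Import complex.
From mathcomp Require Import all_classical all_reals all_analysis.
From mathcomp.analysis.showcase Require Import summability.

Set Implicit Arguments.
Unset Strict Implicit.
Unset Printing Implicit Defensive.
Import Order.TTheory GRing.Theory Num.Theory numFieldNormedType.Exports.

Local Open Scope classical_set_scope.
Local Open Scope ring_scope.
Local Open Scope complex_scope.

HB.mixin Record CompleteNormedModule_isHilbert (R : realType) H
    & CompleteNormedModule R[i] H := {
  inner : H -> H -> R[i];
  inner_linearl : forall (z : H) (c : R[i]) (x y : H),
    inner (c *: x + y) z = c * inner x z + inner y z;
  innerC : forall x y : H, inner x y = Num.conj (inner y x);
  inner_norm : forall x : H, inner x x = `|x| ^+ 2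
}.

#[short(type="hilbertType")]
HB.structure Definition Hilbert (R : realType) :=
  {H of CompleteNormedModule R[i] H & CompleteNormedModule_isHilbert R H}.

(* Norms of R[i]-modules take their values in R[i]; nrm is the same norm seen
   as a real number. *)
Definition nrm (R : realType) (V : normedModType R[i]) (x : V) : R :=
  complex.Re `|x|.

Section Nrm.
Context {R : realType} {V : normedModType R[i]}.
Implicit Types x y : V.

Lemma nrmE x : (nrm x)%:C = `|x|.
Proof. by rewrite /nrm RRe_real// normr_real. Qed.

Lemma nrm_ge0 x : 0 <= nrm x.
Proof. by rewrite -lecR nrmE; exact: normr_ge0. Qed.

Lemma nrm_le x y : (nrm x <= nrm y) = (`|x| <= `|y|).
Proof. by rewrite -!nrmE lecR. Qed.

Lemma nrmD x y : nrm (x + y) <= nrm x + nrm y.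
Proof. by rewrite -lecR rmorphD /= !nrmE ler_normD. Qed.

Lemma nrmZ (c : R[i]) x : nrm (c *: x) = nrm (c : R[i]^o) * nrm x.
Proof.
by apply: (@complexI R); rewrite rmorphM /= !nrmE normrZ.
Qed.

Lemma nrm0 : nrm (0 : V) = 0.
Proof. by apply: (@complexI R); rewrite nrmE normr0. Qed.

Lemma nrm0_eq0 x : nrm x = 0 -> x = 0.
Proof. by move=> x0; apply/normr0_eq0; rewrite -nrmE x0. Qed.

End Nrm.

Section BoundedOperators.
Context {R : realType} {H K : hilbertType R}.

Definition bounded_operator : {pred H -> K} :=
  [pred f | `[< linear f /\ continuous f >]].

Lemma bounded_operator_submod : submod_closed bounded_operator.
Proof.
split=> [|c f g /asboolP[lf cf] /asboolP[lg cg]]; apply/asboolP; split.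
- move=> a x y; change (0 = a *: 0 + 0 :> K).
  by rewrite scaler0 addr0.
- by move=> x; exact: cvg_cst.
- move=> a x y; change (c *: f (a *: x + y) + g (a *: x + y) =
    a *: (c *: f x + g x) + (c *: f y + g y)).
  by rewrite lf lg !scalerDr !scalerA [a * c]mulrC addrACA.
- move=> x; apply: cvgD; last exact: cg.
  by apply: cvgZr; exact: cf.
Qed.

HB.instance Definition _ := GRing.isSubmodClosed.Build R[i] (H -> K)
  bounded_operator bounded_operator_submod.

Record bop := BOp { bop_fun :> H -> K; _ : bop_fun \in bounded_operator }.

HB.instance Definition _ := [isSub for bop_fun].
HB.instance Definition _ := [Choice of bop by <:].
HB.instance Definition _ := [SubChoice_isSubLmodule of bop by <:].

Lemma bop_linear (f : bop) : linear f.
Proof. by case: f => f /= /asboolP[]. Qed.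

Lemma bop_continuous (f : bop) : continuous f.
Proof. by case: f => f /= /asboolP[]. Qed.

HB.instance Definition _ (f : bop) :=
  GRing.isLinear.Build R[i] H K *:%R f (bop_linear f).

Lemma bopP (f g : bop) : f =1 g -> f = g.
Proof. by move=> fg; apply/val_inj/funext. Qed.

Definition opnorm (f : bop) : R :=
  sup [set nrm (f x) | x in [set x : H | nrm x <= 1]].

Lemma bop_bounded (f : bop) : exists2 M, 0 <= M & forall x, nrm (f x) <= M * nrm x.
Proof.
have /linear_boundedP : bounded_near f (nbhs (0 : H)).
  by apply/linear_bounded_continuous; exact: bop_continuous.
move=> /pinfty_ex_gt0[M M0 fM].
have MR : (complex.Re M)%:C = M by rewrite RRe_real// gtr0_real.
exists (complex.Re M); first by rewrite -lecR MR; exact: ltW.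
by move=> x; rewrite -lecR rmorphM /= MR !nrmE; exact: fM.
Qed.

Lemma opnorm_has_sup (f : bop) :
  has_sup [set nrm (f x) | x in [set x : H | nrm x <= 1]].
Proof.
split; first by exists (nrm (f 0)), 0 => //=; rewrite nrm0.
have [M M0 fM] := bop_bounded f; exists M => _ [x /= x1 <-].
by rewrite (le_trans (fM x))// ler_piMr.
Qed.

Lemma opnorm_ub (f : bop) x : nrm x <= 1 -> nrm (f x) <= opnorm f.
Proof. by move=> x1; apply: (sup_ubound (opnorm_has_sup f).2); exists x. Qed.

Lemma opnorm_ge0 (f : bop) : 0 <= opnorm f.
Proof. by rewrite (le_trans (nrm_ge0 (f 0)))// opnorm_ub// nrm0. Qed.

Lemma opnorm_lub (f : bop) (M : R) :
  (forall x, nrm x <= 1 -> nrm (f x) <= M) -> opnorm f <= M.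
Proof.
move=> fM; apply: ge_sup; first exact: (opnorm_has_sup f).1.
by move=> _ [x x1 <-]; exact: fM.
Qed.

Lemma opnormP (f : bop) x : nrm (f x) <= opnorm f * nrm x.
Proof.
have [->|x0] := eqVneq x 0; first by rewrite linear0 !nrm0 mulr0.
have nx : 0 < nrm x.
  by rewrite lt_neqAle nrm_ge0 andbT eq_sym; apply: contra_neq x0 => /nrm0_eq0.
have nxi : nrm (((nrm x)^-1)%:C : R[i]^o) = (nrm x)^-1.
  apply: (@complexI R); rewrite nrmE ger0_norm// lecR invr_ge0; exact: ltW.
have := @opnorm_ub f (((nrm x)^-1)%:C *: x).
rewrite linearZ /= !nrmZ nxi mulVf ?gt_eqF// => /(_ (lexx _)).
by rewrite mulrC ler_pdivrMr.
Qed.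

Let ler_opnormD (f g : bop) :
  (opnorm (f + g))%:C <= (opnorm f)%:C + (opnorm g)%:C.
Proof.
rewrite -rmorphD lecR; apply: opnorm_lub => x x1.
by rewrite (le_trans (nrmD _ _))// lerD// opnorm_ub.
Qed.

Let opnormZ_le (c : R[i]) (f : bop) :
  opnorm (c *: f) <= nrm (c : R[i]^o) * opnorm f.
Proof.
apply: opnorm_lub => x x1; rewrite (_ : (c *: f) x = c *: f x)// nrmZ.
by rewrite ler_wpM2l ?nrm_ge0// opnorm_ub.
Qed.

Let opnormZ (c : R[i]) (f : bop) :
  (opnorm (c *: f))%:C = `|c| * (opnorm f)%:C.
Proof.
rewrite -[ `|c| ](@nrmE R R[i]^o) -rmorphM; congr (_%:C).
apply/eqP; rewrite eq_le opnormZ_le /=.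
have [->|c0] := eqVneq c 0.
  by rewrite [nrm _](@nrm0 R R[i]^o) mul0r opnorm_ge0.
have nc : 0 < nrm (c : R[i]^o).
  rewrite lt_neqAle nrm_ge0 andbT eq_sym.
  by apply: contra_neq c0 => /(@nrm0_eq0 R R[i]^o).
rewrite mulrC -ler_pdivlMr// mulrC.
rewrite -{1}[f](scalerK c0) (le_trans (opnormZ_le _ _))//.
rewrite ler_wpM2r ?opnorm_ge0// -lecR fmorphV /=.
by rewrite (@nrmE R R[i]^o) (@nrmE R R[i]^o) normfV.
Qed.

Let opnorm_eq0 (f : bop) : (opnorm f)%:C = 0 -> f = 0.
Proof.
move=> /(@complexI R) f0; apply: bopP => x; apply: nrm0_eq0.
by apply: le_anti; rewrite nrm_ge0 andbT (le_trans (opnormP f x))// f0 mul0r.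
Qed.

HB.instance Definition _ :=
  Lmodule_isNormed.Build R[i] bop ler_opnormD opnormZ opnorm_eq0.

Lemma nrm_bop (f : bop) : nrm f = opnorm f.
Proof. by []. Qed.

End BoundedOperators.

Arguments bop {R} H K.
Notation "''B' ( H )" := (bop H H) (format "''B' ( H )") : type_scope.

Section OperatorRing.
Context {R : realType}.

Lemma bop_comp_subproof (H K L : hilbertType R) (f : bop K L) (g : bop H K) :
  f \o g \in bounded_operator.
Proof.
apply/asboolP; split=> [c x y|x].
  by rewrite /= (bop_linear g) (bop_linear f).
by apply: continuous_comp; exact: bop_continuous.
Qed.

Definition bop_comp (H K L : hilbertType R) (f : bop K L) (g : bop H K) :
  bop H L := BOp (bop_comp_subproof f g).

Context {H : hilbertType R}.

Lemma bop_id_subproof : idfun \in @bounded_operator R H H.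
Proof. by apply/asboolP; split=> // x. Qed.

Definition bop_id : 'B(H) := BOp bop_id_subproof.

Let bop_compA : associative (@bop_comp H H H).
Proof. by move=> f g h; exact: bopP. Qed.
Let bop_comp1f : left_id bop_id (@bop_comp H H H).
Proof. by move=> f; exact: bopP. Qed.
Let bop_compf1 : right_id bop_id (@bop_comp H H H).
Proof. by move=> f; exact: bopP. Qed.
Let bop_compDl : left_distributive (@bop_comp H H H) +%R.
Proof. by move=> f g h; exact: bopP. Qed.
Let bop_compDr : right_distributive (@bop_comp H H H) +%R.
Proof. by move=> f g h; apply: bopP => x; exact: linearD. Qed.

(* The product of 'B(H) is composition; the ring may be trivial (H = 0). *)
HB.instance Definition _ := GRing.Zmodule_isPzRing.Build 'B(H)
  bop_compA bop_comp1f bop_compf1 bop_compDl bop_compDr.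

Lemma bop_mulE (f g : 'B(H)) x : (f * g) x = f (g x).
Proof. by []. Qed.

Lemma bop_oneE x : (1 : 'B(H)) x = x.
Proof. by []. Qed.

End OperatorRing.

Section AdjointPositivity.
Context {R : realType}.

(* The bounded operator with this property exists and is unique (Riesz); the
   default 0 of xget is never reached. *)
Definition adj (H K : hilbertType R) (f : bop H K) : bop K H :=
  xget 0 [set g : bop K H | forall x y, inner (f x) y = inner x (g y)].

(* The order of R[i] is the one where 0 <= z means that z is real and
   nonnegative. *)
Definition bop_ge0 (H : hilbertType R) (f : 'B(H)) : Prop :=
  forall x : H, 0 <= inner (f x) x.

Definition bop_invertible (H : hilbertType R) (f : 'B(H)) : Prop :=
  exists g : 'B(H), f * g = 1 /\ g * f = 1.

Definition bop_gt0 (H : hilbertType R) (f : 'B(H)) : Prop :=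
  bop_ge0 f /\ bop_invertible f.

Definition total_family (I : Type) (H : hilbertType R) (v : I -> H) : Prop :=
  closure [set z : H | exists s : seq (R[i] * I),
                         z = \sum_(c <- s) c.1 *: v c.2] = setT.

(* Hilbert space tensor products are characterised up to a unitary which
   respects elementary tensors. *)
Record htensor (K H : hilbertType R) := HTensor {
  htensor_space :> hilbertType R;
  tens : K -> H -> htensor_space;
  tens_linearl : forall y, linear (tens ^~ y);
  tens_linearr : forall x, linear (tens x);
  inner_tens : forall x y x' y',
    inner (tens x y) (tens x' y') = inner x x' * inner y y';
  tens_total : total_family (fun xy : K * H => tens xy.1 xy.2)
}.

(* A \otimes X; well defined since elementary tensors are total *)
Definition tensop (K H : hilbertType R) (T : htensor K H)
    (A : 'B(K)) (X : 'B(H)) : 'B(T) :=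
  xget 0 [set B : 'B(T) | forall x y, B (tens T x y) = tens T (A x) (X y)].

Record hbigtensor (k : nat) (H : 'I_k -> hilbertType R) := HBigTensor {
  hbigtensor_space :> hilbertType R;
  bigtens : (forall i, H i) -> hbigtensor_space;
  bigtens_linear : forall (x : forall i, H i) i,
    linear (fun y : H i => bigtens (dfwith x i y));
  inner_bigtens : forall x y,
    inner (bigtens x) (bigtens y) = \prod_(i < k) inner (x i) (y i);
  bigtens_total : total_family bigtens
}.

(* I \otimes ... \otimes A \otimes ... \otimes I, with A in position i *)
Definition bigtensop (k : nat) (H : 'I_k -> hilbertType R) (T : hbigtensor H)
    (i : 'I_k) (A : 'B(H i)) : 'B(T) :=
  xget 0 [set B : 'B(T) |
    forall x, B (bigtens T x) = bigtens T (dfwith x i (A (x i)))].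

End AdjointPositivity.

(* The free semigroup on n generators is seq 'I_n: the identity is [::], the
   product is concatenation and the length is size. *)
Definition ncpoly (R : realType) (n : nat) := {fsfun seq 'I_n -> R with 0}.

Section OnePolynomial.
Context {R : realType} {n : nat}.
Implicit Types (q : ncpoly R n) (alpha : seq 'I_n).

Definition positive_regular q : Prop :=
  [/\ forall alpha, 0 <= q alpha, q [::] = 0 & forall j, 0 < q [:: j]].

Definition monomial (H : hilbertType R) (X : 'I_n -> 'B(H)) alpha : 'B(H) :=
  \prod_(j <- alpha) X j.

Definition Phi (H : hilbertType R) q (X : 'I_n -> 'B(H)) (Y : 'B(H)) : 'B(H) :=
  \sum_(alpha <- finsupp q)
    (q alpha)%:C *: (monomial X alpha * Y * adj (monomial X alpha)).

Definition factors (m p : nat) (gamma : p.-tuple (m.-bseq 'I_n)) :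
  seq (seq 'I_n) := map val (val gamma).

(* A factor of alpha has length at most size alpha, so the factorisations
   alpha = gamma_1 ... gamma_p range over a finite type. *)
Definition bcoef q alpha : R :=
  if alpha == [::] then 1 else
  \sum_(1 <= p < (size alpha).+1)
    \sum_(gamma : p.-tuple ((size alpha).-bseq 'I_n) |
          (flatten (factors gamma) == alpha)
          && all (fun w => 0 < size w)%N (factors gamma))
      \prod_(w <- factors gamma) q w.

(* The full Fock space, through its orthonormal basis e_alpha *)
Record fock := Fock {
  fock_space :> hilbertType R;
  fock_basis : seq 'I_n -> fock_space;
  fock_orthonormal : forall alpha beta,
    inner (fock_basis alpha) (fock_basis beta) = (alpha == beta)%:R;
  fock_total : total_family fock_basis
}.

Definition weighted_shift (F : fock) q (j : 'I_n) : 'B(F) :=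
  xget 0 [set B : 'B(F) | forall alpha, B (fock_basis F alpha) =
    (Num.sqrt (bcoef q alpha / bcoef q (j :: alpha)))%:C
      *: fock_basis F (j :: alpha)].

End OnePolynomial.

Arguments fock R n : clear implicits.

Section Polydomain.
Context {R : realType} {k : nat} {n : 'I_k -> nat}.
Implicit Types (q : forall i, ncpoly R (n i)) (r rho : 'I_k -> R).

(* The topology of prod_topology is the product topology; as there are finitely
   many entries, its closure is the closure in operator norm. *)
Definition optuple (H : hilbertType R) : topologicalType :=
  prod_topology (fun i : 'I_k => prod_topology (fun _ : 'I_(n i) => 'B(H))).

Definition multiword : Type := forall i : 'I_k, seq 'I_(n i).

Definition commuting_tuples (H : hilbertType R) (X : optuple H) : Prop :=
  forall s t, s != t -> forall (j : 'I_(n s)) (l : 'I_(n t)),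
    X s j * X t l = X t l * X s j.

Definition Delta (H : hilbertType R) q (p : 'I_k -> bool) (X : optuple H)
    (Y : 'B(H)) : 'B(H) :=
  foldr (fun i Z => iter (p i) (fun Z' => Z' - Phi (q i) (X i) Z') Z)
        Y (enum 'I_k).

Definition polydomain_closed q (H : hilbertType R) : set (optuple H) :=
  [set X | commuting_tuples X /\ forall p, bop_ge0 (Delta q p X 1)].

Definition polydomain q (H : hilbertType R) : set (optuple H) :=
  [set X | polydomain_closed q X /\ bop_gt0 (Delta q (fun=> true) X 1)].

Definition scale_tuple (H : hilbertType R) r (X : optuple H) : optuple H :=
  fun i j => (r i)%:C *: X i j.

Definition multimonomial (H : hilbertType R) (X : optuple H)
    (alpha : multiword) : 'B(H) :=
  \prod_(i < k) monomial (X i) (alpha i).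

Definition Lambda (p : 'I_k -> nat) : finType :=
  {dffun forall i : 'I_k, (p i).-tuple 'I_(n i)}.

Definition word_of (p : 'I_k -> nat) (alpha : Lambda p) : multiword :=
  fun i => tval (alpha i).

Definition homogeneous_part (K H : hilbertType R) (T : htensor K H)
    (A : multiword -> 'B(K)) (X : optuple H) (p : {ffun 'I_k -> nat}) : 'B(T) :=
  \sum_(alpha : Lambda p)
    tensop T (A (word_of alpha)) (multimonomial X (word_of alpha)).

(* The family indexed by Z_+^k is summed along the filter totally of finite
   subsets, that is, as an unordered sum in operator norm. *)
Definition series_converges (K H : hilbertType R) (T : htensor K H)
    (A : multiword -> 'B(K)) (X : optuple H) : Prop :=
  cvg (partial_sum (homogeneous_part T A X) @ totally).

Definition series_value (K H : hilbertType R) (T : htensor K H)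
    (A : multiword -> 'B(K)) (X : optuple H) : 'B(T) :=
  summability.sum (homogeneous_part T A X).

Definition free_holomorphic (K : hilbertType R) rho q
    (A : multiword -> 'B(K)) : Prop :=
  forall (H : hilbertType R) (T : htensor K H) (X : optuple H),
    polydomain q X -> series_converges T A (scale_tuple rho X).

Definition Msup (K : hilbertType R) r q (A : multiword -> 'B(K)) : \bar R :=
  ereal_sup [set y | exists (H : hilbertType R) (T : htensor K H)
    (X : optuple H), closure (polydomain q (H:=H)) X /\
      y = (nrm (series_value T A (scale_tuple r X)))%:E].

Definition universal_model q (F : forall i, fock R (n i)) (T : hbigtensor F) :
    optuple T :=
  fun i j => bigtensop T (weighted_shift (F i) (q i) j).

End Polydomain.

Arguments optuple {R k} n H.
Arguments multiword {k} n.
Arguments Lambda {k} n p.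

(* Main.v *)
Require Import Defs.
From HB Require Import structures.
From mathcomp Require Import all_boot all_order all_algebra finmap.
From mathcomp Require Import complex.
From mathcomp Require Import all_classical all_reals all_analysis.
From mathcomp Require Import ring lra.
From mathcomp.analysis.showcase Require Import summability.

Set Implicit Arguments.
Unset Strict Implicit.
Unset Printing Implicit Defensive.
Import Order.TTheory GRing.Theory Num.Theory numFieldNormedType.Exports.

Local Open Scope classical_set_scope.
Local Open Scope ring_scope.
Local Open Scope complex_scope.

(** The theorem rests on a von Neumann inequality: |P(X)| <= |P(W)| for every
    polynomial P with coefficients in B(K) and every X in the polydomain, where
    W is the universal model.  It makes F(rW) the largest value of F, while the
    coefficients of F can be read off the action of W on the vacuum vector.

    The inequality ([von_neumann]).  The coefficients satisfy the recursion
    b_alpha = sum a_gamma b_beta over alpha = gamma beta with gamma nonempty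
    ([bcoef_rec]).  Consequently the sums of b_alpha X_alpha Y adj(X_alpha) over
    the words of length less than m are truncated inverses of id - Phi: composed
    with id - Phi they give id minus a positive map, the tail, and the tail of 1
    is at most t^2m if X = tX' with Phi_X'(1) <= 1 ([resolvent_tail_scaled]).
    Multiplying over the coordinates, the sums of b_alpha X_alpha D adj(X_alpha)
    over boxes, with D the full defect of X, tend to 1 ([box_sum_bounds]).  For u
    in K (x) H this expresses the square of |adj(P(X)) u| through the seminorms
    <D h, h> of the vectors adj(X_beta) h.  A factorisation of their finite Gram
    matrix ([gram_factorable]) turns these seminorms into sums of squares of
    norms in K, and each of the resulting terms is an inequality about one vector
    of K (x) F^2, where P(W) appears ([model_column_bound]).  This is the argument
    of the Poisson kernel, with Gram matrices in place of the square root of D.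

    Closure and convergence.  The map id - Phi_sX is the sum of a positive map
    and of a convex combination of id and id - Phi_X, so that sX is in the open
    polydomain when X is in the closed one and s < 1 ([scaled_polydomain]).  Hence
    the closed polydomain is the closure of the open one, and the series of F
    converges at rX for all its elements X, since r < rho.  It contains W, whose
    defect operators are diagonal projections ([model_polydomain_closed]).

    Coefficients ([coefficient_bound]).  As W_alpha e_0 is e_alpha divided by the
    square root of b_alpha, the component of F(rW)(x (x) e_0) along e_alpha is
    A_alpha x up to a known factor.  A compression of W to a finite-dimensional
    space, on which the tensor product with K is a finite direct sum, has the
    same property for a given multidegree.

    The Hilbert space theory needed is that of adjoints and inverses, from the
    Riesz theorem ([coercive_representation]), and that of operators on tensor
    products, which are extended from elementary tensors ([extend_total]) after
    being bounded there by Gram factorisations ([kernel_contract]). *)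
(** * Inner products and positive operators *)

Section ComplexScalars.
Context {R : realType}.
Implicit Types (z w : R[i]) (a b : R).

Lemma ReD z w : complex.Re (z + w) = complex.Re z + complex.Re w.
Proof. by case: z w => [? ?] []. Qed.

Lemma ReN z : complex.Re (- z) = - complex.Re z.
Proof. by case: z. Qed.

Lemma Re_conj z : complex.Re z^*%R = complex.Re z.
Proof. by case: z. Qed.

Lemma Re_MR a z : complex.Re (a%:C * z) = a * complex.Re z.
Proof. by case: z => x y /=; rewrite mul0r subr0. Qed.

Lemma ReC a : complex.Re a%:C = a. Proof. by []. Qed.

Lemma conjR a : (a%:C)^*%R = a%:C :> R[i].
Proof. by apply: conj_Creal; apply/complex_realP; exists a. Qed.

Lemma normR a : `|a%:C| = `|a|%:C :> R[i].
Proof.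
by rewrite normc_def /= expr0n /= addr0 sqrtr_sqr.
Qed.

Lemma nrm_scalar z : (nrm (z : R[i]^o))%:C = `|z|.
Proof. exact: (@nrmE R R[i]^o). Qed.

Lemma nrm_real a : nrm (a%:C : R[i]^o) = `|a|.
Proof. by apply: (@complexI R); rewrite nrm_scalar normR. Qed.

Lemma nrm_ge_Re z : complex.Re z <= nrm (z : R[i]^o).
Proof.
rewrite -lecR nrm_scalar (le_trans _ (normc_ge_Re z))// lecR; exact: ler_norm.
Qed.

Lemma ge0_ReE z : 0 <= z -> (complex.Re z)%:C = z.
Proof. by move=> z0; rewrite RRe_real// ger0_real. Qed.

Lemma Re_ge0 z : 0 <= z -> 0 <= complex.Re z.
Proof. by move=> z0; rewrite -ler0c ge0_ReE. Qed.

Lemma nrm_sqrC z : ((nrm (z : R[i]^o)) ^+ 2)%:C = z * z^*%R.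
Proof. by rewrite rmorphXn /= nrm_scalar normCK. Qed.

End ComplexScalars.

Lemma nrmN (R : realType) (V : normedModType R[i]) (x : V) : nrm (- x) = nrm x.
Proof. by rewrite /nrm normrN. Qed.

Lemma nrm_distC (R : realType) (V : normedModType R[i]) (x y : V) :
  nrm (x - y) = nrm (y - x).
Proof. by rewrite /nrm distrC. Qed.

Section Inner.
Context {R : realType} {H : hilbertType R}.
Implicit Types (x y z : H) (c : R[i]).

Lemma innerDl x y z : inner (x + y) z = inner x z + inner y z.
Proof. by rewrite -{1}[x]scale1r inner_linearl mul1r. Qed.

Lemma inner0l z : inner (0 : H) z = 0.
Proof. by apply: (addrI (inner (0 : H) z)); rewrite -innerDl !addr0. Qed.

Lemma innerZl c x z : inner (c *: x) z = c * inner x z.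
Proof. by rewrite -[c *: x]addr0 inner_linearl inner0l addr0. Qed.

Lemma innerNl x z : inner (- x) z = - inner x z.
Proof. by rewrite -scaleN1r innerZl mulN1r. Qed.

Lemma innerBl x y z : inner (x - y) z = inner x z - inner y z.
Proof. by rewrite innerDl innerNl. Qed.

Lemma innerDr x y z : inner z (x + y) = inner z x + inner z y.
Proof. by rewrite innerC innerDl rmorphD /= -!innerC. Qed.

Lemma inner0r z : inner z (0 : H) = 0.
Proof. by rewrite innerC inner0l rmorph0. Qed.

Lemma innerZr c x z : inner z (c *: x) = c^*%R * inner z x.
Proof. by rewrite innerC innerZl rmorphM /= -innerC. Qed.

Lemma innerNr x z : inner z (- x) = - inner z x.
Proof. by rewrite innerC innerNl rmorphN /= -innerC. Qed.

Lemma innerBr x y z : inner z (x - y) = inner z x - inner z y.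
Proof. by rewrite innerDr innerNr. Qed.

Lemma inner_suml (I : Type) (s : seq I) (F : I -> H) z :
  inner (\sum_(i <- s) F i) z = \sum_(i <- s) inner (F i) z.
Proof.
elim: s => [|i s IH]; first by rewrite !big_nil inner0l.
by rewrite !big_cons innerDl IH.
Qed.

Lemma inner_sumr (I : Type) (s : seq I) (F : I -> H) z :
  inner z (\sum_(i <- s) F i) = \sum_(i <- s) inner z (F i).
Proof.
elim: s => [|i s IH]; first by rewrite !big_nil inner0r.
by rewrite !big_cons innerDr IH.
Qed.

Lemma inner_sqr x : inner x x = (nrm x ^+ 2)%:C.
Proof. by rewrite inner_norm rmorphXn /= nrmE. Qed.

Lemma inner_inj x y : (forall z, inner x z = inner y z) -> x = y.
Proof.
move=> xy; apply/eqP; rewrite -subr_eq0; apply/eqP/nrm0_eq0/eqP.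
rewrite -sqrf_eq0; apply/eqP/(@complexI R); rewrite -inner_sqr.
by rewrite innerBl xy subrr.
Qed.

End Inner.

Section PointwiseOperations.
Context {R : realType} {H K : hilbertType R}.
Implicit Types (f g : bop H K) (x : H).

Lemma bop0E x : (0 : bop H K) x = 0. Proof. by []. Qed.
Lemma bopDE f g x : (f + g) x = f x + g x. Proof. by []. Qed.
Lemma bopNE f x : (- f) x = - f x. Proof. by []. Qed.
Lemma bopBE f g x : (f - g) x = f x - g x. Proof. by []. Qed.
Lemma bopZE c f x : (c *: f) x = c *: f x. Proof. by []. Qed.

Lemma bopD f x y : f (x + y) = f x + f y. Proof. exact: linearD. Qed.
Lemma bopB f x y : f (x - y) = f x - f y. Proof. exact: linearB. Qed.
Lemma bopZ f c x : f (c *: x) = c *: f x. Proof. exact: linearZ. Qed.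
Lemma bop0 f : f 0 = 0. Proof. exact: linear0. Qed.
Lemma bop_sum f (I : Type) (s : seq I) (F : I -> H) :
  f (\sum_(i <- s) F i) = \sum_(i <- s) f (F i).
Proof. exact: linear_sum. Qed.

Lemma bop_sumE (I : Type) (s : seq I) (F : I -> bop H K) x :
  (\sum_(i <- s) F i) x = \sum_(i <- s) F i x.
Proof.
elim: s => [|i s IH]; first by rewrite !big_nil.
by rewrite !big_cons -IH.
Qed.

End PointwiseOperations.

Section PositiveOperators.
Context {R : realType} {H : hilbertType R}.
Implicit Types (x y : H) (D E : 'B(H)).

Lemma bop_ge0_1 : bop_ge0 (1 : 'B(H)).
Proof. by move=> x; rewrite bop_oneE inner_sqr ler0c sqr_ge0. Qed.

Lemma bop_ge0_0 : bop_ge0 (0 : 'B(H)).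
Proof. by move=> x; rewrite bop0E inner0l. Qed.

Lemma bop_ge0D D E : bop_ge0 D -> bop_ge0 E -> bop_ge0 (D + E).
Proof. by move=> D0 E0 x; rewrite bopDE innerDl addr_ge0 ?D0 ?E0. Qed.

Lemma bop_ge0Z (c : R) D : 0 <= c -> bop_ge0 D -> bop_ge0 (c%:C *: D).
Proof. by move=> c0 D0 x; rewrite bopZE innerZl mulr_ge0 ?ler0c ?D0. Qed.

Lemma bop_ge0_sum (I : Type) (s : seq I) (P : pred I) (F : I -> 'B(H)) :
  (forall i, P i -> bop_ge0 (F i)) -> bop_ge0 (\sum_(i <- s | P i) F i).
Proof.
move=> F0; elim/big_ind: _ => //; first exact: bop_ge0_0.
exact: bop_ge0D.
Qed.

Lemma bop_ge0_trans D E (F : 'B(H)) :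
  bop_ge0 (E - D) -> bop_ge0 (F - E) -> bop_ge0 (F - D).
Proof. by move=> DE EF; rewrite -(subrK E F) -addrA; exact: bop_ge0D. Qed.

(** Polarisation: over the complex numbers a form which is real on the
    diagonal is hermitian. *)
Lemma bop_ge0_sym D : bop_ge0 D -> forall x y, inner (D x) y = inner x (D y).
Proof.
move=> D0 x y.
have realD v : complex.Im (inner (D v) v) = 0.
  by have := ge0_ReE (D0 v); case: (inner _ _) => a b [] <-.
rewrite [RHS]innerC.
have := realD (x + y); have := realD (x + 'i%C *: y).
rewrite !bopD !bopZ !innerDl !innerDr !innerZl !innerZr /=.
have := realD x; have := realD y.
case: (inner (D x) x) => a0 a1; case: (inner (D y) y) => b0 b1.
case: (inner (D x) y) => c0 c1; case: (inner (D y) x) => d0 d1 /= -> -> /=.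
move=> e1 e2; congr (_ +i* _); lra.
Qed.

Lemma bop_ge0_conj D : bop_ge0 D ->
  forall x y, inner (D y) x = (inner (D x) y)^*%R.
Proof. by move=> D0 x y; rewrite bop_ge0_sym// innerC. Qed.

(** With a = <D x, y>, the vector x - t a y has nonnegative form for all real
    t; the inverse of <D y, y> is the best t, and if <D y, y> = 0 then a large
    t forces a = 0. *)
Lemma cauchy_schwarz D : bop_ge0 D -> forall x y,
  inner (D x) y * (inner (D x) y)^*%R <= inner (D x) x * inner (D y) y.
Proof.
move=> D0 x y; set a := inner (D x) y.
have expand (t : R) : 0 <= inner (D x) x - (t%:C *+ 2) * (a * a^*%R)
    + (t ^+ 2)%:C * (a * a^*%R) * inner (D y) y.
  have := D0 (x - (t%:C * a) *: y).
  rewrite !bopB !bopZ !innerBl !innerBr !innerZl !innerZr /=.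
  rewrite (bop_ge0_conj D0 x y) -/a rmorphM /= conjR.
  set u := inner (D x) x; set v := inner (D y) y; set b := a^*%R.
  by congr (_ <= _); rewrite rmorphXn /=; ring.
have y0 := D0 y; have x0 := D0 x.
have n0 : 0 <= a * a^*%R by exact: mul_conjC_ge0.
move: expand; rewrite -(ge0_ReE y0) -(ge0_ReE x0) -(ge0_ReE n0).
move: (Re_ge0 y0) (Re_ge0 x0) (Re_ge0 n0).
move: (complex.Re (inner (D x) x)) (complex.Re (inner (D y) y)).
move: (complex.Re (a * a^*%R)) => m u v v0 u0 m0 expand.
have {}expand t : 0 <= u - t *+ 2 * m + t ^+ 2 * m * v.
  rewrite -ler0c.
  by have := expand t; rewrite -!rmorphMn -!rmorphM -rmorphB -rmorphD.
rewrite -rmorphM lecR.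
have [v00|vn0] := eqVneq v 0.
  rewrite v00 mulr0; rewrite leNgt; apply/negP => mp.
  (* for this t the affine function u - 2 t m of t is negative *)
  have := expand ((u + 1) / m); rewrite v00 mulr0 addr0.
  have -> : (u + 1) / m *+ 2 * m = (u + 1) *+ 2 by field; rewrite gt_eqF.
  lra.
have vp : 0 < v by rewrite lt_neqAle eq_sym vn0.
have := expand v^-1.
have -> : v^-1 ^+ 2 * m * v = v^-1 * m by field.
move=> h; have : v^-1 * m <= u by lra.
by rewrite mulrC ler_pdivrMr.
Qed.

Lemma inner_nrm_le x y : nrm (inner x y : R[i]^o) <= nrm x * nrm y.
Proof.
have := cauchy_schwarz bop_ge0_1 x y; rewrite !bop_oneE -nrm_sqrC !inner_sqr.
rewrite -rmorphM lecR -exprMn ler_pXn2r// nnegrE ?mulr_ge0 ?nrm_ge0//.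
Qed.

Lemma Re_inner_le x y : complex.Re (inner x y) <= nrm x * nrm y.
Proof. exact: le_trans (nrm_ge_Re _) (inner_nrm_le x y). Qed.

End PositiveOperators.

(** * Convergence, the Riesz representation and adjoints *)

Section RealNorm.
Context {R : realType}.

Lemma gt0_ReE (e : R[i]) : 0 < e -> (complex.Re e)%:C = e /\ 0 < complex.Re e.
Proof.
move=> e0; have E := ge0_ReE (ltW e0); split=> //.
by move: e0; rewrite -E ltcR.
Qed.

Lemma cvg_nrmP (V : normedModType R[i]) (T : Type) (F : set_system T)
    {FF : Filter F} (f : T -> V) (y : V) :
  f @ F --> y <->
  forall e : R, 0 < e -> \forall t \near F, nrm (y - f t) < e.
Proof.
rewrite cvgrPdist_lt; split=> h e e0.
  have e0' : 0 < e%:C :> R[i] by rewrite ltcR.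
  by apply: filterS (h _ e0') => t /=; rewrite -nrmE ltcR.
have [E e0'] := gt0_ReE e0.
by apply: filterS (h _ e0') => t; rewrite -E -nrmE ltcR.
Qed.

Lemma cauchy_nrm_cvg (V : completeNormedModType R[i]) (F : set_system V)
    {FF : ProperFilter F} :
  (forall e : R, 0 < e -> exists x : V, F [set y | nrm (x - y) < e]) ->
  exists l : V, F --> l.
Proof.
move=> cF; suff : cvg F by exists (lim F).
apply/cauchy_cvgP/cauchy_exP => e e0; have [E e0'] := gt0_ReE e0.
have [x Fx] := cF _ e0'; exists x; apply: filterS Fx => y /=.
by rewrite -ball_normE /= -E -nrmE ltcR.
Qed.

Lemma cauchy_seq_nrm_cvg (V : completeNormedModType R[i]) (u : nat -> V) :
  (forall e : R, 0 < e -> exists N, forall n m, (N <= n)%N -> (N <= m)%N ->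
     nrm (u n - u m) < e) ->
  exists l : V, forall e : R, 0 < e -> \forall n \near \oo, nrm (l - u n) < e.
Proof.
move=> cu; have [e e0|l ul] := @cauchy_nrm_cvg V (u @ \oo) _.
  have [N uN] := cu _ e0; exists (u N); exists N => // m /= Nm.
  exact: uN.
by exists l; apply/cvg_nrmP.
Qed.

Lemma linear_bounded_operator (H K : hilbertType R) (f : H -> K) (M : R) :
  linear f -> (forall x, nrm (f x) <= M * nrm x) -> f \in bounded_operator.
Proof.
move=> lf fM; apply/asboolP; split=> // x.
apply/cvg_nrmP => e e0.
have M1 : 0 < `|M| + 1 by rewrite ltr_wpDl.
have fB u v : f u - f v = f (u - v).
  by rewrite [u - v]addrC -[- v]scaleN1r lf scaleN1r addrC.
have d0 : 0 < e / (`|M| + 1) by rewrite divr_gt0.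
have /cvg_nrmP/(_ _ d0) : id @ x --> x by exact: cvg_id.
apply: filterS => t /=; rewrite ltr_pdivlMr// fB mulrC.
apply: le_lt_trans; rewrite (le_trans (fM _))// ler_wpM2r ?nrm_ge0//.
by rewrite (le_trans (ler_norm _))// lerDl.
Qed.

Lemma archi_small (e : R) : 0 < e -> exists N : nat, forall n, (N <= n)%N ->
  (n.+1%:R)^-1 < e.
Proof.
move=> e0; exists (Num.truncn e^-1) => n Nn.
rewrite invf_plt ?posrE// (lt_le_trans (truncnS_gt _))//.
by rewrite ler_nat ltnS.
Qed.

End RealNorm.

Section Representation.
Context {R : realType} {H : hilbertType R}.
Variables (D : 'B(H)) (c : R) (f : H -> R[i]) (L : R).
Hypotheses (c0 : 0 < c) (D0 : bop_ge0 D)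
  (Dc : forall x, c * nrm x ^+ 2 <= complex.Re (inner (D x) x))
  (f_lin : forall a x y, f (a *: x + y) = a * f x + f y)
  (fL : forall x, nrm (f x : R[i]^o) <= L * nrm x).

Let Q x := complex.Re (inner (D x) x).
Let B x y := complex.Re (inner (D x) y).
Let J x : R := Q x - 2 * complex.Re (f x).

Let J_var x y (t : R) :
  J (x + t%:C *: y) = J x + 2 * t * (B x y - complex.Re (f y)) + t ^+ 2 * Q y.
Proof.
rewrite /J /Q /B [x + _]addrC f_lin !bopD !bopZ !innerDl !innerDr.
rewrite !innerZl !innerZr conjR (bop_ge0_conj D0 x y).
rewrite !ReD !Re_MR Re_conj; ring.
Qed.

Let J_lb x : - (L ^+ 2 / c) <= J x.
Proof.
have h1 := Dc x; have h2 := le_trans (nrm_ge_Re _) (fL x).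
suff : 0 <= c * nrm x ^+ 2 - 2 * (L * nrm x) + L ^+ 2 / c.
  by rewrite /J /Q; lra.
have -> : c * nrm x ^+ 2 - 2 * (L * nrm x) + L ^+ 2 / c =
  (c * nrm x - L) ^+ 2 / c by field; rewrite gt_eqF.
by rewrite divr_ge0 ?sqr_ge0// ltW.
Qed.

Let Jset := [set J x | x in [set: H]].
Let m := inf Jset.

Let has_inf_J : has_inf Jset.
Proof.
split; first by exists (J 0), 0.
by exists (- (L ^+ 2 / c)) => _ [x _ <-].
Qed.

Let m_le x : m <= J x.
Proof. by apply: ge_inf; [exact: has_inf_J.2|exists x]. Qed.

(** The parallelogram identity for J around the midpoint of u and v. *)
Let J_near u v e : J u < m + e -> J v < m + e -> nrm (u - v) ^+ 2 <= 4 * e / c.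
Proof.
move=> ue ve; pose mid := (2^-1 : R)%:C *: (u + v).
pose d := (2^-1 : R)%:C *: (u - v).
have half : (2^-1 : R)%:C + (2^-1)%:C = 1 :> R[i].
  by rewrite -rmorphD /=; congr (_%:C); field.
have uE : u = mid + (1 : R)%:C *: d.
  rewrite scale1r /mid /d -scalerDr addrACA subrr addr0.
  by rewrite scalerDr -scalerDl half scale1r.
have vE : v = mid + (-1 : R)%:C *: d.
  rewrite (_ : (-1)%:C = -1 :> R[i]); last by rewrite rmorphN.
  rewrite scaleN1r /mid /d -scalerBr opprB [u + v]addrC addrACA.
  by rewrite subrr addr0 scalerDr -scalerDl half scale1r.
have dE : u - v = (2 : R)%:C *: d.
  by rewrite /d scalerA -rmorphM /= divff ?pnatr_eq0// scale1r.
rewrite dE nrmZ nrm_real ger0_norm// exprMn.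
have := Dc d; rewrite -/(Q d) => Qd.
move: ue ve; rewrite uE vE !J_var; have := m_le mid => h1 h2 h3.
rewrite -mulrA [_ ^+ 2]expr2 -natrM ler_pM2l// ler_pdivlMr// mulrC.
by rewrite expr1n sqrrN expr1n in h2 h3; lra.
Qed.

(** The functional J(x) = Re <D x, x> - 2 Re f(x) is coercive.  Its minimising
    sequences are Cauchy by the parallelogram identity, and the vanishing of
    its derivative at the minimiser is the equation.  The case D = 1 is the
    Riesz theorem; a functional <., z> gives a solution of D x = z. *)
Lemma coercive_representation : exists x, forall y, f y = inner y (D x).
Proof.
have Jex n : exists x, J x < m + (n.+1%:R)^-1.
  have n0 : 0 < (n.+1%:R)^-1 :> R by rewrite invr_gt0.
  by have [_ [x _ <-] xn] := inf_adherent n0 has_inf_J; exists x.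
have [u uJ] := choice Jex.
have [e e0|x ux] := @cauchy_seq_nrm_cvg R H u.
  have d0 : 0 < e ^+ 2 * c / 4 by rewrite !mulr_gt0.
  have [N hN] := archi_small d0; exists N => i j Ni Nj.
  rewrite -(@ltr_pXn2r _ 2)// ?nnegrE ?nrm_ge0 ?(ltW e0)//.
  have iN : (i.+1%:R)^-1 <= (N.+1%:R)^-1 :> R by rewrite lef_pV2 ?posrE// ler_nat.
  have jN : (j.+1%:R)^-1 <= (N.+1%:R)^-1 :> R by rewrite lef_pV2 ?posrE// ler_nat.
  have ui : J (u i) < m + (N.+1%:R)^-1 by apply: lt_le_trans (uJ i) _; rewrite lerD2l.
  have uj : J (u j) < m + (N.+1%:R)^-1 by apply: lt_le_trans (uJ j) _; rewrite lerD2l.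
  apply: le_lt_trans (J_near ui uj) _.
  have := hN N (leqnn N).
  by rewrite ltr_pdivlMr// ltr_pdivrMr// => h; rewrite [4 / _]mulrC.
have key y : complex.Re (f y) = B x y.
  have step (t : R) : 0 <= 2 * t * (B x y - complex.Re (f y)) + t ^+ 2 * Q y.
    apply/ler_addgt0Pr => e e0; rewrite -lerBlDr sub0r.
    have [M M0 DM] := bop_bounded D.
    pose k := 2 * `|t| * M * nrm y + 1.
    have k1 : 0 < k.
      by rewrite ltr_wpDl// !mulr_ge0 ?nrm_ge0.
    have d0 : 0 < e / 2 / k by rewrite !divr_gt0.
    have e20 : 0 < e / 2 by rewrite divr_gt0.
    have [N1 hN1] := archi_small e20.
    have [N2 _ hN2] := ux _ d0.
    pose i := maxn N1 N2.
    have J1 : J (u i) < m + e / 2.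
      by apply: lt_trans (uJ i) _; rewrite ltrD2l hN1// leq_maxl.
    have := m_le (u i + t%:C *: y); rewrite J_var => h.
    have /ltW xi : nrm (x - u i) < e / 2 / k by apply: hN2; rewrite /= leq_maxr.
    have BB : 2 * t * (B (u i) y - B x y) <= e / 2.
      have -> : 2 * t * (B (u i) y - B x y) =
          complex.Re (inner (D (u i - x)) ((2 * t)%:C *: y)).
        by rewrite innerZr conjR Re_MR bopB innerBl ReD ReN.
      apply: le_trans (Re_inner_le _ _) _.
      rewrite nrmZ nrm_real normrM ger0_norm// mulrCA.
      have h1 : nrm (D (u i - x)) <= M * (e / 2 / k).
        by rewrite (le_trans (DM _))// ler_wpM2l// nrm_distC.
      apply: (@le_trans _ _ (2 * `|t| * (M * (e / 2 / k) * nrm y))).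
        by rewrite ler_wpM2l ?mulr_ge0// ler_wpM2r ?nrm_ge0.
      have -> : 2 * `|t| * (M * (e / 2 / k) * nrm y) = (k - 1) * (e / 2 / k).
        by rewrite /k; ring.
      rewrite [leRHS](_ : _ = k * (e / 2 / k)); last by field; rewrite gt_eqF.
      by rewrite ler_wpM2r ?gerBl//; exact: ltW.
    by lra.
  have Q0 : 0 <= Q y by exact/Re_ge0/D0.
  apply/esym/eqP; rewrite -subr_eq0; apply/negPn/negP => bn0.
  set b := _ - _ in step bn0.
  (* as b is not 0, the polynomial 2 t b + t^2 Q y takes negative values *)
  have Q1 : 0 < Q y + 1 by rewrite ltr_wpDl.
  have := step (- b / (Q y + 1)).
  have -> : 2 * (- b / (Q y + 1)) * b + (- b / (Q y + 1)) ^+ 2 * Q y =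
    - (b ^+ 2 * (Q y + 2) / (Q y + 1) ^+ 2) by field; rewrite gt_eqF.
  rewrite oppr_ge0 leNgt divr_gt0 ?exprn_gt0// mulr_gt0//.
    by rewrite lt_neqAle sqr_ge0 andbT eq_sym expf_eq0.
  by rewrite ltr_wpDl.
exists x => y.
have f0 : f 0 = 0.
  by apply: (addrI (f 0)); rewrite -{1}[f 0]mul1r -f_lin scaler0 !addr0.
have fi : f ('i%C *: y) = 'i%C * f y by rewrite -[_ *: y]addr0 f_lin f0 addr0.
have BE z : B x z = complex.Re (inner z (D x)).
  by rewrite /B -Re_conj -innerC.
have := key ('i%C *: y); have := key y; rewrite !BE fi innerZl.
case: (f y) => a1 a2; case: (inner _ _) => b1 b2 /= -> h; congr (_ +i* _); lra.
Qed.

End Representation.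

Section Adjoint.
Context {R : realType}.
Implicit Types H K : hilbertType R.

Lemma riesz H (f : H -> R[i]) (L : R) :
  (forall a x y, f (a *: x + y) = a * f x + f y) ->
  (forall x, nrm (f x : R[i]^o) <= L * nrm x) ->
  exists z, forall x, f x = inner x z.
Proof.
move=> fl fL; have [|z zP] := coercive_representation ltr01 bop_ge0_1 _ fl fL.
  by move=> x; rewrite bop_oneE inner_sqr mul1r.
by exists z => x; rewrite zP bop_oneE.
Qed.

Lemma coercive_invertible H (D : 'B(H)) (c : R) : 0 < c ->
  bop_ge0 (D - c%:C *: (1 : 'B(H))) -> bop_invertible D.
Proof.
move=> c0 Dc.
have D0 : bop_ge0 D.
  have -> : D = (D - c%:C *: (1 : 'B(H))) + c%:C *: (1 : 'B(H)) by rewrite subrK.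
  by apply: bop_ge0D => //; apply: bop_ge0Z (ltW c0) bop_ge0_1.
have Dc' x : c * nrm x ^+ 2 <= complex.Re (inner (D x) x).
  have := Re_ge0 (Dc x).
  by rewrite bopBE bopZE bop_oneE innerBl innerZl inner_sqr ReD ReN Re_MR subr_ge0.
have Dlb x : c * nrm x <= nrm (D x).
  have [x0|x0] := eqVneq (nrm x) 0; first by rewrite x0 mulr0 nrm_ge0.
  have xp : 0 < nrm x by rewrite lt_neqAle eq_sym x0 nrm_ge0.
  rewrite -(ler_pM2r xp) -mulrA -expr2.
  exact: le_trans (Dc' x) (Re_inner_le _ _).
have solve z : exists x, D x = z.
  have [|y|x xP] := @coercive_representation R H D c (fun y => inner y z) (nrm z) c0 D0 Dc'.
  - by move=> a x y; rewrite innerDl innerZl.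
  - by rewrite mulrC; exact: inner_nrm_le.
  by exists x; apply: inner_inj => y; rewrite innerC -xP -innerC.
have [g gP] := choice solve.
have Dinj x y : D x = D y -> x = y.
  move=> xy; apply/eqP; rewrite -subr_eq0; apply/eqP/nrm0_eq0/eqP.
  have := Dlb (x - y); rewrite bopB xy subrr nrm0 => h.
  by rewrite eq_le nrm_ge0 andbT -(pmulr_rle0 _ c0).
have gB : g \in bounded_operator.
  apply: (@linear_bounded_operator _ _ _ _ c^-1) => [a x y|x].
    by apply: Dinj; rewrite bopD bopZ !gP.
  by rewrite mulrC ler_pdivlMr// mulrC -{2}[x]gP.
exists (BOp gB); split; apply: bopP => x; rewrite bop_mulE bop_oneE /=; first exact: gP.
by apply: Dinj; rewrite gP.
Qed.

(** The value of the adjoint at y is the Riesz vector of x |-> <f x, y>. *)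
Lemma adjP H K (f : bop H K) x y : inner (f x) y = inner x (adj f y).
Proof.
suff : exists g : bop K H, forall x y, inner (f x) y = inner x (g y).
  by move=> exg; move: x y; exact: (@xgetPex _ 0 [set g : bop K H |
    forall x y, inner (f x) y = inner x (g y)] exg).
have [M M0 fM] := bop_bounded f.
have ex v : exists z, forall x, inner (f x) v = inner x z.
  apply: (@riesz _ (fun x => inner (f x) v) (M * nrm v)) => [a u w|u].
    by rewrite bopD bopZ innerDl innerZl.
  rewrite (le_trans (inner_nrm_le _ _))// mulrAC ler_wpM2r ?nrm_ge0//.
have [g gP] := choice ex.
have gB : g \in bounded_operator.
  apply: (@linear_bounded_operator _ _ _ _ M) => [a u w|u].
    apply: inner_inj => z; rewrite [LHS]innerC [RHS]innerC; congr (_^*%R).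
    by rewrite -gP !innerDr !innerZr -!gP.
  have [g0|g0] := eqVneq (nrm (g u)) 0; first by rewrite g0 mulr_ge0 ?nrm_ge0.
  have gp : 0 < nrm (g u) by rewrite lt_neqAle eq_sym g0 nrm_ge0.
  rewrite -(ler_pM2l gp) -expr2.
  have -> : nrm (g u) ^+ 2 = complex.Re (inner (g u) (g u)) by rewrite inner_sqr.
  rewrite -gP (le_trans (Re_inner_le _ _))// mulrA ler_wpM2r ?nrm_ge0//.
  by rewrite mulrC; exact: fM.
by exists (BOp gB).
Qed.

Lemma adj_unique H K (f : bop H K) (g : bop K H) :
  (forall x y, inner (f x) y = inner x (g y)) -> adj f = g.
Proof.
move=> fg; apply: bopP => y; apply: inner_inj => z.
by rewrite innerC -adjP fg -innerC.
Qed.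

Lemma adjK H K (f : bop H K) : adj (adj f) = f.
Proof. by apply: adj_unique => x y; rewrite innerC -adjP -innerC. Qed.

Lemma adj_inner H K (f : bop H K) x y : inner (adj f x) y = inner x (f y).
Proof. by rewrite adjP adjK. Qed.

Lemma adjM H (f g : 'B(H)) : adj (f * g) = adj g * adj f.
Proof. by apply: adj_unique => x y; rewrite !bop_mulE !adjP. Qed.

Lemma adjZ H K (c : R[i]) (f : bop H K) : adj (c *: f) = c^*%R *: adj f.
Proof.
by apply: adj_unique => x y; rewrite !bopZE innerZl innerZr conjCK adjP.
Qed.

Lemma adjD H K (f g : bop H K) : adj (f + g) = adj f + adj g.
Proof.
by apply: adj_unique => x y; rewrite !bopDE innerDl innerDr !adjP.
Qed.

Lemma adj1 H : adj (1 : 'B(H)) = 1.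
Proof. by apply: adj_unique => x y; rewrite !bop_oneE. Qed.

Lemma nrm_adj_le H K (f : bop H K) : nrm (adj f) <= nrm f.
Proof.
rewrite !nrm_bop; apply: opnorm_lub => y y1; set z := adj f y.
have [z0|z0] := eqVneq (nrm z) 0; first by rewrite z0 opnorm_ge0.
have zp : 0 < nrm z by rewrite lt_neqAle eq_sym z0 nrm_ge0.
rewrite -(ler_pM2r zp) -expr2.
have -> : nrm z ^+ 2 = complex.Re (inner (f z) y) by rewrite adjP inner_sqr.
rewrite (le_trans (Re_inner_le _ _))//.
by rewrite (le_trans (ler_piMr (nrm_ge0 _) y1))// opnormP.
Qed.

End Adjoint.

(** * Total families *)

Definition lincomb (R : realType) (I : Type) (V : lmodType R[i]) (v : I -> V)
  (s : seq (R[i] * I)) : V := \sum_(c <- s) c.1 *: v c.2.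

Section TotalFamilies.
Context {R : realType}.

(** One list of coefficients serves all families at once, which is what allows
    two families to be compared. *)
Lemma lincomb_axpy (I : Type) (a : R[i]) (s t : seq (R[i] * I)) :
  exists u, forall (V : lmodType R[i]) (v : I -> V),
    lincomb v u = a *: lincomb v s + lincomb v t.
Proof.
exists ([seq (a * c.1, c.2) | c <- s] ++ t) => V v.
rewrite /lincomb big_cat big_map /=; congr (_ + _).
by rewrite scaler_sumr; apply: eq_bigr => c _; rewrite scalerA.
Qed.

Lemma lincomb_unit (I : Type) (i : I) (V : lmodType R[i]) (v : I -> V) :
  lincomb v [:: (1, i)] = v i.
Proof. by rewrite /lincomb big_seq1 scale1r. Qed.

Lemma bop_lincomb (I : Type) (H K : hilbertType R) (f : bop H K) (v : I -> H) s :
  f (lincomb v s) = lincomb (f \o v) s.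
Proof. by rewrite /lincomb bop_sum; apply: eq_bigr => c _; rewrite bopZ. Qed.

Lemma nrm_triangle (V : normedModType R[i]) (x y z : V) :
  nrm (x - z) <= nrm (x - y) + nrm (y - z).
Proof. by apply: le_trans (nrmD _ _); rewrite addrA subrK. Qed.

Lemma total_approx (I : Type) (H : hilbertType R) (v : I -> H) :
  total_family v -> forall z (e : R), 0 < e -> exists s, nrm (z - lincomb v s) < e.
Proof.
move=> tv z e e0.
have : closure [set z : H | exists s : seq (R[i] * I),
    z = \sum_(c <- s) c.1 *: v c.2] z by rewrite tv.
have /cvg_nrmP/(_ e e0) : (id @ nbhs z --> z) by exact: cvg_id.
by move=> ze /(_ _ ze) [_ [[s ->]] /= h]; exists s.
Qed.

Lemma dense_total (I : Type) (H : hilbertType R) (v : I -> H) :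
  (forall z (e : R), 0 < e -> exists s, nrm (z - lincomb v s) < e) ->
  total_family v.
Proof.
move=> dv; apply/seteqP; split=> // z _ U /nbhs_ballP[e /= e0 eU].
have [E e0'] := gt0_ReE e0; have [s hs] := dv z _ e0'.
exists (lincomb v s); split; first by exists s.
by apply: eU; rewrite -ball_normE /= -E -nrmE ltcR.
Qed.

Section Extension.
Context {I : Type} {H K : hilbertType R} (v : I -> H) (w : I -> K) (M : R).
Hypotheses (tv : total_family v) (M0 : 0 <= M)
  (vw : forall s, nrm (lincomb w s) <= M * nrm (lincomb v s)).

Let graph x y := forall e : R, 0 < e ->
  exists s, nrm (x - lincomb v s) < e /\ nrm (y - lincomb w s) < e.

Let graph_unit i : graph (v i) (w i).
Proof. by move=> e e0; exists [:: (1, i)]; rewrite !lincomb_unit !subrr !nrm0. Qed.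

Let graph_axpy a x y x' y' : graph x y -> graph x' y' ->
  graph (a *: x + x') (a *: y + y').
Proof.
move=> xy xy' e e0; pose k := nrm (a : R[i]^o) + 1.
have k0 : 0 < k by rewrite ltr_wpDl ?(@nrm_ge0 R R[i]^o).
have [|s [sx sy]] := xy (e / k / 2); first by rewrite !divr_gt0.
have [|t [tx ty]] := xy' (e / 2); first by rewrite !divr_gt0.
have [u uP] := lincomb_axpy a s t; exists u; rewrite !uP.
have key (V : normedModType R[i]) (z z' b b' : V) : nrm (z - b) < e / k / 2 ->
    nrm (z' - b') < e / 2 -> nrm (a *: z + z' - (a *: b + b')) < e.
  move=> h1 h2; rewrite opprD addrACA -scalerBr.
  apply: le_lt_trans (nrmD _ _) _; rewrite [ltRHS]splitr ler_ltD// nrmZ.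
  apply: (@le_trans _ _ (k * (e / k / 2))).
    by rewrite ler_pM ?nrm_ge0 ?(@nrm_ge0 R R[i]^o) ?lerDl// ltW.
  by rewrite [leLHS](_ : _ = e / 2)//; field; rewrite gt_eqF.
by split; exact: key.
Qed.

Let graph_bound x y : graph x y -> nrm y <= M * nrm x.
Proof.
move=> xy; apply/ler_addgt0Pr => e e0.
have d0 : 0 < e / (M + 1) by rewrite divr_gt0// ltr_wpDl.
have [s [/ltW sx /ltW sy]] := xy _ d0.
have h1 : nrm y <= nrm (y - lincomb w s) + nrm (lincomb w s).
  by apply: le_trans (nrmD _ _); rewrite subrK.
have h2 : nrm (lincomb v s) <= nrm (x - lincomb v s) + nrm x.
  by rewrite nrm_distC; apply: le_trans (nrmD _ _); rewrite subrK.
apply: (le_trans h1); apply: (le_trans (lerD sy (vw s))).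
apply: (@le_trans _ _ (e / (M + 1) + M * (e / (M + 1) + nrm x))).
  by rewrite lerD2l ler_wpM2l// (le_trans h2)// lerD2r.
rewrite mulrDr addrA [leRHS]addrC lerD2r le_eqVlt.
by apply/orP; left; apply/eqP; field; rewrite gt_eqF// ltr_wpDl.
Qed.

Let graph_ex x : exists y, graph x y.
Proof.
have h n : exists s, nrm (x - lincomb v s) < n.+1%:R^-1.
  by apply: total_approx => //; rewrite invr_gt0.
have [s sP] := choice h.
have [e e0|y yP] := @cauchy_seq_nrm_cvg R K (fun n => lincomb w (s n)).
  have d0 : 0 < e / (2 * M + 1) by rewrite divr_gt0// ltr_wpDl// mulr_ge0.
  have [N hN] := archi_small d0; exists N => i j Ni Nj.
  have [u uP] := lincomb_axpy (-1) (s j) (s i).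
  have -> : lincomb w (s i) - lincomb w (s j) = lincomb w u.
    by rewrite uP scaleN1r addrC.
  apply: le_lt_trans (vw u) _; rewrite uP scaleN1r addrC.
  have h1 := nrm_triangle (lincomb v (s i)) x (lincomb v (s j)).
  rewrite [nrm (_ - x)]nrm_distC in h1.
  have h2 := ltW (lt_trans (sP i) (hN i Ni)).
  have h3 := ltW (lt_trans (sP j) (hN j Nj)).
  apply: (@le_lt_trans _ _ (M * (e / (2 * M + 1) + e / (2 * M + 1)))).
    by rewrite ler_wpM2l// (le_trans h1)// lerD.
  have -> : M * (e / (2 * M + 1) + e / (2 * M + 1)) = 2 * M * (e / (2 * M + 1)).
    by ring.
  rewrite [ltRHS](_ : _ = (2 * M + 1) * (e / (2 * M + 1))).
    by rewrite ltr_pM2r// ltrDl.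
  by field; rewrite gt_eqF// ltr_wpDl// mulr_ge0.
exists y => e e0; have [N hN] := archi_small e0; have [N' _ hN'] := yP _ e0.
exists (s (maxn N N')); split; last by apply: hN'; rewrite /= leq_maxr.
by apply: lt_trans (sP _) (hN _ _); rewrite leq_maxl.
Qed.

(** The closure of the set of pairs (lincomb v s, lincomb w s) is the graph of
    the extension: the bound makes it single-valued, and it is defined
    everywhere because v is total and K is complete. *)
Lemma extend_total : exists2 B : bop H K,
  (forall i, B (v i) = w i) & (forall x, nrm (B x) <= M * nrm x).
Proof.
have [g gP] := choice graph_ex.
have uniq x y y' : graph x y -> graph x y' -> y = y'.
  move=> h h'; have := graph_bound (graph_axpy (-1) h h').
  rewrite !scaleN1r addNr nrm0 mulr0 => yy.
  by apply/eqP; rewrite eq_sym -subr_eq0 addrC; apply/eqP/nrm0_eq0/le_anti; rewrite yy nrm_ge0.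
have gM x : nrm (g x) <= M * nrm x by exact: graph_bound.
have gB : g \in bounded_operator.
  apply: linear_bounded_operator gM => a x y.
  by apply: uniq (gP _) _; exact: graph_axpy.
by exists (BOp gB) => //= i; apply: uniq (gP _) _; exact: graph_unit.
Qed.

End Extension.

Lemma total_bop_ext (I : Type) (H K : hilbertType R) (v : I -> H) (f g : bop H K) :
  total_family v -> (forall i, f (v i) = g (v i)) -> f = g.
Proof.
move=> tv fg; apply: bopP => x; apply/eqP; rewrite -subr_eq0 -bopBE.
apply/eqP/nrm0_eq0/le_anti; rewrite nrm_ge0 andbT.
have [M M0 hM] := bop_bounded (f - g); apply/ler_addgt0Pr => e e0.
have d0 : 0 < e / (M + 1) by rewrite divr_gt0// ltr_wpDl.
have [s /ltW hs] := total_approx tv x d0.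
have fgs : (f - g) (lincomb v s) = 0.
  rewrite bopBE !bop_lincomb; apply/eqP; rewrite subr_eq0; apply/eqP.
  by apply: eq_bigr => c _ /=; rewrite fg.
rewrite -[x](subrK (lincomb v s)) bopD fgs addr0 add0r (le_trans (hM _))//.
apply: (@le_trans _ _ ((M + 1) * (e / (M + 1)))).
  by rewrite ler_pM ?nrm_ge0// lerDl.
by rewrite mulrC divfK// gt_eqF// ltr_wpDl.
Qed.

Lemma total_orth (I : Type) (H : hilbertType R) (v : I -> H) (x : H) :
  total_family v -> (forall i, inner x (v i) = 0) -> x = 0.
Proof.
move=> tv xv; have [x0|x0] := eqVneq (nrm x) 0; first exact: nrm0_eq0.
have xp : 0 < nrm x by rewrite lt_neqAle eq_sym x0 nrm_ge0.
have [s hs] := total_approx tv x xp.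
have : inner x (lincomb v s) = 0.
  by rewrite inner_sumr big1// => c _; rewrite innerZr xv mulr0.
have := Re_inner_le x (x - lincomb v s); rewrite innerBr => + e0.
by rewrite e0 subr0 inner_sqr ReC expr2 ler_pM2l// leNgt hs.
Qed.

Lemma total_inner_ext (I : Type) (H : hilbertType R) (v : I -> H) (x y : H) :
  total_family v -> (forall i, inner x (v i) = inner y (v i)) -> x = y.
Proof.
move=> tv xy; apply/eqP; rewrite -subr_eq0; apply/eqP/(total_orth tv) => i.
by rewrite innerBl xy subrr.
Qed.

Lemma nrm_bop_total (I : Type) (H K : hilbertType R) (v : I -> H) (f : bop H K)
    (M : R) : total_family v -> 0 <= M ->
  (forall s, nrm (f (lincomb v s)) <= M * nrm (lincomb v s)) -> nrm f <= M.
Proof.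
move=> tv M0 fM; have [|B Bv BM] := @extend_total _ _ _ v (f \o v) M tv M0.
  by move=> s; rewrite -bop_lincomb.
have <- : B = f by apply: (total_bop_ext tv).
rewrite nrm_bop; apply: opnorm_lub => x x1.
by rewrite (le_trans (BM x))// ler_piMr.
Qed.

End TotalFamilies.

(** * Gram kernels and operators on tensor products *)

Section Factorable.
Context {R : realType} {I : eqType}.
Implicit Types (s : seq I) (G : I -> I -> R[i]).

(** Such kernels are the positive semidefinite matrices indexed by the list. *)
Definition factorable s G := exists cs : seq (I -> R[i]),
  forall a b, a \in s -> b \in s -> G a b = \sum_(f <- cs) f a * (f b)^*%R.

(** The Schur product theorem: a product of rank one kernels has rank one. *)
Lemma factorableM s G1 G2 : factorable s G1 -> factorable s G2 ->
  factorable s (fun a b => G1 a b * G2 a b).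
Proof.
move=> [c1 h1] [c2 h2].
exists [seq (fun a => f a * g a) | f <- c1, g <- c2] => a b sa sb.
rewrite h1// h2// mulr_suml big_allpairs_dep /=; apply: eq_bigr => f _.
rewrite mulr_sumr; apply: eq_bigr => g _.
by rewrite rmorphM mulrACA.
Qed.

Lemma factorable_prod (J : Type) (r : seq J) (P : pred J) s
    (G : J -> I -> I -> R[i]) : (forall j, factorable s (G j)) ->
  factorable s (fun a b => \prod_(j <- r | P j) G j a b).
Proof.
move=> h; elim: r => [|j r [c hc]].
  by exists [:: fun=> 1] => a b _ _; rewrite big_seq1 big_nil conjC1 mulr1.
case Pj : (P j); last by exists c => a b sa sb; rewrite big_cons Pj hc.
have [|c' hc'] := @factorableM s (G j) (fun a b => \prod_(j <- r | P j) G j a b) (h j).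
  by exists c.
by exists c' => a b sa sb; rewrite big_cons Pj hc'.
Qed.

(** Cholesky elimination: subtracting from all vectors their component along
    the first one leaves a Gram matrix supported on the others. *)
Lemma gram_factorable (H : hilbertType R) (D : 'B(H)) (v : I -> H) s :
  bop_ge0 D -> factorable s (fun a b => inner (D (v a)) (v b)).
Proof.
move=> D0; elim: s v => [|i s IH] v; first by exists [::].
pose d := complex.Re (inner (D (v i)) (v i)).
have dE : inner (D (v i)) (v i) = d%:C by rewrite ge0_ReE.
have d0 : 0 <= d by exact/Re_ge0.
pose G a b := inner (D (v a)) (v b).
have [c hc] := IH (fun a => v a - (G a i / d%:C) *: v i).
pose f0 a := G a i / (Num.sqrt d)%:C.
(* cutting a factor off at i is harmless, as the reduced kernel vanishes there *)
pose ext (f : I -> R[i]) a := if a == i then 0 else f a.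
exists (f0 :: map ext c) => a b sa sb; rewrite big_cons big_map -/(G a b).
have f0E : f0 a * (f0 b)^*%R = G a i * (G b i)^*%R / d%:C.
  rewrite /f0 rmorphM /= fmorphV /= conjR mulrACA -invfM -rmorphM /=.
  by rewrite -expr2 sqr_sqrtr.
have GC x y : (G x y)^*%R = G y x by rewrite [RHS]bop_ge0_conj.
have G0 x : d = 0 -> G x i = 0.
  move=> d00; have := cauchy_schwarz D0 (v x) (v i); rewrite -/(G x i).
  rewrite dE d00 mulr0 => h; apply/eqP; rewrite -normr_eq0 -sqrf_eq0 normCK.
  by apply/eqP/le_anti; rewrite h mul_conjC_ge0.
have Gii : G i i = d%:C by [].
rewrite f0E; have [->|d1] := eqVneq a i.
  rewrite [X in _ + X]big1 => [|f _]; last by rewrite /ext eqxx mul0r.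
  rewrite addr0 Gii GC; have [d00|dn0] := eqVneq d 0.
    by rewrite d00 mul0r mul0r -GC G0// conjC0.
  by rewrite mulrAC divff ?mul1r// (inj_eq (@complexI R)).
have [bi|d2] := eqVneq b i.
  rewrite [X in _ + X]big1 => [|f _]; last by rewrite bi /ext eqxx conjC0 mulr0.
  rewrite bi addr0 Gii conjR; have [d00|dn0] := eqVneq d 0.
    by rewrite G0// !mul0r.
  by rewrite mulfK// (inj_eq (@complexI R)).
have sa' : a \in s by move: sa; rewrite inE (negbTE d1).
have sb' : b \in s by move: sb; rewrite inE (negbTE d2).
have := hc a b sa' sb'.
rewrite bopB bopZ !innerBl !innerBr !innerZl !innerZr -!/(G _ _) Gii.
rewrite rmorphM /= fmorphV /= conjR GC => e.
have -> : \sum_(j <- c) ext j a * (ext j b)^*%R = \sum_(f <- c) f a * (f b)^*%R.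
  by apply: eq_bigr => f _; rewrite /ext (negbTE d1) (negbTE d2).
rewrite -e; have [d00|dn0] := eqVneq d 0.
  by rewrite d00 invr0 !(mulr0,mul0r) !subr0 add0r.
have dC : d%:C != 0 :> R[i] by rewrite (inj_eq (@complexI R)).
by field.
Qed.

End Factorable.

Section KernelBounds.
Context {R : realType}.

(** A factorisation of G splits the form into one copy of the form of D for
    each factor. *)
Lemma inner_lincomb (I : eqType) (U H : hilbertType R) (D : 'B(H))
    (u' u : I -> U) (x : I -> H) (G : I -> I -> R[i]) (s : seq (R[i] * I))
    (cs : seq (I -> R[i])) :
  (forall a b, a \in map snd s -> b \in map snd s ->
     G a b = \sum_(f <- cs) f a * (f b)^*%R) ->
  (forall a b, inner (u' a) (u b) = inner (D (x a)) (x b) * G a b) ->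
  inner (lincomb u' s) (lincomb u s) =
  \sum_(f <- cs) inner (D (\sum_(c <- s) (c.1 * f c.2) *: x c.2))
                       (\sum_(c <- s) (c.1 * f c.2) *: x c.2).
Proof.
move=> hG hu; rewrite inner_suml.
transitivity (\sum_(c <- s) \sum_(c' <- s) \sum_(f <- cs)
   (c.1 * f c.2) * (c'.1 * f c'.2)^*%R * inner (D (x c.2)) (x c'.2)).
  apply: eq_big_seq => c sc; rewrite innerZl inner_sumr mulr_sumr.
  apply: eq_big_seq => c' sc'; rewrite innerZr hu hG ?map_f// mulr_sumr.
  rewrite !mulr_sumr; apply: eq_bigr => f _; rewrite rmorphM; ring.
under eq_bigr do rewrite exchange_big /=.
rewrite exchange_big /=; apply: eq_bigr => f _.
rewrite bop_sum inner_suml; apply: eq_bigr => c _.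
rewrite inner_sumr; apply: eq_bigr => c' _.
rewrite bopZ innerZl innerZr; ring.
Qed.

(** In each of the copies given by a factorisation of G the operator A acts
    alone, so that its norm bounds the whole. *)
Lemma kernel_contract (I : eqType) (U U' H H' : hilbertType R) (A : bop H H')
    (u : I -> U) (u' : I -> U') (x : I -> H) (G : I -> I -> R[i])
    (s : seq (R[i] * I)) :
  factorable (map snd s) G ->
  (forall a b, inner (u a) (u b) = inner (x a) (x b) * G a b) ->
  (forall a b, inner (u' a) (u' b) = inner (A (x a)) (A (x b)) * G a b) ->
  nrm (lincomb u' s) <= nrm A * nrm (lincomb u s).
Proof.
move=> [cs hcs] hu hu'.
rewrite -(@ler_pXn2r _ 2)// ?nnegrE ?mulr_ge0 ?nrm_ge0// exprMn.
rewrite -lecR [leRHS]rmorphM /= -(inner_sqr (lincomb u s)) -(inner_sqr (lincomb u' s)).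
rewrite (@inner_lincomb _ _ _ 1 u u x G _ cs)//.
rewrite (@inner_lincomb _ _ _ 1 u' u' (A \o x) G _ cs)//.
rewrite mulr_sumr; apply: ler_sum => f _; rewrite !bop_oneE.
have -> : \sum_(c <- s) (c.1 * f c.2) *: (A \o x) c.2 =
    A (\sum_(c <- s) (c.1 * f c.2) *: x c.2).
  by rewrite bop_sum; apply: eq_bigr => c _; rewrite bopZ.
rewrite !inner_sqr -rmorphM lecR -exprMn ler_pXn2r ?nnegrE ?mulr_ge0 ?nrm_ge0//.
by rewrite nrm_bop opnormP.
Qed.

End KernelBounds.

Section TensorOperators.
Context {R : realType} {K H : hilbertType R} (T : htensor K H).

Lemma tensZl c x y : tens T (c *: x) y = c *: tens T x y.
Proof.
have l := @tens_linearl _ _ _ T y.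
have t0 : tens T 0 y = 0.
  by apply: (addrI (tens T 0 y)); have := l 1 0 0; rewrite !scale1r !addr0.
by have := l c x 0; rewrite t0 !addr0.
Qed.

Lemma tensZr c x y : tens T x (c *: y) = c *: tens T x y.
Proof.
have l := @tens_linearr _ _ _ T x.
have t0 : tens T x 0 = 0.
  by apply: (addrI (tens T x 0)); have := l 1 0 0; rewrite !scale1r !addr0.
by have := l c y 0; rewrite t0 !addr0.
Qed.

Lemma tensDr x y y' : tens T x (y + y') = tens T x y + tens T x y'.
Proof. by have := @tens_linearr _ _ _ T x 1 y y'; rewrite !scale1r. Qed.

Let basis (xy : K * H) := tens T xy.1 xy.2.

(** A (x) X is the product of A (x) I and I (x) X; in each of them the idle
    factor enters inner products only through its Gram kernel. *)
Lemma tensopE (A : 'B(K)) (X : 'B(H)) x y :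
  tensop T A X (tens T x y) = tens T (A x) (X y).
Proof.
suff exB : exists B : 'B(T), forall x y, B (tens T x y) = tens T (A x) (X y).
  by move: x y; exact: (@xgetPex _ 0 [set B : 'B(T) |
    forall x y, B (tens T x y) = tens T (A x) (X y)] exB).
have [|B1 B1E _] := @extend_total _ _ _ _ basis
    (fun xy => tens T (A xy.1) xy.2) (nrm A) (@tens_total _ _ _ T) (nrm_ge0 _).
  move=> s; apply: (@kernel_contract _ _ _ _ _ _ A basis _ fst
    (fun a b => inner a.2 b.2)).
  - exact: (@gram_factorable _ _ _ 1 snd _ bop_ge0_1).
  - by move=> a b; rewrite inner_tens.
  - by move=> a b; rewrite inner_tens.
have [|B2 B2E _] := @extend_total _ _ _ _ basis
    (fun xy => tens T xy.1 (X xy.2)) (nrm X) (@tens_total _ _ _ T) (nrm_ge0 _).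
  move=> s; apply: (@kernel_contract _ _ _ _ _ _ X basis _ snd
    (fun a b => inner a.1 b.1)).
  - exact: (@gram_factorable _ _ _ 1 fst _ bop_ge0_1).
  - by move=> a b; rewrite inner_tens mulrC.
  - by move=> a b; rewrite inner_tens mulrC.
exists (B1 * B2) => u v; rewrite bop_mulE.
by rewrite (B2E (u, v)) /= (B1E (u, X v)).
Qed.

Lemma tens_bop_ext (L : hilbertType R) (f g : bop T L) :
  (forall x y, f (tens T x y) = g (tens T x y)) -> f = g.
Proof. by move=> fg; apply: (total_bop_ext (@tens_total _ _ _ T)) => -[]. Qed.

Lemma tensopZ c (A : 'B(K)) (X : 'B(H)) :
  tensop T A (c *: X) = c *: tensop T A X.
Proof.
by apply: tens_bop_ext => x y; rewrite bopZE !tensopE bopZE tensZr.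
Qed.

Lemma tensopZZ c (A : 'B(K)) (X : 'B(H)) :
  tensop T A (c *: X) = tensop T (c *: A) X.
Proof.
by apply: tens_bop_ext => x y; rewrite !tensopE !bopZE tensZr tensZl.
Qed.

Lemma adj_tensop (A : 'B(K)) (X : 'B(H)) :
  adj (tensop T A X) = tensop T (adj A) (adj X).
Proof.
apply: tens_bop_ext => x y.
apply: (total_inner_ext (@tens_total _ _ _ T)) => -[x' y'] /=.
by rewrite adj_inner !tensopE !inner_tens !adj_inner.
Qed.

End TensorOperators.

Section BigTensorOperators.
Context {R : realType} {k : nat} {H : 'I_k -> hilbertType R} (T : hbigtensor H).

Lemma bigtensZ (x : forall i, H i) i c (y : H i) :
  bigtens T (dfwith x i (c *: y)) = c *: bigtens T (dfwith x i y).
Proof.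
have l := @bigtens_linear _ _ _ T x i.
set g := fun y => _ in l; rewrite -[LHS]/(g _) -[bigtens _ _ in RHS]/(g _).
have g0 : g 0 = 0.
  by apply: (addrI (g 0)); have := l 1 0 0; rewrite !scale1r !addr0.
by have := l c y 0; rewrite g0 !addr0.
Qed.

(** The idle factors enter inner products through a product of Gram kernels. *)
Lemma bigtensopE (i : 'I_k) (A : 'B(H i)) x :
  bigtensop T A (bigtens T x) = bigtens T (dfwith x i (A (x i))).
Proof.
suff exB : exists B : 'B(T), forall x,
    B (bigtens T x) = bigtens T (dfwith x i (A (x i))).
  by move: x; exact: (@xgetPex _ 0 [set B : 'B(T) |
    forall x, B (bigtens T x) = bigtens T (dfwith x i (A (x i)))] exB).
have [|B BE _] := @extend_total _ _ _ _ (bigtens T)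
    (fun x => bigtens T (dfwith x i (A (x i)))) (nrm A) (@bigtens_total _ _ _ T)
    (nrm_ge0 _); last by exists B.
move=> s; apply: (@kernel_contract _ _ _ _ _ _ A _ _ (fun x => x i)
  (fun a b => \prod_(j < k | j != i) inner (a j) (b j))).
- apply: factorable_prod => j.
  exact: (@gram_factorable _ _ _ 1 (fun x => x j) _ bop_ge0_1).
- by move=> a b; rewrite inner_bigtens (bigD1 i).
- move=> a b; rewrite inner_bigtens (bigD1 i)//= !dfwithin; congr (_ * _).
  by apply: eq_bigr => j ji; rewrite !dfwithout// eq_sym.
Qed.

End BigTensorOperators.

(** * The coefficients of the resolvent series *)

Section Words.
Context {n : nat}.
Implicit Types (v w : seq 'I_n).

Definition words_lt (m : nat) : seq (seq 'I_n) :=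
  [seq w <- map val (enum {: m.-bseq 'I_n}) | (size w < m)%N].

Lemma mem_words_lt m w : (w \in words_lt m) = (size w < m)%N.
Proof.
rewrite mem_filter; case: ltnP => //= wm; apply/mapP.
by exists (Bseq (ltnW wm)) => //; rewrite mem_enum.
Qed.

Lemma words_lt_uniq m : uniq (words_lt m).
Proof. by rewrite filter_uniq// map_inj_uniq ?enum_uniq//; exact: val_inj. Qed.

Lemma cat_eq_prefix v w u : (v ++ u == w) = prefix v w && (u == drop (size v) w).
Proof.
apply/eqP/andP => [<-|[/prefixP[t ->] /eqP ->]].
  by rewrite prefix_prefix drop_size_cat.
by rewrite drop_size_cat.
Qed.

End Words.

Section Coefficients.
Context {R : realType} {n : nat}.
Variable (q : ncpoly R n).
Hypothesis hq : positive_regular q.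
Implicit Types (alpha beta gamma : seq 'I_n).

(** The sum over factorisations into p nonempty words; the bound m on the
    length of the factors is immaterial once it exceeds the total length. *)
Let B (m p : nat) alpha : R :=
  \sum_(gamma : p.-tuple (m.-bseq 'I_n) |
          (flatten (factors gamma) == alpha)
          && all (fun w => 0 < size w)%N (factors gamma))
      \prod_(w <- factors gamma) q w.

Let B0 m alpha : B m 0 alpha = (alpha == [::])%:R.
Proof.
rewrite /B big_mkcond (bigD1 [tuple])//= [X in _ + X]big1 => [|t]; last first.
  by move=> /negP[]; apply/eqP; exact: tuple0.
by rewrite addr0 big_nil andbT eq_sym; case: eqP.
Qed.

Let BS m p alpha : (size alpha <= m)%N ->
  B m p.+1 alpha =
    \sum_(gamma <- finsupp q | prefix gamma alpha)
      q gamma * B m p (drop (size gamma) alpha).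
Proof.
move=> am; rewrite /B.
pose cns (wt : m.-bseq 'I_n * p.-tuple (m.-bseq 'I_n)) := cons_tuple wt.1 wt.2.
rewrite (reindex cns) /=; last first.
  exists (fun t => (thead t, behead_tuple t)) => [[w t] _|t _].
    by congr (_, _) => //; exact/val_inj.
  by apply/val_inj; rewrite /= [in RHS](tuple_eta t).
rewrite (eq_bigl (fun wt : m.-bseq 'I_n * p.-tuple (m.-bseq 'I_n) =>
  (prefix wt.1 alpha && (0 < size wt.1)%N) &&
  ((flatten (factors wt.2) == drop (size wt.1) alpha) &&
   all (fun w => 0 < size w)%N (factors wt.2)))); last first.
  by move=> [w t] /=; rewrite cat_eq_prefix -!andbA; do !bool_congr.
rewrite -(pair_big_dep (fun w : m.-bseq 'I_n => prefix w alpha && (0 < size w)%N)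
  (fun w t => (flatten (factors t) == drop (size w) alpha) &&
   all (fun w => 0 < size w)%N (factors t))
  (fun w t => \prod_(w <- factors (cns (w, t))) q w)) /=.
under eq_bigr do under eq_bigr do rewrite /factors /= big_cons.
under eq_bigr do rewrite -mulr_sumr -/(B m p _).
pose F gamma := q gamma * B m p (drop (size gamma) alpha).
have -> : \sum_(w : m.-bseq 'I_n | prefix w alpha && (0 < size w)%N) F w =
   \sum_(gamma <- map val (enum {: m.-bseq 'I_n}) | prefix gamma alpha
      && (0 < size gamma)%N) F gamma by rewrite big_map big_enum_cond.
have F0 gamma : gamma \notin finsupp q -> F gamma = 0.
  by move=> h; rewrite /F fsfun_dflt// mul0r.
rewrite (bigID (fun g => g \in finsupp q)) /= [X in _ + X]big1 ?addr0; last first.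
  by move=> g /andP[_ /F0].
rewrite -big_filter -[RHS]big_filter; apply: perm_big; apply: uniq_perm.
- by rewrite filter_uniq// map_inj_uniq ?enum_uniq//; exact: val_inj.
- by rewrite filter_uniq// fset_uniq.
move=> g; rewrite !mem_filter.
have [ga|//] := boolP (prefix g alpha).
have [gq|] := boolP (g \in finsupp q); last by rewrite !andbF.
have -> : (0 < size g)%N.
  by case: g gq {ga} => //; rewrite mem_finsupp; case: hq => _ ->; rewrite eqxx.
rewrite /=; apply/mapP.
have gm : (size g <= m)%N by rewrite (leq_trans _ am)// size_prefix.
by exists (Bseq gm) => //; rewrite mem_enum.
Qed.

Let Bindep p m m' alpha : (size alpha <= m)%N -> (size alpha <= m')%N ->
  B m p alpha = B m' p alpha.
Proof.
elim: p alpha => [|p IH] alpha am am'; first by rewrite !B0.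
rewrite !BS//; apply: eq_bigr => g _; congr (_ * _).
by apply: IH; rewrite size_drop (leq_trans (leq_subr _ _)).
Qed.

Let finsupp_neq0 gamma : gamma \in finsupp q -> (0 < size gamma)%N.
Proof.
by case: gamma => //; rewrite mem_finsupp; case: hq => _ ->; rewrite eqxx.
Qed.

Let Blarge p m alpha : (size alpha <= m)%N -> (size alpha < p)%N ->
  B m p alpha = 0.
Proof.
elim: p alpha => // p IH alpha am ap.
rewrite BS// big_seq_cond big1// => g /andP[/finsupp_neq0 g0 /size_prefix ga].
rewrite IH ?mulr0// size_drop; first exact: leq_trans (leq_subr _ _) am.
by rewrite ltn_subLR// (leq_trans ap)// -add1n leq_add2r.
Qed.

Lemma bcoef_nil : bcoef q [::] = 1. Proof. by []. Qed.

Let bcoefE m alpha : (size alpha < m)%N ->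
  bcoef q alpha = \sum_(0 <= p < m) B m p alpha.
Proof.
move=> am.
have -> : \sum_(0 <= p < m) B m p alpha =
    \sum_(0 <= p < (size alpha).+1) B (size alpha) p alpha.
  rewrite (big_cat_nat _ (n := (size alpha).+1))//= [X in _ + X]big_nat_cond.
  rewrite [X in _ + X]big1 ?addr0 => [|p /andP[/andP[ap _] _]].
    by apply: eq_bigr => p _; apply: Bindep => //; exact: ltnW.
  by rewrite Blarge//; exact: ltnW.
rewrite /bcoef; case: eqP => [->|/eqP a0]; first by rewrite big_nat1 B0.
by rewrite [RHS]big_ltn// B0 (negbTE a0) add0r.
Qed.

(** Grouping the factorisations of a word by their first factor. *)
Lemma bcoef_rec alpha : alpha != [::] -> bcoef q alpha =
  \sum_(gamma <- finsupp q | prefix gamma alpha)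
     q gamma * bcoef q (drop (size gamma) alpha).
Proof.
move=> a0; rewrite (@bcoefE (size alpha).+1)// big_ltn// B0 (negbTE a0) add0r.
rewrite big_add1 /=.
have -> : \sum_(0 <= p < size alpha) B (size alpha).+1 p.+1 alpha =
  \sum_(gamma <- finsupp q | prefix gamma alpha)
     \sum_(0 <= p < size alpha) q gamma * B (size alpha) p (drop (size gamma) alpha).
  rewrite exchange_big /=; apply: eq_bigr => p _.
  rewrite BS//; apply: eq_bigr => g _; congr (_ * _).
  apply: Bindep; rewrite size_drop ?leq_subr//.
  exact: leq_trans (leq_subr _ _) (leqnSn _).
rewrite big_seq_cond [RHS]big_seq_cond; apply: eq_bigr => g /andP[/finsupp_neq0 g0 ga].
by rewrite -mulr_sumr -bcoefE// size_drop ltn_subrL g0 lt0n size_eq0.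
Qed.

Let bcoef_lb j beta : (forall gamma, (size gamma <= size beta)%N ->
  0 <= bcoef q gamma) -> q [:: j] * bcoef q beta <= bcoef q (j :: beta).
Proof.
move=> IH; have [q0 q00 q1] := hq.
rewrite (@bcoef_rec (j :: beta))// -big_filter (bigD1_seq [:: j]) /=; last 2 first.
- by rewrite mem_filter /= eqxx ?prefix0s mem_finsupp gt_eqF.
- by rewrite filter_uniq// fset_uniq.
rewrite drop0 lerDl big_filter_cond; apply: sumr_ge0 => -[|l g] /andP[gp gj].
  by rewrite q00 mul0r.
by rewrite mulr_ge0// IH//= size_drop leq_subr.
Qed.

Lemma bcoef_gt0 alpha : 0 < bcoef q alpha.
Proof.
have [N] := ubnP (size alpha); elim: N alpha => // N IH [|j alpha] aN.
  by rewrite bcoef_nil.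
apply: (@lt_le_trans _ _ (q [:: j] * bcoef q alpha)).
  by have [_ _ q1] := hq; rewrite mulr_gt0// IH.
by apply: bcoef_lb => g ga; apply/ltW/IH; exact: leq_ltn_trans ga aN.
Qed.

(** The weights of the shifts are therefore bounded. *)
Lemma bcoef_cons_ge j beta : q [:: j] * bcoef q beta <= bcoef q (j :: beta).
Proof. by apply: bcoef_lb => g _; exact/ltW/bcoef_gt0. Qed.

(** The coefficients b are those of the Neumann series of q: a nonempty word
    is split after the first factor of its factorisations. *)
Lemma sum_words_rec (V : lmodType R[i]) (g : seq 'I_n -> V) m : (0 < m)%N ->
  \sum_(alpha <- words_lt m) (bcoef q alpha)%:C *: g alpha = g [::] +
  \sum_(gamma <- finsupp q) (q gamma)%:C *:
     \sum_(beta <- words_lt (m - size gamma))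
        (bcoef q beta)%:C *: g (gamma ++ beta).
Proof.
move=> m0; rewrite (bigD1_seq [::]) ?words_lt_uniq ?mem_words_lt//=.
rewrite bcoef_nil scale1r; congr (_ + _).
transitivity (\sum_(alpha <- words_lt m | alpha != [::])
  \sum_(gamma <- finsupp q | prefix gamma alpha)
    (q gamma)%:C *: ((bcoef q (drop (size gamma) alpha))%:C *: g alpha)).
  apply: eq_bigr => a a0; rewrite bcoef_rec// rmorph_sum scaler_suml.
  by apply: eq_bigr => c _; rewrite rmorphM scalerA.
rewrite (exchange_big_dep xpredT)//=.
rewrite big_seq [RHS]big_seq; apply: eq_bigr => c cq.
rewrite -scaler_sumr; congr (_ *: _).
have c0 := finsupp_neq0 cq.
have -> : \sum_(b <- words_lt (m - size c)) (bcoef q b)%:C *: g (c ++ b) =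
  \sum_(a <- [seq c ++ b | b <- words_lt (m - size c)])
     (bcoef q (drop (size c) a))%:C *: g a.
  by rewrite big_map; apply: eq_bigr => b _; rewrite drop_size_cat.
rewrite -big_filter; apply: perm_big; apply: uniq_perm.
- by rewrite filter_uniq// words_lt_uniq.
- by rewrite map_inj_uniq ?words_lt_uniq// => a b /eqP; rewrite eqseq_cat// eqxx => /eqP.
move=> a; rewrite mem_filter mem_words_lt; apply/andP/mapP.
  move=> [/andP[a0 /prefixP[b ab]] am]; exists b => //.
  by rewrite mem_words_lt ltn_subRL -size_cat -ab.
move=> [b]; rewrite mem_words_lt => bm ->; rewrite prefix_prefix size_cat.
by split; [case: (c) c0|rewrite -ltn_subRL].
Qed.

End Coefficients.

(** * Completely positive maps built from words *)

Section ConjugationSums.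
Context {R : realType} {H : hilbertType R}.
Implicit Types (Y Z : 'B(H)) (I J : Type).

Lemma bop_scalerAl (c : R[i]) (f g : 'B(H)) : c *: (f * g) = (c *: f) * g.
Proof. exact: bopP. Qed.

Lemma bop_scalerAr (c : R[i]) (f g : 'B(H)) : c *: (f * g) = f * (c *: g).
Proof. by apply: bopP => x; rewrite bopZE !bop_mulE bopZE bopZ. Qed.

Definition conj_sum I (s : seq I) (c : I -> R) (a : I -> 'B(H)) Y : 'B(H) :=
  \sum_(i <- s) (c i)%:C *: (a i * Y * adj (a i)).

Lemma conj_sumB I s c (a : I -> 'B(H)) Y Z :
  conj_sum s c a (Y - Z) = conj_sum s c a Y - conj_sum s c a Z.
Proof.
rewrite /conj_sum -sumrB; apply: eq_bigr => i _.
by rewrite mulrBr mulrBl scalerBr.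
Qed.

Lemma conj_sumD I s c (a : I -> 'B(H)) Y Z :
  conj_sum s c a (Y + Z) = conj_sum s c a Y + conj_sum s c a Z.
Proof.
rewrite /conj_sum -big_split; apply: eq_bigr => i _.
by rewrite mulrDr mulrDl scalerDr.
Qed.

Lemma conj_sum0 I s c (a : I -> 'B(H)) : conj_sum s c a 0 = 0.
Proof. by have := conj_sumB s c a 0 0; rewrite !subrr. Qed.

Lemma conj_sum_sum I J s c (a : I -> 'B(H)) (t : seq J) (F : J -> 'B(H)) :
  conj_sum s c a (\sum_(j <- t) F j) = \sum_(j <- t) conj_sum s c a (F j).
Proof.
elim: t => [|j t IH]; first by rewrite !big_nil conj_sum0.
by rewrite !big_cons -IH conj_sumD.
Qed.

Lemma conj_sumZ I s c (a : I -> 'B(H)) (r : R) Y :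
  conj_sum s c a (r%:C *: Y) = r%:C *: conj_sum s c a Y.
Proof.
rewrite /conj_sum scaler_sumr; apply: eq_bigr => i _.
rewrite -bop_scalerAr -bop_scalerAl !scalerA; congr (_ *: _); exact: mulrC.
Qed.

Lemma conj_ge0 (a : 'B(H)) Y : bop_ge0 Y -> bop_ge0 (a * Y * adj a).
Proof. by move=> Y0 x; rewrite !bop_mulE adjP. Qed.

Lemma conj_sumC I J s c (a : I -> 'B(H)) t d (b : J -> 'B(H)) Y :
  (forall i j, a i * b j = b j * a i) ->
  conj_sum s c a (conj_sum t d b Y) = conj_sum t d b (conj_sum s c a Y).
Proof.
move=> ab; rewrite /(conj_sum t) conj_sum_sum.
rewrite /conj_sum.
apply: eq_bigr => j _.
rewrite mulr_sumr mulr_suml scaler_sumr; apply: eq_bigr => i _.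
rewrite -!(bop_scalerAr, bop_scalerAl) !scalerA [(d j)%:C * _]mulrC; congr (_ *: _).
have ab' : adj (b j) * adj (a i) = adj (a i) * adj (b j) by rewrite -!adjM ab.
by rewrite !mulrA ab -!mulrA ab'.
Qed.

End ConjugationSums.

Section Monomials.
Context {R : realType} {H : hilbertType R} {n : nat}.
Implicit Types (X : 'I_n -> 'B(H)) (q : ncpoly R n) (w : seq 'I_n).

Lemma monomial_nil X : monomial X [::] = 1.
Proof. by rewrite /monomial big_nil. Qed.

Lemma monomial_cons X j w : monomial X (j :: w) = X j * monomial X w.
Proof. by rewrite /monomial big_cons. Qed.

Lemma monomial_cat X v w : monomial X (v ++ w) = monomial X v * monomial X w.
Proof. by rewrite /monomial big_cat. Qed.

Lemma monomial_comm X (Y : 'B(H)) w :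
  (forall j, X j * Y = Y * X j) -> monomial X w * Y = Y * monomial X w.
Proof.
move=> XY; elim: w => [|j w IH]; first by rewrite monomial_nil mulr1 mul1r.
by rewrite monomial_cons -mulrA IH !mulrA XY.
Qed.

Lemma monomial_scale X (c : R) w :
  monomial (fun j => c%:C *: X j) w = (c ^+ size w)%:C *: monomial X w.
Proof.
elim: w => [|j w IH]; first by rewrite !monomial_nil scale1r.
by rewrite !monomial_cons IH -bop_scalerAr -bop_scalerAl scalerA -rmorphM exprSr.
Qed.

Lemma PhiE q X Y : Phi q X Y = conj_sum (finsupp q) q (monomial X) Y.
Proof. by []. Qed.

Lemma Phi_scale q X (c : R) Y : Phi q (fun j => c%:C *: X j) Y =
  conj_sum (finsupp q) (fun w => q w * c ^+ (size w).*2) (monomial X) Y.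
Proof.
apply: eq_bigr => w _; rewrite monomial_scale adjZ conjR.
rewrite -!(bop_scalerAr, bop_scalerAl) !scalerA -!rmorphM; congr (_%:C *: _).
by rewrite -mulrA -exprD addnn.
Qed.

End Monomials.

Section Resolvent.
Context {R : realType} {H : hilbertType R} {n : nat}.
Variables (q : ncpoly R n) (X : 'I_n -> 'B(H)).
Hypothesis hq : positive_regular q.
Implicit Types (Y Z : 'B(H)) (m : nat).

Definition resolvent_sum m Y : 'B(H) :=
  conj_sum (words_lt m) (bcoef q) (monomial X) Y.

(** The truncated sum over the words of length less than m is an approximate
    inverse of id - Phi; the tail is the error. *)
Definition resolvent_tail m Y : 'B(H) :=
  Y - resolvent_sum m (Y - Phi q X Y).

(** The source terms of the recursion of the truncated sums cancel, so that
    the tail is obtained from Y by iterating positive maps. *)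
Lemma resolvent_tail_rec m Y : (0 < m)%N -> resolvent_tail m Y =
  \sum_(w <- finsupp q)
    (q w)%:C *: (monomial X w * resolvent_tail (m - size w) Y * adj (monomial X w)).
Proof.
move=> m0; rewrite /resolvent_tail; set Z := Y - Phi q X Y.
rewrite /resolvent_sum /conj_sum (sum_words_rec hq)// monomial_nil adj1 mulr1 mul1r.
rewrite opprD addrA [Y - Z](_ : _ = Phi q X Y); last first.
  by rewrite /Z opprB addrC subrK.
rewrite /Phi -sumrB; apply: eq_bigr => w _.
rewrite mulrBr mulrBl scalerBr; congr (_ - _ *: _).
rewrite mulr_sumr mulr_suml; apply: eq_bigr => v _.
by rewrite monomial_cat adjM -!(bop_scalerAr, bop_scalerAl) !mulrA.
Qed.

Lemma resolvent_tail0 Y : resolvent_tail 0 Y = Y.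
Proof.
rewrite /resolvent_tail /resolvent_sum /conj_sum (_ : words_lt 0 = [::]).
  by rewrite big_nil subr0.
by apply/eqP; case E : (words_lt 0) => [//|w s]; have := mem_words_lt 0 w; rewrite E mem_head.
Qed.

Lemma resolvent_tailB m Y Z :
  resolvent_tail m (Y - Z) = resolvent_tail m Y - resolvent_tail m Z.
Proof.
have subACA (a b c d : 'B(H)) : (a - b) - (c - d) = (a - c) - (b - d).
  by rewrite !opprB addrACA [RHS]addrACA [- b - c]addrC.
rewrite /resolvent_tail (_ : Y - Z - Phi q X (Y - Z) = Y - Phi q X Y - (Z - Phi q X Z)).
  by rewrite /resolvent_sum conj_sumB subACA.
by rewrite !PhiE conj_sumB subACA.
Qed.

Lemma resolvent_tail_ge0 m Y : bop_ge0 Y -> bop_ge0 (resolvent_tail m Y).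
Proof.
move=> Y0; have [N] := ubnP m; elim: N m => // N IH [|m] mN.
  by rewrite resolvent_tail0.
have [q0 q00 _] := hq.
rewrite resolvent_tail_rec//; apply: bop_ge0_sum => -[|j w] _.
  by rewrite q00 scale0r; exact: bop_ge0_0.
apply: bop_ge0Z => //; apply/conj_ge0/IH.
by rewrite (leq_ltn_trans _ (mN : (m < N)%N))//= subSS leq_subr.
Qed.

End Resolvent.

Section ResolventScaled.
Context {R : realType} {H : hilbertType R} {n : nat}.
Variables (q : ncpoly R n) (X : 'I_n -> 'B(H)) (t : R).
Hypotheses (hq : positive_regular q) (t01 : 0 <= t <= 1)
  (X1 : bop_ge0 (1 - Phi q X 1)).

(** A word of length d contributes a factor t^2d, and shortens the remaining
    tail by d, so that every term of the recursion carries the same power. *)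
Lemma resolvent_tail_scaled m : bop_ge0
  ((t ^+ m.*2)%:C *: (1 : 'B(H)) - resolvent_tail q (fun j => t%:C *: X j) m 1).
Proof.
have [N] := ubnP m; elim: N m => // N IH [|m] mN.
  by rewrite resolvent_tail0 expr0 scale1r subrr; exact: bop_ge0_0.
have [q0 q00 _] := hq; have /andP[t0 t1] := t01.
rewrite resolvent_tail_rec//.
have -> : (t ^+ m.+1.*2)%:C *: (1 : 'B(H)) = (t ^+ m.+1.*2)%:C *: ((1 : 'B(H)) - Phi q X 1) +
    \sum_(w <- finsupp q) (q w * t ^+ m.+1.*2)%:C *: (monomial X w * 1 * adj (monomial X w)).
  rewrite scalerBr; set b := \sum_(w <- _) _.
  suff -> : (t ^+ m.+1.*2)%:C *: Phi q X 1 = b by rewrite subrK.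
  rewrite scaler_sumr; apply: eq_bigr => w _.
  by rewrite scalerA -rmorphM mulrC.
rewrite -addrA -sumrB; apply: bop_ge0D.
  by apply: bop_ge0Z => //; exact: exprn_ge0.
apply: bop_ge0_sum => -[|j w] _.
  by rewrite q00 mul0r !scale0r subrr; exact: bop_ge0_0.
set v := j :: w; rewrite monomial_scale adjZ conjR.
set E := resolvent_tail _ _ _ _.
rewrite -!(bop_scalerAr, bop_scalerAl) !scalerA -!rmorphM.
rewrite -[q v * t ^+ size v * _]mulrA -expr2 -exprM muln2 /=.
set a := monomial X v.
apply: (@bop_ge0_trans _ _ _
  ((q v * t ^+ (size v).*2)%:C *: (a * ((t ^+ (m.+1 - size v).*2)%:C *: (1 : 'B(H))) * adj a))).
  rewrite -scalerBr -mulrBl -mulrBr; apply: bop_ge0Z.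
    by rewrite mulr_ge0// exprn_ge0.
  by apply/conj_ge0/IH; rewrite (leq_ltn_trans _ (mN : (m < N)%N))//= subSS leq_subr.
rewrite -!(bop_scalerAr, bop_scalerAl) scalerA -rmorphM -scalerBl -rmorphB.
apply: bop_ge0Z; last exact/conj_ge0/bop_ge0_1.
rewrite -mulrA -exprD -doubleD -mulrBr mulr_ge0// subr_ge0.
by apply: ler_wiXn2l => //; rewrite leq_double -leq_subLR.
Qed.

End ResolventScaled.

(** * Scaling a polydomain *)

Section Folds.
Context {T : eqType} {V : Type}.
Implicit Types (l : seq T) (g : T -> V -> V).

Lemma foldr_comm (f : V -> V) g l z :
  (forall i v, i \in l -> f (g i v) = g i (f v)) ->
  f (foldr g z l) = foldr g (f z) l.
Proof.
elim: l => //= i l IH h; rewrite h ?mem_head// IH// => j v jl.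
by rewrite h// inE jl orbT.
Qed.

Lemma foldr_eq g g' l z : (forall i v, i \in l -> g i v = g' i v) ->
  foldr g z l = foldr g' z l.
Proof.
elim: l => //= i l IH h; rewrite IH ?h ?mem_head// => j v jl.
by rewrite h// inE jl orbT.
Qed.

End Folds.

Section PolydomainMaps.
Context {R : realType} {k : nat} {n : 'I_k -> nat}.
Variables (q : forall i, ncpoly R (n i)).
Hypothesis hq : forall i, positive_regular (q i).
Context {H : hilbertType R}.
Variable X : optuple n H.
Arguments X : clear implicits.
Hypothesis Xc : commuting_tuples X.
Implicit Types (Y Z : 'B(H)) (i j : 'I_k) (l : seq 'I_k).

Lemma monomialC i j v w : i != j ->
  monomial (X i) v * monomial (X j) w = monomial (X j) w * monomial (X i) v.
Proof.
move=> ij; apply: monomial_comm => a; apply/esym/monomial_comm => b.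
by rewrite Xc// eq_sym.
Qed.

Lemma word_mapsC i j s c t d Y : i != j ->
  conj_sum s c (monomial (X i)) (conj_sum t d (monomial (X j)) Y) =
  conj_sum t d (monomial (X j)) (conj_sum s c (monomial (X i)) Y).
Proof. by move=> ij; apply: conj_sumC => v w; exact: monomialC. Qed.

Definition defect i Y : 'B(H) := Y - Phi (q i) (X i) Y.

Lemma defectC i j s c Y : i != j ->
  defect i (conj_sum s c (monomial (X j)) Y) =
  conj_sum s c (monomial (X j)) (defect i Y).
Proof.
by move=> ij; rewrite /defect PhiE word_mapsC// conj_sumB.
Qed.

Section Scaling.
Arguments scale_tuple {R k n} {H} r X i i0 : rename.
Variable s : 'I_k -> R.
Hypothesis s01 : forall i, 0 <= s i < 1.

Definition scaled_defect i Y : 'B(H) := Y - Phi (q i) (scale_tuple s X i) Y.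

(** Since q has no constant term, id - Phi_{sX} is the convex combination of id
    and id - Phi_X with weights 1 - s^2 and s^2, plus a positive map. *)
Lemma scaled_defect_ge i Y : bop_ge0 Y -> bop_ge0 (defect i Y) ->
  bop_ge0 (scaled_defect i Y - (1 - s i ^+ 2)%:C *: Y).
Proof.
move=> Y0 dY; have /andP[s0 s1] := s01 i; have [q0 q00 _] := hq i.
have -> : scaled_defect i Y - (1 - s i ^+ 2)%:C *: Y =
  (s i ^+ 2)%:C *: defect i Y + \sum_(w <- finsupp (q i))
    ((s i ^+ 2 - s i ^+ (size w).*2) * q i w)%:C *:
      (monomial (X i) w * Y * adj (monomial (X i) w)).
  rewrite /scaled_defect /scale_tuple Phi_scale /defect scalerBr.
  rewrite rmorphB scalerBl rmorph1 scale1r opprB [LHS]addrC addrA subrK.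
  rewrite -addrA; congr (_ + _).
  rewrite PhiE /conj_sum scaler_sumr -sumrN -[in RHS]sumrN -big_split.
  apply: eq_bigr => w _ /=; rewrite scalerA -rmorphM -!scaleNr -scalerDl.
  by rewrite -!rmorphN -rmorphD /=; congr (_%:C *: _); ring.
apply: bop_ge0D; first exact: bop_ge0Z (sqr_ge0 _) dY.
apply: bop_ge0_sum => -[|j w] _.
  by rewrite q00 mulr0 scale0r; exact: bop_ge0_0.
apply: bop_ge0Z (conj_ge0 _ Y0); rewrite mulr_ge0// subr_ge0.
by apply: ler_wiXn2l => //; exact: ltW.
Qed.

Let dfold (p : 'I_k -> bool) := fun i Y => iter (p i) (defect i) Y.
Let sfold (p : 'I_k -> bool) := fun i Y => iter (p i) (scaled_defect i) Y.

Let scaled_conj i Y : exists t c, forall Y,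
  Phi (q i) (scale_tuple s X i) Y = conj_sum t c (monomial (X i)) Y.
Proof. by eexists; eexists => Z; rewrite /scale_tuple Phi_scale. Qed.

Let defect_scaledC i j Y : i != j ->
  defect i (scaled_defect j Y) = scaled_defect j (defect i Y).
Proof.
move=> ij; rewrite /scaled_defect; have [t [c tc]] := scaled_conj j Y.
rewrite !tc -defectC// /defect !PhiE conj_sumB !opprB addrACA [RHS]addrACA; congr (_ + _); exact: addrC.
Qed.

Let defect_defectC i j Y : i != j -> defect i (defect j Y) = defect j (defect i Y).
Proof.
move=> ij; rewrite /(defect j) !PhiE -defectC// /defect !PhiE conj_sumB.
by rewrite !opprB addrACA [RHS]addrACA; congr (_ + _); exact: addrC.
Qed.

Let positive_on l Z := forall p, bop_ge0 (foldr (dfold p) Z l).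

Let positive_on_cons i l Z : i \notin l -> positive_on (i :: l) Z ->
  positive_on l Z /\ positive_on l (defect i Z).
Proof.
move=> il h; split=> p.
  have := h (fun j => if j == i then false else p j); rewrite /= {1}/dfold eqxx /=.
  rewrite (@foldr_eq _ _ _ (dfold p))// => j v jl; rewrite /dfold.
  by have [ji|//] := eqVneq j i; rewrite ji (negbTE il) in jl.
have := h (fun j => if j == i then true else p j); rewrite /= {1}/dfold eqxx /=.
rewrite (@foldr_eq _ _ _ (dfold p)) => [|j v jl]; last first.
  rewrite /dfold.
  by have [ji|//] := eqVneq j i; rewrite ji (negbTE il) in jl.
rewrite foldr_comm// => j v jl; rewrite /dfold; case: (p j) => //=.
by rewrite defect_defectC//; apply: contraNneq il => ->.
Qed.

(** The coordinates are scaled one at a time: scaling the coordinate i uses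
    the positivity of the remaining partial defects of Z and of those of its
    defect in the direction i. *)
Let scaled_ge0 l Z : uniq l -> positive_on l Z ->
  forall p, bop_ge0 (foldr (sfold p) Z l).
Proof.
elim: l Z => [|i l IH] Z /= => [_ h p|/andP[il ul] h p]; first exact: (h p).
have [h0 h1] := positive_on_cons il h.
have A0 := IH _ ul h0 p; have A1 := IH _ ul h1 p.
rewrite /sfold; case: (p i) => //=; set A := foldr _ _ _ in A0 *.
have dA : bop_ge0 (defect i A).
  rewrite /A foldr_comm// => j v jl; rewrite /sfold; case: (p j) => //=.
  by rewrite defect_scaledC//; apply: contraNneq il => ->.
have := scaled_defect_ge A0 dA.
move=> h2; rewrite -[scaled_defect i A](subrK ((1 - s i ^+ 2)%:C *: A)).
apply: bop_ge0D => //; apply: bop_ge0Z => //.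
have /andP[s0 s1] := s01 i.
by rewrite subr_ge0 exprn_ile1// ltW.
Qed.

Let scaled_lb l Z : uniq l -> positive_on l Z ->
  bop_ge0 (foldr scaled_defect Z l - (\prod_(i <- l) (1 - s i ^+ 2))%:C *: Z).
Proof.
elim: l Z => [|i l IH] Z /= => [_ _|/andP[il ul] h].
  by rewrite big_nil scale1r subrr; exact: bop_ge0_0.
have [h0 h1] := positive_on_cons il h.
have A0 := scaled_ge0 ul h0 (fun=> true); have A1 := scaled_ge0 ul h1 (fun=> true).
rewrite /sfold /= in A0 A1; set A := foldr _ _ _ in A0 *.
have dA : bop_ge0 (defect i A).
  rewrite /A foldr_comm// => j v jl.
  by rewrite defect_scaledC//; apply: contraNneq il => ->.
have /andP[s0 s1] := s01 i.
rewrite big_cons rmorphM -scalerA.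
apply: bop_ge0_trans (scaled_defect_ge A0 dA); rewrite -scalerBr.
apply: bop_ge0Z; last exact: IH.
by rewrite subr_ge0 exprn_ile1// ltW.
Qed.

Lemma scale_commuting : commuting_tuples (scale_tuple s X).
Proof.
move=> i j ij a b; rewrite /scale_tuple -!(bop_scalerAr, bop_scalerAl) Xc//.
by rewrite !scalerA; congr (_ *: _); exact: mulrC.
Qed.

(** The full defect of sX is at least the product of the numbers 1 - s_i^2,
    hence invertible. *)
Lemma scaled_polydomain : polydomain_closed q X -> polydomain q (scale_tuple s X).
Proof.
move=> [_ hX]; have pos : positive_on (enum 'I_k) 1 by move=> p; exact: hX.
have ue := enum_uniq 'I_k; split; first split.
- exact: scale_commuting.
- by move=> p; exact: scaled_ge0.
have lb := scaled_lb ue pos; split; first exact: (scaled_ge0 ue pos (fun=> true)).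
apply: coercive_invertible lb; apply: prodr_gt0 => i _.
by have /andP[s0 s1] := s01 i; rewrite subr_gt0 exprn_ilt1.
Qed.

End Scaling.

End PolydomainMaps.

(** * Truncated resolutions of the identity *)

HB.instance Definition _ (k : nat) (n : 'I_k -> nat) :=
  Choice.copy (multiword n) (forall i : 'I_k, seq 'I_(n i)).

Section Boxes.
Context {k : nat} {n : 'I_k -> nat}.
Implicit Types (alpha beta : multiword n) (l : seq 'I_k) (m : nat).

Definition mw_nil : multiword n := fun i => [::].

Definition mw_cat alpha beta : multiword n := fun i => alpha i ++ beta i.

Fixpoint box_on m l : seq (multiword n) :=
  if l is i :: l' then
    [seq dfwith alpha i w | w <- words_lt m, alpha <- box_on m l']
  else [:: mw_nil].

Definition box m := box_on m (enum 'I_k).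

Lemma mem_box_on m l alpha : alpha \in box_on m l <->
  forall i, if i \in l then (size (alpha i) < m)%N else alpha i == [::].
Proof.
elim: l alpha => [|i l IH] alpha.
  rewrite /= inE; split=> [/eqP-> j//|h]; apply/eqP/functional_extensionality_dep => j.
  exact/eqP/h.
rewrite /=; split.
  move=> /allpairsPdep[w [beta [+ /IH hb ->]]]; rewrite mem_words_lt => wm j.
  rewrite inE; have [->|ji] := eqVneq j i; first by rewrite dfwithin.
  have ij : i != j by rewrite eq_sym.
  by rewrite dfwithout//; exact: hb.
move=> h; apply/allpairsPdep.
exists (alpha i), (if i \in l then alpha else dfwith alpha i [::]).
rewrite mem_words_lt; split.
- by have := h i; rewrite mem_head.
- apply/IH => j; have := h j; rewrite inE.
  have [->|ji] := eqVneq j i; case il : (i \in l) => //=; rewrite ?il//=.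
    by rewrite dfwithin.
  by rewrite dfwithout// eq_sym.
apply/functional_extensionality_dep => j.
have [->|ji] := eqVneq j i; first by rewrite dfwithin.
have ij : i != j by rewrite eq_sym.
by rewrite dfwithout//; case: ifP => // _; rewrite dfwithout.
Qed.

Lemma mem_box m alpha : alpha \in box m <-> forall i, (size (alpha i) < m)%N.
Proof.
rewrite mem_box_on; split=> h i; have := h i; by rewrite mem_enum.
Qed.

Lemma box_on_uniq m l : uniq l -> uniq (box_on m l).
Proof.
elim: l => //= i l IH /andP[il ul]; apply: allpairs_uniq_dep.
- exact: words_lt_uniq.
- by move=> w _; exact: IH.
move=> [v a] [w b] /allpairsPdep[v' [a' [_ a'l [-> ->]]]].
move=> /allpairsPdep[w' [b' [_ b'l [-> ->]]]] /= e.
have vw : v' = w' by have := f_equal (fun f => f i) e; rewrite !dfwithin.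
suff ab : a' = b' by rewrite vw ab.
apply/functional_extensionality_dep => j; have [->|ji] := eqVneq j i.
  move/mem_box_on/(_ i): a'l; move/mem_box_on/(_ i): b'l.
  by rewrite (negbTE il) => /eqP-> /eqP->.
have ij : i != j by rewrite eq_sym.
by have := f_equal (fun f => f j) e; rewrite !dfwithout.
Qed.

Lemma box_uniq m : uniq (box m).
Proof. exact/box_on_uniq/enum_uniq. Qed.

End Boxes.

Lemma big_ord_enum (T : Type) (idx : T) (op : T -> T -> T) k (F : 'I_k -> T) :
  \big[op/idx]_(i < k) F i = \big[op/idx]_(i <- enum 'I_k) F i.
Proof. by rewrite enumT [index_enum _]unlock. Qed.

Section BoxSums.
Context {R : realType} {k : nat} {n : 'I_k -> nat}.
Variables (q : forall i, ncpoly R (n i)).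
Hypothesis hq : forall i, positive_regular (q i).
Context {H : hilbertType R}.
Implicit Types (X : optuple n H) (Y Z : 'B(H)) (l : seq 'I_k).

Definition mcoef (alpha : multiword n) : R :=
  \prod_(i < k) bcoef (q i) (alpha i).

Lemma mcoef_gt0 alpha : 0 < mcoef alpha.
Proof. by apply: prodr_gt0 => i _; exact: bcoef_gt0. Qed.

(** Maps belonging to different coordinates commute, so that each truncated
    inverse can be moved next to the defect of its own coordinate. *)
Lemma resolvent_fold X m l Z : commuting_tuples X -> uniq l ->
  foldr (fun i => resolvent_sum (q i) (X i) m) (foldr (defect q X) Z l) l =
  foldr (fun i Y => Y - resolvent_tail (q i) (X i) m Y) Z l.
Proof.
move=> Xc; elim: l => //= i l IH /andP[il ul]; rewrite -IH//.
rewrite /resolvent_tail opprB addrC subrK -/(defect q X i _).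
congr (resolvent_sum _ _ _ _); symmetry; apply: foldr_comm => j v jl.
by apply: defectC => //; apply: contraNneq il => ->.
Qed.

Lemma resolvent_fold_box X m l Y : uniq l ->
  foldr (fun i => resolvent_sum (q i) (X i) m) Y l =
  \sum_(alpha <- box_on m l) (\prod_(i <- l) bcoef (q i) (alpha i))%:C *:
     ((\prod_(i <- l) monomial (X i) (alpha i)) * Y *
      adj (\prod_(i <- l) monomial (X i) (alpha i))).
Proof.
elim: l => [|i l IH] /=.
  by rewrite big_seq1 !big_nil adj1 mulr1 mul1r scale1r.
move=> /andP[il ul]; rewrite IH// /resolvent_sum conj_sum_sum.
rewrite big_allpairs_dep [RHS]exchange_big /=; apply: eq_bigr => a _.
rewrite conj_sumZ /conj_sum scaler_sumr; apply: eq_bigr => w _.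
rewrite !big_cons dfwithin.
have E (T : Type) (idx : T) (op : T -> T -> T) (F : forall j, seq 'I_(n j) -> T) :
    \big[op/idx]_(j <- l) F j (dfwith a i w j) = \big[op/idx]_(j <- l) F j (a j).
  rewrite big_seq_cond [RHS]big_seq_cond; apply: eq_bigr => j /andP[jl _].
  by rewrite dfwithout//; apply: contraNneq il => ->.
rewrite (E _ _ _ (fun j => bcoef (q j))) (E _ _ _ (fun j => monomial (X j))).
by rewrite scalerA rmorphM [in RHS]mulrC adjM !mulrA.
Qed.

(** Each further factor id - T_i lowers the value by at most d, and does not
    raise it as long as the partial products stay positive. *)
Lemma tail_fold_bounds X m l (d : R) : 0 <= d -> (size l)%:R * d <= 1 ->
  (forall i, bop_ge0 (d%:C *: (1 : 'B(H)) - resolvent_tail (q i) (X i) m 1)) ->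
  let Z := foldr (fun i Y => Y - resolvent_tail (q i) (X i) m Y) 1 l in
  bop_ge0 (Z - (1 - (size l)%:R * d)%:C *: (1 : 'B(H))) /\ bop_ge0 (1 - Z).
Proof.
move=> d0 + ht; elim: l => [_|i l IH] /=.
  by rewrite mul0r subr0 scale1r subrr; split; exact: bop_ge0_0.
move=> ld; have ld' : (size l)%:R * d <= 1.
  by apply: le_trans ld; rewrite ler_wpM2r// ler_nat.
have [IH1 IH2] := IH ld'; set Z := foldr _ _ _ in IH1 IH2 *.
have Z0 : bop_ge0 Z.
  rewrite -[Z](subrK ((1 - (size l)%:R * d)%:C *: (1 : 'B(H)))).
  by apply: bop_ge0D => //; apply: bop_ge0Z bop_ge0_1; rewrite subr_ge0.
set T := resolvent_tail (q i) (X i) m.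
have T0 : bop_ge0 (T Z) by exact: resolvent_tail_ge0.
have T1 : bop_ge0 (d%:C *: (1 : 'B(H)) - T Z).
  apply: bop_ge0_trans (ht i); rewrite -/T -resolvent_tailB.
  exact: resolvent_tail_ge0.
split; last by rewrite opprB addrA addrAC; exact: bop_ge0D.
have -> : Z - T Z - (1 - (size l).+1%:R * d)%:C *: (1 : 'B(H)) =
    (Z - (1 - (size l)%:R * d)%:C *: (1 : 'B(H))) + (d%:C *: (1 : 'B(H)) - T Z).
  have -> : (1 - (size l).+1%:R * d)%:C *: (1 : 'B(H)) =
      (1 - (size l)%:R * d)%:C *: (1 : 'B(H)) - d%:C *: (1 : 'B(H)).
    rewrite -scalerBl -rmorphB /=; congr (_%:C *: _).
    by rewrite mulrSr; ring.
  move: (T Z) => tz; rewrite opprB addrACA [RHS]addrACA; congr (_ + _); exact: addrC.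
exact: bop_ge0D.
Qed.

Lemma defect_ge0 X i : polydomain_closed q X -> bop_ge0 (defect q X i 1).
Proof.
move=> [_ /(_ (fun j => j == i))]; rewrite /Delta.
suff -> : foldr (fun j Z => iter (j == i) (defect q X j) Z) 1 (enum 'I_k) =
    defect q X i 1 by [].
have : i \in enum 'I_k by rewrite mem_enum.
elim: (enum 'I_k) (enum_uniq 'I_k) => //= j l IH /andP[jl ul].
rewrite inE; have [ji|ij] := eqVneq j i => /= il.
  suff -> : foldr (fun j Z => iter (j == i) (defect q X j) Z) 1 l = 1 by rewrite ji.
  move: jl; rewrite ji => {ji} jl.
  elim: l {IH ul il} jl => //= a l IH; rewrite inE negb_or => /andP[ia il].
  by rewrite IH// eq_sym (negbTE ia).
by rewrite IH.
Qed.

(** For t < 1 both bounds tend to 1 as m grows: this is the resolution of the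
    identity which makes the Poisson kernel of tX an isometry. *)
Lemma box_sum_bounds X (t : R) m : polydomain_closed q X -> 0 <= t <= 1 ->
  k%:R * t ^+ m.*2 <= 1 ->
  let tX := scale_tuple (fun=> t) X in
  let Z := \sum_(alpha <- box m) (mcoef alpha)%:C *:
    (multimonomial tX alpha * Delta q (fun=> true) tX 1 * adj (multimonomial tX alpha)) in
  bop_ge0 (Z - (1 - k%:R * t ^+ m.*2)%:C *: (1 : 'B(H))) /\ bop_ge0 (1 - Z).
Proof.
move=> [Xc Xp] t01 tm tX Z.
have tXc : commuting_tuples tX := scale_commuting Xc (fun=> t).
have ZE : Z = foldr (fun i Y => Y - resolvent_tail (q i) (tX i) m Y) 1 (enum 'I_k).
  rewrite -resolvent_fold ?enum_uniq// resolvent_fold_box ?enum_uniq//.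
  by rewrite /Z; apply: eq_bigr => a _; rewrite -!big_ord_enum.
have := @tail_fold_bounds tX m (enum 'I_k) (t ^+ m.*2).
rewrite size_enum_ord -ZE; apply=> //.
  by apply: exprn_ge0; case/andP: t01.
by move=> i; apply: resolvent_tail_scaled => //; exact: defect_ge0.
Qed.

End BoxSums.

(** * Weighted shift models *)

(** The family e is orthonormal on the multiwords which satisfy S, and zero on
    the others.  The predicate S is hereditary for the removal of prefixes: the
    constant true gives the universal model, and bounds on the lengths give its
    compressions to finite dimension. *)
Section Model.
Context {R : realType} {k : nat} {n : 'I_k -> nat}.
Variables (q : forall i, ncpoly R (n i)).
Hypothesis hq : forall i, positive_regular (q i).
Context {H : hilbertType R}.
Variables (S : pred (multiword n)) (e : multiword n -> H) (X : optuple n H).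
Arguments X : clear implicits.
Hypotheses
  (e_orth : forall a b, inner (e a) (e b) = ((a == b) && S a)%:R)
  (e_total : total_family e)
  (S_suffix : forall a i w, S (dfwith a i (w ++ a i)) -> S a)
  (XE : forall i j a, X i j (e a) =
     (Num.sqrt (bcoef (q i) (a i) / bcoef (q i) (j :: a i)))%:C *:
       e (dfwith a i (j :: a i))).
Implicit Types (a b : multiword n) (i : 'I_k).

Lemma dfwith_twice a i (v w : seq 'I_(n i)) :
  dfwith (dfwith a i v : multiword n) i w = dfwith a i w :> multiword n.
Proof.
apply/functional_extensionality_dep => j; have [->|ji] := eqVneq j i.
  by rewrite !dfwithin.
have ij : i != j by rewrite eq_sym.
by rewrite !dfwithout.
Qed.

Lemma dfwith_comm a i j (v : seq 'I_(n i)) (w : seq 'I_(n j)) : i != j ->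
  dfwith (dfwith a i v : multiword n) j w = dfwith (dfwith a j w : multiword n) i v :> multiword n.
Proof.
move=> ij; have ji : j != i by rewrite eq_sym.
apply/functional_extensionality_dep => l; have [->|li] := eqVneq l i.
  by rewrite dfwithin dfwithout// dfwithin.
have il : i != l by rewrite eq_sym.
have [lj|lj] := eqVneq l j; first by subst l; rewrite dfwithin dfwithout// dfwithin.
have jl : j != l by rewrite eq_sym.
by rewrite !dfwithout.
Qed.

Lemma dfwith_id a i : dfwith a i (a i) = a :> multiword n.
Proof.
apply/functional_extensionality_dep => j; have [->|ji] := eqVneq j i.
  by rewrite dfwithin.
have ij : i != j by rewrite eq_sym.
by rewrite dfwithout.
Qed.

Let e0 a : ~~ S a -> e a = 0.
Proof.
move=> Sa; apply/nrm0_eq0/eqP; rewrite -sqrf_eq0; apply/eqP/(@complexI R).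
by rewrite -inner_sqr e_orth eqxx (negbTE Sa).
Qed.

Let b_gt0 i w : 0 < bcoef (q i) w. Proof. exact: bcoef_gt0. Qed.

Lemma model_monomial i w a : monomial (X i) w (e a) =
  (Num.sqrt (bcoef (q i) (a i) / bcoef (q i) (w ++ a i)))%:C *:
     e (dfwith a i (w ++ a i)).
Proof.
elim: w => [|j w IH].
  rewrite monomial_nil bop_oneE divff ?gt_eqF// sqrtr1 scale1r.
  by rewrite (dfwith_id a i).
rewrite monomial_cons bop_mulE IH bopZ XE dfwithin scalerA dfwith_twice.
rewrite -rmorphM -sqrtrM ?divr_ge0 ?ltW//= mulrA divfK// gt_eqF//.
Qed.

Lemma model_adj_monomial i w a : S a -> adj (monomial (X i) w) (e a) =
  if prefix w (a i) then
    (Num.sqrt (bcoef (q i) (drop (size w) (a i)) / bcoef (q i) (a i)))%:C *: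
       e (dfwith a i (drop (size w) (a i)))
  else 0.
Proof.
move=> Sa; apply: (total_inner_ext e_total) => b.
rewrite adj_inner model_monomial innerZr conjR e_orth Sa andbT.
case: ifP => [/prefixP[v av]|wa]; last first.
  rewrite inner0l; have [ab|] := eqVneq a; last by rewrite mulr0.
  by move: wa; rewrite ab dfwithin prefix_prefix.
have -> : drop (size w) (a i) = v by rewrite av drop_size_cat.
rewrite innerZl e_orth.
have Sv : S (dfwith a i v).
  apply: (S_suffix (i := i) (w := w)).
  by rewrite dfwithin dfwith_twice -av dfwith_id.
rewrite Sv andbT.
have [ab|ab] := eqVneq a (dfwith b i (w ++ b i)).
  have bv : b i = v.
    by move: av; rewrite ab dfwithin => /eqP; rewrite eqseq_cat// eqxx => /eqP.
  by rewrite -bv ab dfwithin dfwith_twice dfwith_id !eqxx.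
rewrite mulr0; have [ba|] := eqVneq (dfwith a i v : multiword n) b; last by rewrite mulr0.
case/eqP: ab; rewrite -ba dfwith_twice dfwithin -av dfwith_id//.
Qed.

Let diag (Z : 'B(H)) (z : multiword n -> R) := forall a, Z (e a) = (z a)%:C *: e a.

Let diag_conj Z z i w : diag Z z ->
  diag (monomial (X i) w * Z * adj (monomial (X i) w))
    (fun a => if prefix w (a i) then
       bcoef (q i) (drop (size w) (a i)) / bcoef (q i) (a i) *
       z (dfwith a i (drop (size w) (a i))) else 0).
Proof.
move=> dZ a; have [Sa|/e0 ->] := boolP (S a); last by rewrite bop0 scaler0.
rewrite !bop_mulE model_adj_monomial//; case: ifP => [/prefixP[v av]|_]; last first.
  by rewrite !bop0 scale0r.
have -> : drop (size w) (a i) = v by rewrite av drop_size_cat.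
rewrite !bopZ dZ bopZ model_monomial dfwithin.
rewrite dfwith_twice -av dfwith_id !scalerA; congr (_ *: _).
rewrite -!rmorphM /=; congr (_%:C).
rewrite mulrAC -expr2 sqr_sqrtr// divr_ge0// ltW//.
Qed.

(** By the recursion of the coefficients b, the diagonal entry of Phi_i(1) at
    a is 1 unless the i-th word of a is empty, when it is 0. *)
Let diag_defect Z i (P : pred (multiword n)) :
  (forall a w, P (dfwith a i w) = P a) -> diag Z (fun a => (P a)%:R) ->
  diag (defect q X i Z) (fun a => ((a i == [::]) && P a)%:R).
Proof.
move=> Pi dZ a; rewrite /defect bopBE dZ /Phi bop_sumE.
under eq_bigr do rewrite bopZE (@diag_conj _ _ _ _ dZ) scalerA -rmorphM Pi.
rewrite -scaler_suml -rmorph_sum -scalerBl -rmorphB; congr (_%:C *: _).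
have -> : \sum_(w <- finsupp (q i)) (q i w * (if prefix w (a i) then
     bcoef (q i) (drop (size w) (a i)) / bcoef (q i) (a i) * (P a)%:R else 0)) =
   (\sum_(w <- finsupp (q i) | prefix w (a i))
      q i w * bcoef (q i) (drop (size w) (a i))) * ((P a)%:R / bcoef (q i) (a i)).
  rewrite mulr_suml [RHS]big_mkcond /=; apply: eq_bigr => w _.
  by case: ifP => _; rewrite ?mulr0//; ring.
have [ai|ai] := eqVneq (a i) [::].
  rewrite ai big1 ?mul0r ?subr0//= => -[|//] _.
  by have [_ -> _] := hq i; rewrite mul0r.
by rewrite -bcoef_rec// mulrCA divff ?mulr1 ?subrr// gt_eqF.
Qed.

Let Delta_diag (p : 'I_k -> bool) (l : seq 'I_k) : uniq l ->
  diag (foldr (fun i Z => iter (p i) (defect q X i) Z) 1 l)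
    (fun a => (all (fun i => p i ==> (a i == [::])) l)%:R).
Proof.
elim: l => [_ a|i l IH /= /andP[il ul]]; first by rewrite bop_oneE scale1r.
have {IH ul} := IH ul; set Z := foldr _ _ _.
case: (p i) => //= dZ; apply: diag_defect dZ => a w.
apply: eq_in_all => j jl; rewrite dfwithout//.
by apply: contraNneq il => ->.
Qed.

(** The defect operators are diagonal projections, onto the span of the basis
    vectors whose selected coordinates are empty. *)
Lemma model_polydomain_closed : polydomain_closed q X.
Proof.
split=> [i j ij u v|p].
  apply: (total_bop_ext e_total) => a; rewrite !bop_mulE !XE !bopZ !XE.
  have ji : j != i by rewrite eq_sym.
  rewrite !dfwithout// !scalerA dfwith_comm//; congr (_ *: _); exact: mulrC.
rewrite /Delta; set Z := foldr _ _ _.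
pose P a := all (fun i => p i ==> (a i == [::])) (enum 'I_k).
have dZ : diag Z (fun a => (P a)%:R) := @Delta_diag p _ (enum_uniq 'I_k).
(* Z is a self-adjoint idempotent *)
have ZZ : Z * Z = Z.
  apply: (total_bop_ext e_total) => a; rewrite bop_mulE !dZ bopZ dZ scalerA.
  by rewrite -rmorphM -natrM mulnb andbb.
have Zadj : adj Z = Z.
  apply: (total_bop_ext e_total) => a; apply: (total_inner_ext e_total) => b.
  rewrite adj_inner !dZ innerZl innerZr conjR e_orth.
  by have [->|] := eqVneq a b; rewrite ?mulr0.
by move=> x; rewrite -ZZ bop_mulE -{1}Zadj adj_inner inner_sqr ler0c sqr_ge0.
Qed.

Lemma model_multimonomial a b : multimonomial X a (e b) =
  (Num.sqrt (mcoef q b / mcoef q (mw_cat a b)))%:C *: e (mw_cat a b).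
Proof.
pose c (l : seq 'I_k) : multiword n := fun i => if i \in l then a i ++ b i else b i.
suff key l : uniq l -> (\prod_(i <- l) monomial (X i) (a i)) (e b) =
    (Num.sqrt (\prod_(i <- l) (bcoef (q i) (b i) / bcoef (q i) (a i ++ b i))))%:C *:
    e (c l).
  rewrite /multimonomial big_ord_enum key ?enum_uniq// -big_ord_enum prodf_div.
  congr (_ *: e _); apply/functional_extensionality_dep => i.
  by rewrite /c mem_enum.
elim: l => [_|i l IH /= /andP[il ul]].
  by rewrite !big_nil bop_oneE sqrtr1 scale1r.
rewrite !big_cons bop_mulE IH// bopZ model_monomial /c (negbTE il) scalerA.
rewrite [_ * \prod_(j <- l) _]mulrC [Num.sqrt (\prod_(j <- l) _ * _)]sqrtrM; last first.
  by apply: prodr_ge0 => j _; rewrite divr_ge0// ltW.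
rewrite rmorphM; congr (_ *: e _); apply/functional_extensionality_dep => j.
rewrite inE; have [->|ji] := eqVneq j i; first by rewrite dfwithin.
have ij : i != j by rewrite eq_sym.
by rewrite dfwithout.
Qed.

End Model.

(** * The von Neumann inequality *)

Section Multimonomials.
Context {R : realType} {k : nat} {n : 'I_k -> nat} {H : hilbertType R}.
Variable X : optuple n H.
Arguments X : clear implicits.
Implicit Types (a b : multiword n).

Lemma multimonomial_scale (r : 'I_k -> R) a :
  multimonomial (scale_tuple r X) a =
  (\prod_(i < k) r i ^+ size (a i))%:C *: multimonomial X a.
Proof.
rewrite /multimonomial !big_ord_enum.
elim: (enum 'I_k) => [|i l IH]; first by rewrite !big_nil scale1r.
rewrite !big_cons IH /scale_tuple monomial_scale.
by rewrite -bop_scalerAl -bop_scalerAr scalerA rmorphM.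
Qed.

Lemma multimonomial_cat a b : commuting_tuples X ->
  multimonomial X (mw_cat a b) = multimonomial X a * multimonomial X b.
Proof.
move=> Xc; rewrite /multimonomial !big_ord_enum.
elim: (enum 'I_k) (enum_uniq 'I_k) => [_|i l IH /= /andP[il ul]].
  by rewrite !big_nil mulr1.
rewrite !big_cons IH// /mw_cat monomial_cat -!mulrA; congr (_ * _).
rewrite !mulrA; congr (_ * _).
elim: l il {IH ul} => [_|j l IH]; first by rewrite !big_nil mulr1 mul1r.
rewrite inE negb_or => /andP[ij il]; rewrite !big_cons -mulrA -IH// !mulrA.
by rewrite monomialC.
Qed.

End Multimonomials.

Section ModelColumns.
Context {R : realType} {k : nat} {n : 'I_k -> nat}.
Variables (q : forall i, ncpoly R (n i)).
Hypothesis hq : forall i, positive_regular (q i).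
Context {K H : hilbertType R} (T : htensor K H).
Variables (e : multiword n -> H) (X : optuple n H).
Arguments X : clear implicits.
Hypotheses
  (e_orth : forall a b, inner (e a) (e b) = (a == b)%:R)
  (XE : forall i j a, X i j (e a) =
     (Num.sqrt (bcoef (q i) (a i) / bcoef (q i) (j :: a i)))%:C *:
       e (dfwith a i (j :: a i))).
Variables (s : seq (multiword n)) (B : multiword n -> 'B(K)).

Let P : 'B(T) := \sum_(g <- s) tensop T (B g) (multimonomial X g).

Let wvec (L : seq (multiword n)) (y : multiword n -> K) : T :=
  \sum_(b <- L) (Num.sqrt (mcoef q b))%:C *: tens T (y b) (e b).

Let m_gt0 b : 0 < mcoef q b. Proof. exact: mcoef_gt0. Qed.

Let inner_wvec L y b z : uniq L -> b \in L ->
  inner (wvec L y) (tens T z (e b)) = (Num.sqrt (mcoef q b))%:C * inner (y b) z.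
Proof.
move=> uL bL; rewrite inner_suml (bigD1_seq b)//= big1 ?addr0 => [|c cb].
  by rewrite innerZl inner_tens e_orth eqxx mulr1.
by rewrite innerZl inner_tens e_orth (negbTE cb) !mulr0.
Qed.

Let nrm_wvec L y : uniq L ->
  nrm (wvec L y) ^+ 2 = \sum_(b <- L) mcoef q b * nrm (y b) ^+ 2.
Proof.
move=> uL; apply: (@complexI R); rewrite -inner_sqr {2}/wvec inner_sumr rmorph_sum.
apply: eq_big_seq => b bL; rewrite innerZr conjR inner_wvec// mulrA -rmorphM.
by rewrite -expr2 sqr_sqrtr ?ltW// inner_sqr -rmorphM.
Qed.

(** For w = sum sqrt(b_beta) y_beta (x) e_beta and w' = sum sqrt(b_alpha)
    z_alpha (x) e_alpha, with z_alpha the inner sum on the left, the weights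
    of the shifts combine to <w, P w'> = <w', w'>; hence |w'| <= |P| |w|. *)
Lemma model_column_bound (L1 L2 : seq (multiword n)) (y : multiword n -> K) :
  uniq L1 -> uniq L2 ->
  (forall g a, g \in s -> a \in L1 -> mw_cat g a \in L2) ->
  \sum_(a <- L1) mcoef q a *
     nrm (\sum_(g <- s) adj (B g) (y (mw_cat g a))) ^+ 2
  <= nrm P ^+ 2 * \sum_(b <- L2) mcoef q b * nrm (y b) ^+ 2.
Proof.
move=> u1 u2 h12.
pose z a := \sum_(g <- s) adj (B g) (y (mw_cat g a)).
rewrite -(nrm_wvec z u1) -(nrm_wvec y u2).
set w := wvec L2 y; set w' := wvec L1 z.
have key : inner w (P w') = (nrm w' ^+ 2)%:C.
  rewrite {2}/w' /wvec bop_sum inner_sumr nrm_wvec// rmorph_sum.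
  apply: eq_big_seq => a a1; rewrite bopZ innerZr conjR /P bop_sumE inner_sumr.
  transitivity ((Num.sqrt (mcoef q a))%:C * \sum_(g <- s)
      (Num.sqrt (mcoef q a))%:C * inner (adj (B g) (y (mw_cat g a))) (z a)).
    congr (_ * _); apply: eq_big_seq => g gs.
    rewrite tensopE (model_multimonomial hq XE) tensZr innerZr conjR.
    rewrite inner_wvec ?h12// adj_inner mulrA -rmorphM; congr (_%:C * _).
    by rewrite -sqrtrM ?divr_ge0 ?ltW// divfK// gt_eqF.
  rewrite -mulr_sumr mulrA -rmorphM -expr2 sqr_sqrtr ?ltW//.
  by rewrite -inner_suml inner_sqr -rmorphM.
have [w0|w0] := eqVneq (nrm w') 0.
  by rewrite w0 expr0n mulr_ge0// sqr_ge0.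
have wp : 0 < nrm w' by rewrite lt_neqAle eq_sym w0 nrm_ge0.
rewrite -exprMn ler_pXn2r ?nnegrE ?mulr_ge0 ?nrm_ge0//.
rewrite -(ler_pM2r wp) -expr2.
have -> : nrm w' ^+ 2 = complex.Re (inner w (P w')) by rewrite key.
rewrite (le_trans (Re_inner_le _ _))// -mulrA mulrCA.
by rewrite ler_wpM2l ?nrm_ge0// nrm_bop opnormP.
Qed.

End ModelColumns.

Section TensorForms.
Context {R : realType} {K H : hilbertType R} (T : htensor K H).

(** The quadratic form of I (x) D on a finite sum of elementary tensors,
    through a factorisation of the Gram matrix of D. *)
Lemma tensor_form (J : eqType) (I : eqType) (D : 'B(H)) (h : I -> H) (p : J -> I)
    (x : J -> K) (s : seq (R[i] * J)) (L : seq I) (cs : seq (I -> R[i])) (z : T) :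
  z = \sum_(c <- s) c.1 *: tens T (x c.2) (h (p c.2)) ->
  (forall a b, a \in L -> b \in L ->
     inner (D (h a)) (h b) = \sum_(f <- cs) f a * (f b)^*%R) ->
  (forall c, c \in s -> p c.2 \in L) ->
  inner (tensop T 1 D z) z =
  (\sum_(f <- cs) nrm (\sum_(c <- s) (c.1 * f (p c.2)) *: x c.2) ^+ 2)%:C.
Proof.
move=> zE hcs hL.
have -> : tensop T 1 D z = lincomb (fun j => tens T (x j) (D (h (p j)))) s.
  rewrite zE bop_sum; apply: eq_bigr => c _.
  by rewrite bopZ tensopE bop_oneE.
rewrite zE (@inner_lincomb _ _ _ _ 1 _ (fun j => tens T (x j) (h (p j))) x
  (fun a b => inner (D (h (p a))) (h (p b))) s [seq f \o p | f <- cs]).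
- rewrite big_map rmorph_sum; apply: eq_bigr => f _.
  by rewrite bop_oneE inner_sqr.
- move=> a b /mapP[c cs1 ->] /mapP[c' cs2 ->].
  by rewrite big_map hcs ?hL.
- by move=> a b; rewrite bop_oneE inner_tens.
Qed.

Lemma tensor_form_ge0 (J : eqType) (D : 'B(H)) (h : J -> H) (x : J -> K)
    (s : seq (R[i] * J)) (z : T) : bop_ge0 D ->
  z = \sum_(c <- s) c.1 *: tens T (x c.2) (h c.2) ->
  0 <= inner (tensop T 1 D z) z.
Proof.
move=> D0 zE; have [cs hcs] := gram_factorable h (map snd s) D0.
rewrite (tensor_form (p := id) zE hcs) => [|c]; last exact: map_f.
by rewrite ler0c sumr_ge0// => f _; exact: sqr_ge0.
Qed.

Lemma tensop_sumr (I : Type) (s : seq I) (A : 'B(K)) (F : I -> 'B(H)) :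
  tensop T A (\sum_(i <- s) F i) = \sum_(i <- s) tensop T A (F i).
Proof.
apply: tens_bop_ext => x y; rewrite tensopE !bop_sumE.
elim: s => [|i s IH]; first by rewrite !big_nil -(scale0r 0) tensZr scale0r.
by rewrite !big_cons tensDr IH tensopE.
Qed.

Lemma tensopB (A : 'B(K)) (Y Z : 'B(H)) :
  tensop T A (Y - Z) = tensop T A Y - tensop T A Z.
Proof.
apply: tens_bop_ext => x y; rewrite bopBE !tensopE bopBE.
by rewrite tensDr -[- _ in LHS]scaleN1r tensZr scaleN1r.
Qed.

Lemma tensop_comp (A B : 'B(K)) (Y Z : 'B(H)) :
  tensop T (A * B) (Y * Z) = tensop T A Y * tensop T B Z.
Proof. by apply: tens_bop_ext => x y; rewrite bop_mulE !tensopE !bop_mulE. Qed.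

Lemma tensop11 : tensop T 1 1 = 1.
Proof. by apply: tens_bop_ext => x y; rewrite tensopE !bop_oneE. Qed.

Lemma tensop_conj (Y a : 'B(H)) z :
  inner (tensop T 1 (a * Y * adj a) z) z =
  inner (tensop T 1 Y (tensop T 1 (adj a) z)) (tensop T 1 (adj a) z).
Proof.
have -> : tensop T 1 (a * Y * adj a) =
    tensop T 1 a * tensop T 1 Y * tensop T 1 (adj a).
  by rewrite -!tensop_comp !mulr1.
rewrite !bop_mulE; set u := tensop T 1 Y _.
by rewrite adjP adj_tensop adj1.
Qed.

End TensorForms.

Lemma one_sub_expr_le (R : realType) (t : R) m : 0 <= t <= 1 ->
  1 - t ^+ m <= m%:R * (1 - t).
Proof.
move=> /andP[t0 t1]; elim: m => [|m IH]; first by rewrite expr0 mul0r subrr.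
have h1 : t ^+ m * (1 - t) <= 1 - t.
  by rewrite ler_piMl ?subr_ge0// exprn_ile1.
have -> : 1 - t ^+ m.+1 = (1 - t ^+ m) + t ^+ m * (1 - t) by rewrite exprS; ring.
by rewrite mulrSr mulrDl mul1r lerD.
Qed.

Section VonNeumann.
Context {R : realType} {k : nat} {n : 'I_k -> nat}.
Variables (q : forall i, ncpoly R (n i)).
Hypothesis hq : forall i, positive_regular (q i).
Context {K H0 : hilbertType R} (T0 : htensor K H0).
Variables (e : multiword n -> H0) (W : optuple n H0).
Arguments W : clear implicits.
Hypotheses
  (e_orth : forall a b, inner (e a) (e b) = (a == b)%:R)
  (WE : forall i j a, W i j (e a) =
     (Num.sqrt (bcoef (q i) (a i) / bcoef (q i) (j :: a i)))%:C *:
       e (dfwith a i (j :: a i))).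
Context {H : hilbertType R} (T : htensor K H).
Variable X : optuple n H.
Arguments X : clear implicits.
Hypothesis XD : polydomain_closed q X.
Variables (s : seq (multiword n)) (B : multiword n -> 'B(K)).

Let C := nrm (\sum_(g <- s) tensop T0 (B g) (multimonomial W g)).

Let qf (Y : 'B(H)) (z : T) := complex.Re (inner (tensop T 1 Y z) z).

Let qf_sum (I : Type) (r : seq I) (c : I -> R) (F : I -> 'B(H)) z :
  qf (\sum_(i <- r) (c i)%:C *: F i) z = \sum_(i <- r) c i * qf (F i) z.
Proof.
rewrite /qf tensop_sumr bop_sumE inner_suml.
elim: r => [|i r IH]; first by rewrite !big_nil.
by rewrite !big_cons ReD IH tensopZ bopZE innerZl Re_MR.
Qed.

Let qfB Y Z z : qf (Y - Z) z = qf Y z - qf Z z.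
Proof. by rewrite /qf tensopB bopBE innerBl ReD ReN. Qed.

Let qfc c z : qf (c%:C *: (1 : 'B(H))) z = c * nrm z ^+ 2.
Proof. by rewrite /qf tensopZ tensop11 bopZE innerZl Re_MR bop_oneE inner_sqr. Qed.

Section Strict.
Variable t : R.
Hypothesis t01 : 0 <= t < 1.

Let tX : optuple n H := scale_tuple (fun=> t) X.
Let D := Delta q (fun=> true) tX 1.

Let tXc : commuting_tuples tX := scale_commuting (proj1 XD) (fun=> t).

Let D0 : bop_ge0 D.
Proof.
by have [_ []] := @scaled_polydomain _ _ _ q hq _ X (proj1 XD) (fun=> t) (fun=> t01) XD.
Qed.

Let P := \sum_(g <- s) tensop T (B g) (multimonomial tX g).

Let d := \max_(g <- s) \max_(i < k) size (g i).

Let d_ge g i : g \in s -> (size (g i) <= d)%N.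
Proof.
move=> gs; rewrite /d (big_rem g gs) /= leq_max; apply/orP; left.
exact: (@leq_bigmax _ (fun i => size (g i))).
Qed.

Section FixedVector.
Variable us : seq (R[i] * (K * H)).

Let u : T := \sum_(c <- us) c.1 *: tens T c.2.1 c.2.2.
Let js := [seq (c.1, (g, c.2)) | g <- s, c <- us].
Let v := adj P u.

Let vE : v = \sum_(j <- js) j.1 *:
  tens T (adj (B j.2.1) j.2.2.1) (adj (multimonomial tX j.2.1) j.2.2.2).
Proof.
have adjP_sum : adj P = \sum_(g <- s) tensop T (adj (B g)) (adj (multimonomial tX g)).
  apply: adj_unique => x y; rewrite !bop_sumE inner_suml inner_sumr.
  by apply: eq_bigr => g _; rewrite adjP adj_tensop.
rewrite /v adjP_sum bop_sumE /js big_allpairs_dep /=; apply: eq_bigr => g _.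
by rewrite /u bop_sum; apply: eq_bigr => c _; rewrite bopZ tensopE.
Qed.

(** The lower bound of the box sums is used at v, and their upper bound at u
    on a box enlarged by the degree d.  Both forms split along the factors of
    a single Gram matrix, and the terms are compared factor by factor. *)
Let truncated_bound m : k%:R * t ^+ m.*2 <= 1 ->
  (1 - k%:R * t ^+ m.*2) * nrm v ^+ 2 <= C ^+ 2 * nrm u ^+ 2.
Proof.
move=> em; have /andP[t0 t1] := t01.
have t01' : 0 <= t <= 1 by rewrite t0 ltW.
pose M := (m + d)%N.
have eM : k%:R * t ^+ M.*2 <= 1.
  by apply: le_trans em; rewrite ler_wpM2l// ler_wiXn2l ?(ltW t1)// leq_double leq_addr.
have [/= lb _] := box_sum_bounds hq XD t01' em.
have [/= _ ub] := box_sum_bounds hq XD t01' eM.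
rewrite -/tX -/D in lb ub.
pose h (bx : multiword n * (K * H)) := adj (multimonomial tX bx.1) bx.2.2.
pose L : seq (multiword n * (K * H)) := [seq (b, c.2) | b <- box M, c <- us].
have [cs hcs] := gram_factorable h L D0.
pose y (f : multiword n * (K * H) -> R[i]) b := \sum_(c <- us) (c.1 * f (b, c.2)) *: c.2.1.
have adj_cat a b z : adj (multimonomial tX a) (adj (multimonomial tX b) z) =
    adj (multimonomial tX (mw_cat b a)) z.
  by rewrite multimonomial_cat// adjM bop_mulE.
have qu b : b \in box M -> qf (multimonomial tX b * D * adj (multimonomial tX b)) u =
    \sum_(f <- cs) nrm (y f b) ^+ 2.
  move=> bM; rewrite /qf tensop_conj.
  rewrite (@tensor_form _ _ _ T _ _ D h (fun c => (b, c)) fst us L cs)//.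
  - by rewrite /u bop_sum; apply: eq_bigr => c _; rewrite bopZ tensopE bop_oneE.
  - by move=> c cus; apply/allpairsP; exists (b, c).
have inM g a : g \in s -> a \in box m -> mw_cat g a \in box M.
  move=> gs /mem_box am; apply/mem_box => i.
  by rewrite size_cat addnC /M -addSn leq_add ?d_ge.
have qv a : a \in box m -> qf (multimonomial tX a * D * adj (multimonomial tX a)) v =
    \sum_(f <- cs) nrm (\sum_(g <- s) adj (B g) (y f (mw_cat g a))) ^+ 2.
  move=> am; rewrite /qf tensop_conj.
  rewrite (@tensor_form _ _ _ T _ _ D h (fun j => (mw_cat j.1 a, j.2))
    (fun j => adj (B j.1) j.2.1) js L cs)//.
  - rewrite ReC; apply: eq_bigr => f _; congr (nrm _ ^+ 2).
    rewrite /js big_allpairs_dep /=; apply: eq_bigr => g _.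
    by rewrite /y bop_sum; apply: eq_bigr => c _; rewrite bopZ.
  - rewrite vE bop_sum; apply: eq_bigr => j _.
    by rewrite bopZ tensopE bop_oneE adj_cat.
  - move=> j /allpairsP[[g c] /= [gs cus ->]]; apply/allpairsP.
    by exists (mw_cat g a, c); rewrite /= inM.
have lbv : (1 - k%:R * t ^+ m.*2) * nrm v ^+ 2 <=
    \sum_(a <- box m) mcoef q a *
      qf (multimonomial tX a * D * adj (multimonomial tX a)) v.
  rewrite -qfc -qf_sum -subr_ge0 -qfB; apply: Re_ge0.
  apply: (@tensor_form_ge0 _ _ _ T _ _ (fun j => adj (multimonomial tX j.1) j.2.2)
    (fun j => adj (B j.1) j.2.1) js v lb).
  exact: vE.
have ubu : \sum_(b <- box M) mcoef q b *
      qf (multimonomial tX b * D * adj (multimonomial tX b)) u <= nrm u ^+ 2.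
  rewrite -[leRHS]mul1r -(qfc 1) scale1r -qf_sum -subr_ge0 -qfB; apply: Re_ge0.
  exact: (@tensor_form_ge0 _ _ _ T _ _ snd fst us u ub).
apply: (le_trans lbv); apply: le_trans (ler_wpM2l (sqr_ge0 _) ubu).
have -> : \sum_(a <- box m) mcoef q a *
      qf (multimonomial tX a * D * adj (multimonomial tX a)) v =
   \sum_(f <- cs) \sum_(a <- box m) mcoef q a *
      nrm (\sum_(g <- s) adj (B g) (y f (mw_cat g a))) ^+ 2.
  rewrite exchange_big; apply: eq_big_seq => a am /=.
  by rewrite qv// mulr_sumr.
have -> : \sum_(b <- box M) mcoef q b *
      qf (multimonomial tX b * D * adj (multimonomial tX b)) u =
   \sum_(f <- cs) \sum_(b <- box M) mcoef q b * nrm (y f b) ^+ 2.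
  rewrite exchange_big; apply: eq_big_seq => b bM /=.
  by rewrite qu// mulr_sumr.
rewrite mulr_sumr; apply: ler_sum => f _.
exact: (model_column_bound hq T0 e_orth WE B (y f) (box_uniq m) (box_uniq M)).
Qed.

Lemma adj_vector_bound : nrm v <= C * nrm u.
Proof.
rewrite -(@ler_pXn2r _ 2)// ?nnegrE ?mulr_ge0 ?nrm_ge0// exprMn.
apply/ler_addgt0Pr => eps eps0; have /andP[t0 t1] := t01.
pose eta := Num.min 1 (eps / (nrm v ^+ 2 + 1)).
have v1 : 0 < nrm v ^+ 2 + 1 by rewrite ltr_wpDl// sqr_ge0.
have eta0 : 0 < eta by rewrite lt_min ltr01 divr_gt0.
have [m em] : exists m, k%:R * t ^+ m.*2 <= eta.
  have k1 : 0 < k.+1%:R :> R by rewrite ltr0n.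
  have d0 : 0 < eta / k.+1%:R by rewrite divr_gt0.
  have t2 : `|t ^+ 2| < 1 by rewrite ger0_norm ?exprn_ge0// exprn_ilt1.
  have /cvgrPdist_lt/(_ _ d0)[N _ hN] := cvg_expr t2.
  exists N; have := hN N (leqnn N); rewrite sub0r normrN -exprM mul2n.
  rewrite ger0_norm ?exprn_ge0// ltr_pdivlMr// mulrC => /ltW.
  apply: le_trans; rewrite ler_wpM2r ?exprn_ge0// ler_nat//.
have eta1 : eta <= 1 by rewrite ge_min lexx.
have := truncated_bound (le_trans em eta1).
rewrite mulrBl mul1r lerBlDr => h; apply: (le_trans h); rewrite lerD2l.
apply: (@le_trans _ _ (eps / (nrm v ^+ 2 + 1) * nrm v ^+ 2)).
  by rewrite ler_wpM2r ?sqr_ge0// (le_trans em)// ge_min lexx orbT.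
by rewrite mulrAC ler_pdivrMr// ler_wpM2l ?(ltW eps0)// lerDl ler01.
Qed.

End FixedVector.

Lemma strict_von_neumann : nrm P <= C.
Proof.
rewrite -[P]adjK (le_trans (nrm_adj_le _))//.
apply: (nrm_bop_total (@tens_total _ _ _ T) (nrm_ge0 _)) => us.
exact: adj_vector_bound.
Qed.

End Strict.

(** The inequality holds for tX with t < 1, where the box sums converge, and a
    polynomial is continuous in t. *)
Lemma von_neumann :
  nrm (\sum_(g <- s) tensop T (B g) (multimonomial X g)) <= C.
Proof.
pose deg (g : multiword n) := (\sum_(i < k) size (g i))%N.
pose Q g := tensop T (B g) (multimonomial X g).
pose b := \sum_(g <- s) (deg g)%:R * nrm (Q g).
have b0 : 0 <= b by apply: sumr_ge0 => g _; rewrite mulr_ge0 ?nrm_ge0.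
apply/ler_addgt0Pr => eps eps0.
pose t := 1 - Num.min 1 (eps / (b + 1)).
have b1 : 0 < b + 1 by rewrite ltr_wpDl.
have t01 : 0 <= t < 1.
  by rewrite /t subr_ge0 ge_min lexx /= gtrBl lt_min ltr01 divr_gt0.
have /andP[t0 t1] := t01.
have := strict_von_neumann t01.
have -> : \sum_(g <- s) tensop T (B g) (multimonomial (scale_tuple (fun=> t) X) g) =
    \sum_(g <- s) (t ^+ deg g)%:C *: Q g.
  apply: eq_bigr => g _; rewrite multimonomial_scale tensopZ; congr (_%:C *: _).
  by rewrite /deg -prodrXr.
move=> h; have -> : \sum_(g <- s) tensop T (B g) (multimonomial X g) =
    \sum_(g <- s) (t ^+ deg g)%:C *: Q g + \sum_(g <- s) (1 - t ^+ deg g)%:C *: Q g.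
  rewrite -big_split; apply: eq_bigr => g _.
  by rewrite /= -scalerDl -rmorphD addrC subrK scale1r.
apply: (le_trans (nrmD _ _)); apply: lerD => //.
have bern m : 1 - t ^+ m <= m%:R * (1 - t) by rewrite one_sub_expr_le// t0 ltW.
have tm1 m : 0 <= 1 - t ^+ m by rewrite subr_ge0 exprn_ile1// ltW.
apply: (@le_trans _ _ ((1 - t) * b)); last first.
  rewrite /t opprB addrC subrK; apply: (@le_trans _ _ (eps / (b + 1) * b)).
    by rewrite ler_wpM2r// ge_min lexx orbT.
  by rewrite mulrAC ler_pdivrMr// ler_wpM2l ?(ltW eps0)// lerDl ler01.
rewrite /b mulr_sumr.
move: (s) => l; elim: l => [|g l IH]; first by rewrite !big_nil nrm0.
rewrite !big_cons (le_trans (nrmD _ _))// lerD// nrmZ nrm_real ger0_norm//.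
by rewrite mulrA [(1 - t) * _]mulrC ler_wpM2r ?nrm_ge0.
Qed.

End VonNeumann.

(** * The closure of a polydomain *)

Section OperatorLimits.
Context {R : realType} {H : hilbertType R} {T : Type} {F : set_system T}.
Context {FF : ProperFilter F}.
Implicit Types (f g : T -> 'B(H)) (a b : 'B(H)).

Lemma nrmM_le a b : nrm (a * b) <= nrm a * nrm b.
Proof.
rewrite nrm_bop; apply: opnorm_lub => x x1; rewrite bop_mulE.
rewrite (le_trans (opnormP _ _))// !nrm_bop ler_wpM2l ?opnorm_ge0//.
exact: opnorm_ub.
Qed.

Lemma cvg_bopM f g a b : f @ F --> a -> g @ F --> b ->
  (fun t => f t * g t) @ F --> a * b.
Proof.
move=> /cvg_nrmP fa /cvg_nrmP gb; apply/cvg_nrmP => e e0.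
pose c := 1 + nrm a + nrm b.
have c0 : 0 < c by rewrite /c -addrA ltr_wpDr// addr_ge0 ?nrm_ge0.
pose d := Num.min 1 (e / 2 / c).
have d0 : 0 < d by rewrite lt_min ltr01 !divr_gt0.
have d1 : d <= 1 by rewrite ge_min lexx.
have d2 : d * c <= e / 2 by rewrite -ler_pdivlMr// ge_min lexx orbT.
apply: filterS2 (fa _ d0) (gb _ d0) => t /ltW ft /ltW gt.
have -> : a * b - f t * g t = a * (b - g t) + (a - f t) * g t.
  by rewrite mulrBl mulrBr addrA subrK.
apply: (@le_lt_trans _ _ (e / 2)); last by rewrite ltr_pdivrMr// ltr_pMr// ltr1n.
apply: le_trans d2; apply: le_trans (nrmD _ _) _.
have gb1 : nrm (g t) <= 1 + nrm b.
  rewrite -[g t](subrK b) (le_trans (nrmD _ _))// lerD2r nrm_distC.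
  exact: le_trans gt d1.
rewrite /c addrAC [d * _]mulrDr [leRHS]addrC [d * nrm a]mulrC.
by apply: lerD; rewrite (le_trans (nrmM_le _ _))// ler_pM ?nrm_ge0.
Qed.

Lemma cvg_adj f a : f @ F --> a -> (fun t => adj (f t)) @ F --> adj a.
Proof.
move=> /cvg_nrmP fa; apply/cvg_nrmP => e e0; apply: filterS (fa _ e0) => t.
apply: le_lt_trans; rewrite (le_trans _ (nrm_adj_le _))// adjD.
suff -> : adj (- f t) = - adj (f t) by [].
by apply: adj_unique => x y; rewrite !bopNE innerNl innerNr adjP.
Qed.

(** A complex number is nonnegative when it equals its modulus, which is a
    closed condition. *)
Lemma bop_ge0_cvg f a : f @ F --> a -> (\forall t \near F, bop_ge0 (f t)) ->
  bop_ge0 a.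
Proof.
move=> /cvg_nrmP fa f0 x; set z := inner (a x) x.
suff : `|z| - z = 0 by move/eqP; rewrite subr_eq0 => /eqP <-.
apply: (@nrm0_eq0 R R[i]^o); apply/le_anti; rewrite (@nrm_ge0 R R[i]^o) andbT.
apply/ler_addgt0Pr => e e0; rewrite add0r.
have d0 : 0 < e / (2 * (nrm x ^+ 2 + 1)).
  by rewrite divr_gt0// mulr_gt0// ltr_wpDl// sqr_ge0.
have [t [ft f0t]] := filter_ex (filterI (fa _ d0) f0).
set w := inner (f t x) x.
have zw : nrm (z - w : R[i]^o) <= e / 2.
  rewrite /z /w -innerBl -bopBE (le_trans (inner_nrm_le _ _))//.
  apply: (@le_trans _ _ (e / (2 * (nrm x ^+ 2 + 1)) * (nrm x ^+ 2 + 1))).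
    rewrite expr2; apply: (@le_trans _ _ (nrm (a - f t) * nrm x * nrm x)).
      by rewrite ler_wpM2r ?nrm_ge0// nrm_bop opnormP.
    rewrite -mulrA; apply: ler_pM; rewrite ?mulr_ge0 ?nrm_ge0//; first exact: ltW.
    by rewrite lerDl.
  rewrite le_eqVlt; apply/orP; left; apply/eqP; field.
  by rewrite gt_eqF// ltr_wpDl// sqr_ge0.
have wE : `|w| = w by rewrite ger0_norm// f0t.
have -> : `|z| - z = (`|z| - `|w|) - (z - w) by rewrite wE opprB addrA subrK.
rewrite (le_trans (@nrmD R R[i]^o _ _))// [leRHS]splitr.
rewrite (@nrmN R R[i]^o) lerD//; apply: le_trans zw.
by rewrite -lecR !nrm_scalar; exact: ler_dist_dist.
Qed.

End OperatorLimits.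

Section Closure.
Context {R : realType} {k : nat} {n : 'I_k -> nat}.
Variables (q : forall i, ncpoly R (n i)).
Hypothesis hq : forall i, positive_regular (q i).
Context {H : hilbertType R}.
Implicit Types (X Y : optuple n H).

Lemma cvg_optuple (T : Type) (F : set_system T) {FF : Filter F}
    (f : T -> optuple n H) X :
  (forall i j, (fun t => f t i j) @ F --> X i j) -> f @ F --> X.
Proof.
have prodC (I : Type) (K : I -> topologicalType) (g : T -> prod_topology K) (l : prod_topology K) :
    (forall i, (fun t => g t i) @ F --> l i) -> g @ F --> l.
  move=> h; apply/cvg_sup => i A [_ [[B Bo <-] Bl BA]].
  by apply: filterS BA _; apply: h; apply: open_nbhs_nbhs.
by move=> h; apply: (@prodC) => i; apply: (@prodC) => j; exact: h.
Qed.

Lemma cvg_entry (F : set_system (optuple n H)) {FF : Filter F} X i j :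
  F --> X -> (fun Y : optuple n H => Y i j) @ F --> X i j.
Proof.
move=> FX.
have c1 : (fun Y : optuple n H => Y i) @ F --> X i.
  apply: cvg_trans (cvg_app (fun Y : optuple n H => Y i) FX) _.
  exact: (@proj_continuous _ (fun i : 'I_k => prod_topology (fun _ : 'I_(n i) => 'B(H))) i).
apply: cvg_trans (cvg_app (fun Y : prod_topology (fun _ : 'I_(n i) => 'B(H)) => Y j) c1) _.
exact: (@proj_continuous _ (fun _ : 'I_(n i) => 'B(H)) j).
Qed.

Lemma cvg_Phi (F : set_system (optuple n H)) {FF : ProperFilter F} X i
    (Z : optuple n H -> 'B(H)) z : F --> X -> Z @ F --> z ->
  (fun Y : optuple n H => Phi (q i) (Y i) (Z Y)) @ F --> Phi (q i) (X i) z.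
Proof.
move=> FX FZ.
have cm w : (fun Y : optuple n H => monomial (Y i) w) @ F --> monomial (X i) w.
  elim: w => [|j w IH].
    rewrite monomial_nil; under eq_fun do rewrite monomial_nil.
    exact: cvg_cst.
  rewrite monomial_cons; under eq_fun do rewrite monomial_cons.
  by apply: cvg_bopM IH; exact: cvg_entry.
rewrite /Phi; elim: (finsupp (q i) : seq _) => [|w s IH].
  rewrite big_nil; under eq_fun do rewrite big_nil.
  exact: cvg_cst.
rewrite big_cons; under eq_fun do rewrite big_cons.
apply: cvgD IH; apply: cvgZl_tmp; apply: cvg_bopM; last exact: cvg_adj.
exact: cvg_bopM.
Qed.

Lemma cvg_fold (F : set_system (optuple n H)) {FF : ProperFilter F} X
    (p : 'I_k -> bool) (Z : optuple n H -> 'B(H)) z (l : seq 'I_k) :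
  F --> X -> Z @ F --> z ->
  (fun Y : optuple n H =>
     foldr (fun i Z => iter (p i) (fun Z' => Z' - Phi (q i) (Y i) Z') Z) (Z Y) l) @ F
  --> foldr (fun i Z => iter (p i) (fun Z' => Z' - Phi (q i) (X i) Z') Z) z l.
Proof.
move=> FX FZ; elim: l => [|i l IH] //=; case: (p i) => //=.
by apply: cvgB => //; exact: cvg_Phi.
Qed.

(** X is the limit of its multiples by 1 - 1 / (m + 1), which lie in the open
    polydomain. *)
Lemma polydomain_closed_closure X :
  polydomain_closed q X -> closure (polydomain q (H:=H)) X.
Proof.
move=> XD U UX.
pose f (m : nat) : optuple n H := scale_tuple (fun=> 1 - m.+1%:R^-1) X.
have fX : f @ \oo --> X.
  apply: cvg_optuple => i j; apply/cvg_nrmP => e e0.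
  have d0 : 0 < e / (nrm (X i j) + 1) by rewrite divr_gt0// ltr_wpDl ?nrm_ge0.
  have [N hN] := archi_small d0; exists N => // m /= Nm.
  have -> : X i j - f m i j = (m.+1%:R^-1)%:C *: X i j.
    by rewrite /f /scale_tuple rmorphB rmorph1 scalerBl scale1r opprB addrC subrK.
  rewrite nrmZ nrm_real ger0_norm ?invr_ge0//.
  apply: (@le_lt_trans _ _ (m.+1%:R^-1 * (nrm (X i j) + 1))).
    by rewrite ler_wpM2l ?invr_ge0// lerDl.
  by rewrite -ltr_pdivlMr ?hN// ltr_wpDl ?nrm_ge0.
have [m _ hU] := fX _ UX; have Um : U (f m) by exact: (hU m (leqnn m)).
exists (f m); split=> //.
apply: (scaled_polydomain hq (proj1 XD)) => // _.
by rewrite subr_ge0 invf_le1// ler1n /= gtrBl invr_gt0 ltr0n.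
Qed.

(** The entries of X enter continuously in the commutation relations and in
    the partial defects. *)
Lemma closure_polydomain_closed X :
  closure (polydomain q (H:=H)) X -> polydomain_closed q X.
Proof.
move=> clX; pose A := polydomain q (H:=H).
have [F [PF FX FA]] : exists F : set_system (optuple n H),
    [/\ ProperFilter F, F --> X & F A].
  exists (within A (nbhs X)); split.
  - apply: Build_ProperFilter_ex => B BX.
    by have [Y [AY BY]] := clX _ BX; exists Y; exact: BY.
  - by move=> B BX; apply: filterS BX.
  - by apply: nearW.
split=> [i j ij a b|p].
  have entry l c : (fun Y : optuple n H => Y l c) @ F --> X l c by exact: cvg_entry.
  have ab : (fun Y : optuple n H => Y i a * Y j b) @ F --> X i a * X j b.
    by apply: cvg_bopM.
  have ba : (fun Y : optuple n H => Y j b * Y i a) @ F --> X j b * X i a.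
    by apply: cvg_bopM.
  apply/eqP; rewrite -subr_eq0; apply/eqP/nrm0_eq0/le_anti; rewrite nrm_ge0 andbT.
  apply/ler_addgt0Pr => e e0; rewrite add0r.
  have e20 : 0 < e / 2 by rewrite divr_gt0.
  move/cvg_nrmP/(_ _ e20): ab => ab; move/cvg_nrmP/(_ _ e20): ba => ba.
  have [Y [[[[Yc _] _] Yab] Yba]] := filter_ex (filterI (filterI FA ab) ba).
  rewrite [leRHS]splitr (le_trans (nrm_triangle _ (Y i a * Y j b) _))// lerD ?ltW//.
  by rewrite nrm_distC Yc.
apply: (@bop_ge0_cvg _ _ _ F _ (fun Y : optuple n H => Delta q p Y 1)).
  apply: cvg_fold => //; exact: cvg_cst.
by apply: filterS FA => Y [[_ Yp] _]; exact: Yp.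
Qed.

End Closure.

(** * The universal model *)

Section Approximable.
Context {R : realType} {I : Type} {H : hilbertType R} (v : I -> H).

Definition approximable (z : H) :=
  forall e : R, 0 < e -> exists s, nrm (z - lincomb v s) < e.

Lemma approximable_unit i : approximable (v i).
Proof. by move=> e e0; exists [:: (1, i)]; rewrite lincomb_unit subrr nrm0. Qed.

Lemma approximable0 : approximable 0.
Proof. by move=> e e0; exists [::]; rewrite /lincomb big_nil subrr nrm0. Qed.

Lemma approximable_axpy a z z' :
  approximable z -> approximable z' -> approximable (a *: z + z').
Proof.
move=> az az' e e0; pose k := nrm (a : R[i]^o) + 1.
have k0 : 0 < k by rewrite ltr_wpDl ?(@nrm_ge0 R R[i]^o).
have [|s sx] := az (e / k / 2); first by rewrite !divr_gt0.
have [|t tx] := az' (e / 2); first by rewrite !divr_gt0.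
have [u uP] := lincomb_axpy a s t; exists u; rewrite uP opprD addrACA -scalerBr.
apply: le_lt_trans (nrmD _ _) _; rewrite [ltRHS]splitr ler_ltD// nrmZ.
apply: (@le_trans _ _ (k * (e / k / 2))).
  by rewrite ler_pM ?nrm_ge0 ?(@nrm_ge0 R R[i]^o) ?lerDl// ltW.
by rewrite [leLHS](_ : _ = e / 2)//; field; rewrite gt_eqF.
Qed.

Lemma approximable_sum (J : Type) (s : seq J) (c : J -> R[i]) (w : J -> H) :
  (forall j, approximable (w j)) -> approximable (\sum_(j <- s) c j *: w j).
Proof.
move=> aw; elim: s => [|j s IH]; first by rewrite big_nil; exact: approximable0.
by rewrite big_cons; exact: approximable_axpy.
Qed.

Lemma approximable_closed z :
  (forall e : R, 0 < e -> exists2 z', approximable z' & nrm (z - z') < e) ->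
  approximable z.
Proof.
move=> h e e0; have e20 : 0 < e / 2 by rewrite divr_gt0.
have [z' az' zz'] := h _ e20; have [s sz'] := az' _ e20; exists s.
by apply: le_lt_trans (nrm_triangle _ z' _) _; rewrite [ltRHS]splitr ltrD.
Qed.

End Approximable.

Section OrthogonalFamilies.
Context {R : realType} {I : eqType}.

(** Repeated indices have to be collected before the norm of a combination can
    be expressed by its coefficients. *)
Lemma lincomb_orth (H : hilbertType R) (u : I -> H) (d : I -> R) (s : seq (R[i] * I)) :
  (forall a b, inner (u a) (u b) = (a == b)%:R * (d a)%:C) ->
  nrm (lincomb u s) ^+ 2 = \sum_(a <- undup (map snd s))
     nrm (\sum_(c <- s | c.2 == a) c.1 : R[i]^o) ^+ 2 * d a.
Proof.
move=> hu; apply: (@complexI R); rewrite -inner_sqr.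
have -> : lincomb u s = \sum_(a <- undup (map snd s))
    (\sum_(c <- s | c.2 == a) c.1) *: u a.
  under eq_bigr do rewrite scaler_suml.
  rewrite (exchange_big_dep xpredT)//= /lincomb.
  apply: eq_big_seq => c cs; rewrite -big_filter.
  rewrite (_ : [seq a <- undup (map snd s) | c.2 == a] = [:: c.2]) ?big_seq1//.
  have : uniq [seq a <- undup (map snd s) | c.2 == a] by rewrite filter_uniq// undup_uniq.
  have : forall a, a \in [seq a <- undup (map snd s) | c.2 == a] = (a == c.2).
    move=> a; rewrite mem_filter mem_undup eq_sym; have [->|//] := eqVneq a c.2.
    by rewrite map_f.
  by move=> h1 h2; apply: perm_small_eq => //; apply: uniq_perm => // a; rewrite h1 inE.
rewrite inner_suml rmorph_sum; apply: eq_big_seq => a aA.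
rewrite inner_sumr (bigD1_seq a) ?undup_uniq//= [X in _ + X]big1 => [|b ba]; last first.
  by rewrite innerZl innerZr hu eq_sym (negbTE ba) mul0r !mulr0.
by rewrite addr0 innerZl innerZr hu eqxx mul1r mulrA [RHS]rmorphM /= nrm_sqrC.
Qed.

Lemma orth_extend (H H' : hilbertType R) (u : I -> H) (w : I -> H') (d d' : I -> R)
    (M : R) : total_family u -> 0 <= M ->
  (forall a b, inner (u a) (u b) = (a == b)%:R * (d a)%:C) ->
  (forall a b, inner (w a) (w b) = (a == b)%:R * (d' a)%:C) ->
  (forall a, d' a <= M ^+ 2 * d a) ->
  exists B : bop H H', forall a, B (u a) = w a.
Proof.
move=> tu M0 hu hw dd; have [|B BE _] := @extend_total _ _ _ _ u w M tu M0.
  move=> s; rewrite -(@ler_pXn2r _ 2)// ?nnegrE ?mulr_ge0 ?nrm_ge0// exprMn.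
  rewrite (lincomb_orth s hw) (lincomb_orth s hu) mulr_sumr; apply: ler_sum => a _.
  by rewrite mulrCA ler_wpM2l ?sqr_ge0.
by exists B.
Qed.

End OrthogonalFamilies.

Section WeightedShift.
Context {R : realType} {n : nat}.
Variables (q : ncpoly R n) (F : fock R n).
Hypothesis hq : positive_regular q.

Lemma shift_weight_le j a :
  bcoef q a / bcoef q (j :: a) <= Num.sqrt (q [:: j])^-1 ^+ 2 * 1.
Proof.
have [_ _ q1] := hq; have b0 : 0 < bcoef q (j :: a) by exact: bcoef_gt0.
rewrite mulr1 sqr_sqrtr ?invr_ge0 ?(ltW (q1 j))//.
rewrite ler_pdivrMr// mulrC ler_pdivlMr// mulrC.
exact: bcoef_cons_ge.
Qed.

Lemma weighted_shiftE j a : weighted_shift F q j (fock_basis F a) =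
  (Num.sqrt (bcoef q a / bcoef q (j :: a)))%:C *: fock_basis F (j :: a).
Proof.
pose w a := (Num.sqrt (bcoef q a / bcoef q (j :: a)))%:C *: fock_basis F (j :: a).
suff exB : exists B : 'B(F), forall a, B (fock_basis F a) = w a.
  by move: a; exact: (@xgetPex _ 0 [set B : 'B(F) |
    forall a, B (fock_basis F a) = w a] exB).
have b0 v : 0 < bcoef q v by exact: bcoef_gt0.
have [_ _ q1] := hq.
apply: (@orth_extend _ _ _ _ (fock_basis F) w (fun=> 1)
  (fun a => bcoef q a / bcoef q (j :: a)) (Num.sqrt (q [:: j])^-1)).
- exact: fock_total.
- exact: sqrtr_ge0.
- by move=> u v; rewrite fock_orthonormal mulr1.
- move=> u v; rewrite /w innerZl innerZr conjR fock_orthonormal eqseq_cons eqxx /=.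
  have [->|] := eqVneq u v; last by rewrite !(mulr0, mul0r).
  by rewrite mulr1 mul1r -rmorphM -expr2 sqr_sqrtr// divr_ge0// ltW.
move=> v; exact: shift_weight_le.
Qed.

End WeightedShift.

Section UniversalModel.
Context {R : realType} {k : nat} {n : 'I_k -> nat}.
Variables (q : forall i, ncpoly R (n i)).
Hypothesis hq : forall i, positive_regular (q i).
Context {F : forall i, fock R (n i)} (T : hbigtensor F).
Implicit Types (a b : multiword n).

Definition ubasis a : T := bigtens T (fun i => fock_basis (F i) (a i)).

Lemma ubasis_orth a b : inner (ubasis a) (ubasis b) = (a == b)%:R.
Proof.
rewrite inner_bigtens; under eq_bigr do rewrite fock_orthonormal.
have [->|ab] := eqVneq a b; first by rewrite big1// => i _; rewrite eqxx.
have [i abi] : exists i, a i != b i.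
  apply/not_existsP => h; case/eqP: ab; apply/functional_extensionality_dep => i.
  by apply/eqP/negPn/negP; exact: h.
by rewrite (bigD1 i)//= (negbTE abi) mul0r.
Qed.

Lemma ubasis_dfwith a i (w : seq 'I_(n i)) :
  ubasis (dfwith a i w) =
  bigtens T (dfwith (fun i => fock_basis (F i) (a i) : F i) i (fock_basis (F i) w)).
Proof.
congr (bigtens T _); apply/functional_extensionality_dep => j.
have [->|ji] := eqVneq j i; first by rewrite !dfwithin.
have ij : i != j by rewrite eq_sym.
by rewrite !dfwithout.
Qed.

Lemma universal_modelE i (j : 'I_(n i)) a : (universal_model q T : optuple n T) i j (ubasis a) =
  (Num.sqrt (bcoef (q i) (a i) / bcoef (q i) (j :: a i)))%:C *:
    ubasis (dfwith a i (j :: a i)).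
Proof.
by rewrite /universal_model bigtensopE weighted_shiftE// bigtensZ ubasis_dfwith.
Qed.

(** The coordinates of an elementary tensor can be approximated one at a time,
    since the tensor depends linearly and boundedly on each of them. *)
Lemma ubasis_total : total_family ubasis.
Proof.
have key (l : seq 'I_k) (x : forall i, F i) :
    (forall i, i \notin l -> exists w, x i = fock_basis (F i) w) ->
    approximable ubasis (bigtens T x).
  elim: l x => [|i l IH] x hx.
    pose a i := projT1 (cid (hx i isT)).
    have -> : x = fun i => fock_basis (F i) (a i).
      by apply/functional_extensionality_dep => i; exact: (projT2 (cid (hx i isT))).
    exact: (approximable_unit ubasis a).
  pose K := \prod_(j < k | j != i) nrm (x j).
  have K0 : 0 <= K by apply: prodr_ge0 => j _; exact: nrm_ge0.
  have nf (y : F i) : nrm (bigtens T (dfwith x i y)) = nrm y * K.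
    apply/eqP; rewrite -(@eqrXn2 _ 2)// ?mulr_ge0 ?nrm_ge0//; apply/eqP.
    apply: (@complexI R); rewrite -inner_sqr inner_bigtens (bigD1 i)//= dfwithin.
    rewrite exprMn rmorphM inner_sqr; congr (_ * _).
    rewrite /K -prodrXl rmorph_prod; apply: eq_bigr => j ji.
    have ij : i != j by rewrite eq_sym.
    by rewrite dfwithout// inner_sqr.
  have lin := @bigtens_linear _ _ _ T x i.
  apply: approximable_closed => e e0.
  have d0 : 0 < e / (K + 1) by rewrite divr_gt0// ltr_wpDl.
  have [s hs] := total_approx (@fock_total _ _ (F i)) (x i) d0.
  exists (bigtens T (dfwith x i (lincomb (fock_basis (F i)) s))).
    have -> : bigtens T (dfwith x i (lincomb (fock_basis (F i)) s)) =
        \sum_(c <- s) c.1 *: bigtens T (dfwith x i (fock_basis (F i) c.2)).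
      rewrite /lincomb; elim: s {hs} => [|c s IHs].
        by rewrite !big_nil -(scale0r 0) bigtensZ scale0r.
      by rewrite !big_cons lin IHs.
    apply: (approximable_sum s (fun c => c.1)) => c; apply: IH => j jl.
    have [->|ji] := eqVneq j i; first by exists c.2; rewrite dfwithin.
    have [|w xw] := hx j; first by rewrite inE negb_or ji.
    have ij : i != j by rewrite eq_sym.
    by exists w; rewrite dfwithout.
  have -> : bigtens T x - bigtens T (dfwith x i (lincomb (fock_basis (F i)) s)) =
      bigtens T (dfwith x i (x i - lincomb (fock_basis (F i)) s)).
    have -> : x i - lincomb (fock_basis (F i)) s =
        -1 *: lincomb (fock_basis (F i)) s + x i by rewrite scaleN1r addrC.
    rewrite lin scaleN1r [RHS]addrC; congr (bigtens T _ - _).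
    apply/functional_extensionality_dep => j.
    have [->|ji] := eqVneq j i; first by rewrite dfwithin.
    have ij : i != j by rewrite eq_sym.
    by rewrite dfwithout.
  rewrite nf; apply: (@le_lt_trans _ _ (nrm (x i - lincomb (fock_basis (F i)) s) * (K + 1))).
    by rewrite ler_wpM2l ?nrm_ge0// lerDl.
  by rewrite -ltr_pdivlMr// ltr_wpDl.
apply: dense_total => z e e0; move: e0; move: e; apply: approximable_closed => e e0.
have [s hs] := total_approx (@bigtens_total _ _ _ T) z e0.
exists (lincomb (bigtens T) s) => //; apply: (approximable_sum s (fun c => c.1)) => c.
by apply: (key (enum 'I_k)) => i; rewrite mem_enum.
Qed.

Lemma universal_model_closed : polydomain_closed q (universal_model q T).
Proof.
apply: (@model_polydomain_closed _ _ _ q hq _ predT ubasis) => //.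
- by move=> a b; rewrite ubasis_orth andbT.
- exact: ubasis_total.
- exact: universal_modelE.
Qed.

End UniversalModel.

(** * Finite direct sums of Hilbert spaces *)

Section CauchyCriterion.
Context {R : realType} (V : normedModType R[i]).

Lemma nrm_cauchy_complete :
  (forall F : set_system V, ProperFilter F ->
     (forall e : R, 0 < e -> exists x : V, F [set y | nrm (x - y) < e]) ->
     exists l : V, forall e : R, 0 < e -> F [set y | nrm (l - y) < e]) ->
  forall F : set_system V, ProperFilter F -> cauchy F -> cvg F.
Proof.
move=> h F PF /cauchyP cF.
have [e e0|l lF] := h F PF.
  have e0' : 0 < e%:C :> R[i] by rewrite ltcR.
  have [x Fx] := cF _ e0'; exists x; apply: filterS Fx => y.
  by rewrite -ball_normE /= -nrmE ltcR.
by apply/cvg_ex; exists l; apply/(@cvg_nrmP _ _ _ _ _ id).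
Qed.

End CauchyCriterion.

(** A name of its own for R[i]^o, to carry the Hilbert space structure. *)
Definition complex_line (R : realType) : Type := R[i]^o.

Section ComplexLine.
Context {R : realType}.

HB.instance Definition _ := NormedModule.copy (complex_line R) (R[i]^o).

Lemma nrm_complexE (z : complex_line R) :
  nrm z = Num.sqrt (complex.Re (z : R[i]) ^+ 2 + complex.Im (z : R[i]) ^+ 2).
Proof. by apply: (@complexI R); rewrite nrmE normc_def. Qed.

Lemma abs_Re_le (z : complex_line R) : `|complex.Re (z : R[i])| <= nrm z.
Proof. by rewrite nrm_complexE -sqrtr_sqr ler_wsqrtr// lerDl sqr_ge0. Qed.

Lemma abs_Im_le (z : complex_line R) : `|complex.Im (z : R[i])| <= nrm z.
Proof. by rewrite nrm_complexE -sqrtr_sqr ler_wsqrtr// lerDr sqr_ge0. Qed.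

Lemma nrm_le_abs (z : complex_line R) :
  nrm z <= `|complex.Re (z : R[i])| + `|complex.Im (z : R[i])|.
Proof.
rewrite nrm_complexE -[leRHS]ger0_norm ?addr_ge0// -sqrtr_sqr ler_wsqrtr//.
rewrite sqrrD !real_normK ?num_real//.
by rewrite lerD2r lerDl mulrn_wge0// mulr_ge0.
Qed.

Lemma complex_line_complete (F : set_system (complex_line R)) :
  ProperFilter F -> cauchy F -> cvg F.
Proof.
move: F; apply: nrm_cauchy_complete => F PF cF.
have part (p : complex_line R -> R) :
    (forall y z, p (y - z) = p y - p z) -> (forall z, `|p z| <= nrm z) ->
    exists l : R, forall e, 0 < e -> F [set y | `|l - p y| < e].
  move=> pB pn; have cp : cvg (p @ F).
    apply: cauchy_cvg; apply: cauchy_exP => e e0.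
    have [x Fx] := cF _ e0; exists (p x); change (F (p @^-1` ball (p x) e)).
    apply: filterS Fx => y /=.
    by rewrite -ball_normE /= -pB; apply: le_lt_trans.
  exists (lim (p @ F)) => e e0; have /cvgrPdist_lt/(_ _ e0) := cp.
  exact.
have [|z|a Fa] := part (fun z => complex.Re (z : R[i])).
- by move=> y z; rewrite -ReN -ReD.
- exact: abs_Re_le.
have [|z|b Fb] := part (fun z => complex.Im (z : R[i])).
- by move=> [? ?] [? ?].
- exact: abs_Im_le.
exists (a +i* b : R[i]) => e e0; have e20 : 0 < e / 2 by rewrite divr_gt0.
apply: filterS2 (Fa _ e20) (Fb _ e20) => y /= ha hb.
apply: le_lt_trans (nrm_le_abs _) _; rewrite [ltRHS]splitr.
by case: y ha hb => y1 y2 /= ha hb; apply: ltrD.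
Qed.

HB.instance Definition _ :=
  Uniform_isComplete.Build (complex_line R) complex_line_complete.

Definition complex_inner (y z : complex_line R) : R[i] := (y : R[i]) * (z : R[i])^*%R.

Lemma complex_inner_linearl z (c : R[i]) x y :
  complex_inner (c *: x + y) z = c * complex_inner x z + complex_inner y z.
Proof. by rewrite /complex_inner mulrDl mulrA. Qed.

Lemma complex_innerC x y : complex_inner x y = (complex_inner y x)^*%R.
Proof. by rewrite /complex_inner rmorphM /= conjCK mulrC. Qed.

Lemma complex_inner_norm x : complex_inner x x = `|x| ^+ 2.
Proof. by rewrite /complex_inner -normCK. Qed.

HB.instance Definition _ := CompleteNormedModule_isHilbert.Build R (complex_line R)
  complex_inner_linearl complex_innerC complex_inner_norm.

Lemma inner_complex (y z : complex_line R) :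
  inner y z = (y : R[i]) * (z : R[i])^*%R.
Proof. by []. Qed.

End ComplexLine.

Lemma sum_cauchy_schwarz (R : realType) (I : finType) (a b : I -> R) :
  \sum_i a i * b i <= Num.sqrt (\sum_i a i ^+ 2) * Num.sqrt (\sum_i b i ^+ 2).
Proof.
have a0 : 0 <= \sum_i a i ^+ 2 by apply: sumr_ge0 => i _; exact: sqr_ge0.
have b0 : 0 <= \sum_i b i ^+ 2 by apply: sumr_ge0 => i _; exact: sqr_ge0.
rewrite -sqrtrM// (le_trans (ler_norm _))// -sqrtr_sqr ler_wsqrtr//.
(* the identity of Lagrange *)
have : 0 <= \sum_i \sum_j (a i * b j - a j * b i) ^+ 2.
  by apply: sumr_ge0 => i _; apply: sumr_ge0 => j _; exact: sqr_ge0.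
have -> : \sum_i \sum_j (a i * b j - a j * b i) ^+ 2 =
    (\sum_i a i ^+ 2) * (\sum_j b j ^+ 2) + (\sum_i b i ^+ 2) * (\sum_j a j ^+ 2)
    - 2 * ((\sum_i a i * b i) * (\sum_j a j * b j)).
  rewrite !mulr_suml mulr_sumr -sumrN -!big_split; apply: eq_bigr => i _ /=.
  rewrite !mulr_sumr -sumrN -!big_split; apply: eq_bigr => j _ /=; ring.
rewrite [(\sum_i b i ^+ 2) * _]mulrC expr2; lra.
Qed.

(** A name of its own for the finite functions, to carry the l2 norm. *)
Definition ell2 (R : realType) (I : finType) (K : hilbertType R) : Type :=
  {ffun I -> K}.

Section Ell2.
Context {R : realType} {I : finType} {K : hilbertType R}.
Implicit Types (x y : ell2 I K).

HB.instance Definition _ := GRing.Lmodule.copy (ell2 I K) {ffun I -> K}.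

Definition coor (x : ell2 I K) (i : I) : K := (x : {ffun I -> K}) i.

Lemma coorD x y i : coor (x + y) i = coor x i + coor y i.
Proof. exact: ffunE. Qed.

Lemma coorZ c x i : coor (c *: x) i = c *: coor x i.
Proof. exact: ffunE. Qed.

Lemma coor0 i : coor 0 i = 0.
Proof. exact: ffunE. Qed.

Lemma coor_inj x y : (forall i, coor x i = coor y i) -> x = y.
Proof. by move=> h; apply/ffunP. Qed.

Definition ell2norm x : R := Num.sqrt (\sum_i nrm (coor x i) ^+ 2).

Lemma ell2norm_sqr x : ell2norm x ^+ 2 = \sum_i nrm (coor x i) ^+ 2.
Proof. by rewrite sqr_sqrtr// sumr_ge0// => i _; exact: sqr_ge0. Qed.

Lemma ell2norm_ge0 x : 0 <= ell2norm x. Proof. exact: sqrtr_ge0. Qed.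

Lemma ell2normD x y :
  (ell2norm (x + y))%:C <= (ell2norm x)%:C + (ell2norm y)%:C :> R[i].
Proof.
rewrite -rmorphD lecR -(@ler_pXn2r _ 2)// ?nnegrE ?addr_ge0 ?ell2norm_ge0//.
rewrite sqrrD !ell2norm_sqr.
apply: (@le_trans _ _ (\sum_i (nrm (coor x i) + nrm (coor y i)) ^+ 2)).
  apply: ler_sum => i _; rewrite ler_pXn2r ?nnegrE ?addr_ge0 ?nrm_ge0//.
  by rewrite coorD nrmD.
under eq_bigr do rewrite sqrrD; rewrite !big_split /= lerD2r lerD2l.
rewrite -mulr2n ler_pMn2r//.
exact: (sum_cauchy_schwarz (fun i => nrm (coor x i)) (fun i => nrm (coor y i))).
Qed.

Lemma ell2normZ (c : R[i]) x : (ell2norm (c *: x))%:C = `|c| * (ell2norm x)%:C.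
Proof.
rewrite -nrm_scalar -rmorphM; congr (_%:C); apply/eqP.
rewrite -(@eqrXn2 _ 2)// ?mulr_ge0 ?ell2norm_ge0 ?(@nrm_ge0 R R[i]^o)//.
rewrite exprMn !ell2norm_sqr mulr_sumr; apply/eqP/eq_bigr => i _.
by rewrite coorZ nrmZ exprMn.
Qed.

Lemma ell2norm_eq0 x : (ell2norm x)%:C = 0 :> R[i] -> x = 0.
Proof.
move=> /(@complexI R) x0; apply: coor_inj => i; rewrite coor0.
have := ell2norm_sqr x; rewrite x0 expr0n /= => /esym/eqP.
rewrite psumr_eq0 => [/allP/(_ i)|j _]; last exact: sqr_ge0.
by rewrite mem_index_enum sqrf_eq0 => /(_ isT)/eqP/nrm0_eq0.
Qed.

HB.instance Definition _ :=
  Lmodule_isNormed.Build R[i] (ell2 I K) ell2normD ell2normZ ell2norm_eq0.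

Lemma nrm_ell2 x : nrm x = ell2norm x.
Proof. by []. Qed.

Lemma nrm_coor_le x i : nrm (coor x i) <= nrm x.
Proof.
rewrite nrm_ell2 -(@ler_pXn2r _ 2)// ?nnegrE ?nrm_ge0 ?ell2norm_ge0//.
rewrite ell2norm_sqr (bigD1 i)//= lerDl sumr_ge0// => j _; exact: sqr_ge0.
Qed.

Lemma nrm_le_coor x : nrm x <= \sum_i nrm (coor x i).
Proof.
have s0 (P : pred I) : 0 <= \sum_(i | P i) nrm (coor x i).
  by apply: sumr_ge0 => i _; exact: nrm_ge0.
rewrite nrm_ell2 -(@ler_pXn2r _ 2)// ?nnegrE ?ell2norm_ge0 ?s0//.
rewrite ell2norm_sqr expr2 mulr_suml; apply: ler_sum => i _.
rewrite expr2 ler_wpM2l ?nrm_ge0// (bigD1 i)//= lerDl; exact: s0.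
Qed.

Lemma coorB x y i : coor (x - y) i = coor x i - coor y i.
Proof. by rewrite -scaleN1r coorD coorZ scaleN1r. Qed.

Lemma ell2_complete (F : set_system (ell2 I K)) : ProperFilter F -> cauchy F -> cvg F.
Proof.
move: F; apply: nrm_cauchy_complete => F PF cF.
have part i : exists l : K, forall e, 0 < e -> F [set y | nrm (l - coor y i) < e].
  have [e e0|l Fl] := @cauchy_nrm_cvg R K (coor^~ i @ F) _.
    have [x Fx] := cF _ e0; exists (coor x i).
    change (F (coor^~ i @^-1` [set y | nrm (coor x i - y) < e])).
    apply: filterS Fx => y /=; rewrite -coorB; apply: le_lt_trans.
    exact: nrm_coor_le.
  exists l => e e0; have /cvg_nrmP/(_ _ e0) := Fl.
  exact.
have [l hl] := choice part; exists [ffun i => l i] => e e0.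
have c0 : 0 < #|I|%:R + 1 :> R by rewrite ltr_wpDl.
have d0 : 0 < e / (#|I|%:R + 1) by rewrite divr_gt0.
have FI (s : seq I) : F [set y | forall i, i \in s -> nrm (l i - coor y i) < e / (#|I|%:R + 1)].
  elim: s => [|i s IH]; first by apply: nearW.
  apply: filterS2 (hl i _ d0) IH => y /= h1 h2 j; rewrite inE => /orP[/eqP->//|].
  exact: h2.
apply: filterS (FI (index_enum I)) => y /= h.
apply: le_lt_trans (nrm_le_coor _) _.
apply: (@le_lt_trans _ _ (\sum_(i : I) (e / (#|I|%:R + 1)))).
  apply: ler_sum => i _; rewrite coorB {1}/coor ffunE ltW// h//.
  exact: mem_index_enum.
rewrite sumr_const -[ltLHS]mulr_natr.
rewrite (_ : e / _ * _ = e * (#|I|%:R / (#|I|%:R + 1))); last by ring.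
by rewrite gtr_pMr// ltr_pdivrMr// mul1r ltrDl.
Qed.

HB.instance Definition _ := Uniform_isComplete.Build (ell2 I K) ell2_complete.

Definition ell2_inner x y : R[i] := \sum_i inner (coor x i) (coor y i).

Lemma ell2_inner_linearl z (c : R[i]) x y :
  ell2_inner (c *: x + y) z = c * ell2_inner x z + ell2_inner y z.
Proof.
rewrite /ell2_inner mulr_sumr -big_split; apply: eq_bigr => i _.
by rewrite coorD coorZ inner_linearl.
Qed.

Lemma ell2_innerC x y : ell2_inner x y = (ell2_inner y x)^*%R.
Proof. by rewrite /ell2_inner rmorph_sum; apply: eq_bigr => i _; rewrite innerC. Qed.

Lemma ell2_inner_norm x : ell2_inner x x = `|x| ^+ 2.
Proof.
rewrite -nrmE nrm_ell2 -rmorphXn /= ell2norm_sqr rmorph_sum.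
by apply: eq_bigr => i _; rewrite inner_sqr.
Qed.

HB.instance Definition _ := CompleteNormedModule_isHilbert.Build R (ell2 I K)
  ell2_inner_linearl ell2_innerC ell2_inner_norm.

Lemma inner_ell2 x y : inner x y = \sum_i inner (coor x i) (coor y i).
Proof. by []. Qed.

End Ell2.

(** * Truncated models *)

Section EllTensor.
Context {R : realType} (I : finType) (K : hilbertType R).

Definition ell2_tens (x : K) (h : ell2 I (complex_line R)) : ell2 I K :=
  [ffun a => (coor h a : R[i]) *: x].

Lemma coor_tens x h a : coor (ell2_tens x h) a = (coor h a : R[i]) *: x.
Proof. exact: ffunE. Qed.

Lemma ell2_tens_linearl h : linear (ell2_tens ^~ h).
Proof.
move=> c x y; apply: coor_inj => a; rewrite coorD coorZ !coor_tens scalerDr.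
by rewrite !scalerA mulrC.
Qed.

Lemma ell2_tens_linearr x : linear (ell2_tens x).
Proof.
move=> c g h; apply: coor_inj => a; rewrite coorD coorZ !coor_tens coorD coorZ.
by rewrite scalerDl scalerA.
Qed.

Lemma inner_ell2_tens x h x' h' :
  inner (ell2_tens x h) (ell2_tens x' h') = inner x x' * inner h h'.
Proof.
rewrite !inner_ell2 mulr_sumr; apply: eq_bigr => a _.
by rewrite inner_complex !coor_tens innerZl innerZr [RHS]mulrC mulrA.
Qed.

Definition delta (a : I) : ell2 I (complex_line R) :=
  [ffun b => ((b == a)%:R : complex_line R)].

Lemma coor_delta a b : coor (delta a) b = (b == a)%:R :> R[i].
Proof. exact: ffunE. Qed.

Lemma ell2_tens_total : total_family (fun xy : K * _ => ell2_tens xy.1 xy.2).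
Proof.
apply: dense_total => z e e0.
exists [seq (1, (coor z a, delta a)) | a <- index_enum I].
rewrite (_ : z - _ = 0) ?nrm0//; apply/eqP; rewrite subr_eq0; apply/eqP.
rewrite /lincomb big_map /=; apply: coor_inj => b.
have -> : coor (\sum_(a <- index_enum I) 1 *: ell2_tens (coor z a) (delta a)) b =
    \sum_(a <- index_enum I) coor (1 *: ell2_tens (coor z a) (delta a)) b.
  elim: (index_enum I) => [|a s IH]; first by rewrite !big_nil coor0.
  by rewrite !big_cons coorD IH.
rewrite (bigD1 b)//= big1 => [|a ab].
  by rewrite addr0 scale1r coor_tens coor_delta eqxx scale1r.
by rewrite scale1r coor_tens coor_delta eq_sym (negbTE ab) scale0r.
Qed.

Definition ell2_htensor : htensor K (ell2 I (complex_line R)) :=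
  HTensor ell2_tens_linearl ell2_tens_linearr inner_ell2_tens ell2_tens_total.

End EllTensor.

Section TruncatedModel.
Context {R : realType} {k : nat} {n : 'I_k -> nat}.
Variables (q : forall i, ncpoly R (n i)).
Hypothesis hq : forall i, positive_regular (q i).
Variable p : 'I_k -> nat.

(** The basis vectors of these multiwords span a finite-dimensional subspace
    which is invariant under the adjoints of the universal model; the
    compression to it is again a weighted shift model. *)
Definition short_words : finType := {dffun forall i : 'I_k, (p i).-bseq 'I_(n i)}.

Definition mw_of (a : short_words) : multiword n := fun i => val (a i).

Lemma mw_of_inj : injective mw_of.
Proof.
move=> a b ab; apply/ffunP => i; apply/val_inj.
exact: (f_equal (fun f => f i) ab).
Qed.

Definition is_short (a : multiword n) : bool := [forall i, (size (a i) <= p i)%N].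

Lemma is_shortP a : reflect (exists b, mw_of b = a) (is_short a).
Proof.
apply: (iffP forallP) => [ap|[b <-] i]; last exact: size_bseq.
exists [ffun i => Bseq (ap i)]; apply/functional_extensionality_dep => i.
by rewrite /mw_of ffunE.
Qed.

Let H := ell2 short_words (complex_line R).

Definition tbasis (a : multiword n) : H :=
  [ffun b => ((mw_of b == a)%:R : complex_line R)].

Lemma coor_tbasis a b : coor (tbasis a) b = (mw_of b == a)%:R :> R[i].
Proof. exact: ffunE. Qed.

Lemma tbasis_orth a b : inner (tbasis a) (tbasis b) = ((a == b) && is_short a)%:R.
Proof.
rewrite inner_ell2; under eq_bigr do rewrite inner_complex !coor_tbasis conjC_nat -natrM mulnb.
have [[c ca]|sa] := is_shortP a; last first.
  rewrite andbF big1// => c _; case: eqP => //= ca.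
  by case: sa; exists c.
rewrite (bigD1 c)//= big1 ?addr0 => [|d dc]; first by rewrite ca eqxx andbT.
have [da|//] := eqVneq (mw_of d) a.
by case/eqP: dc; apply: mw_of_inj; rewrite da.
Qed.

Lemma tbasis_total : total_family tbasis.
Proof.
apply: dense_total => z e e0.
exists [seq (coor z a : R[i], mw_of a) | a <- index_enum short_words].
rewrite (_ : z - _ = 0) ?nrm0//; apply/eqP; rewrite subr_eq0; apply/eqP.
rewrite /lincomb big_map /=; apply: coor_inj => b.
have -> : coor (\sum_(a <- index_enum short_words) (coor z a : R[i]) *: tbasis (mw_of a)) b =
    \sum_(a <- index_enum short_words) coor ((coor z a : R[i]) *: tbasis (mw_of a)) b.
  elim: (index_enum _) => [|a s IH]; first by rewrite !big_nil coor0.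
  by rewrite !big_cons coorD IH.
rewrite (bigD1 b)//= big1 => [|a ab].
  by rewrite addr0 coorZ coor_tbasis eqxx [RHS]mulr1.
by rewrite coorZ coor_tbasis (inj_eq mw_of_inj) eq_sym (negbTE ab) [LHS]mulr0.
Qed.

Lemma is_short_suffix a i (w : seq 'I_(n i)) :
  is_short (dfwith a i (w ++ a i)) -> is_short a.
Proof.
move=> /forallP h; apply/forallP => j; have := h j.
have [->|ji] := eqVneq j i; last by rewrite dfwithout// eq_sym.
by rewrite dfwithin size_cat; apply: leq_trans; rewrite leq_addl.
Qed.

Lemma truncated_shift_ex : exists X : optuple n H, forall i (j : 'I_(n i)) a,
  X i j (tbasis a) = (Num.sqrt (bcoef (q i) (a i) / bcoef (q i) (j :: a i)))%:C *:
       tbasis (dfwith a i (j :: a i)).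
Proof.
have ex i (j : 'I_(n i)) : exists B : 'B(H), forall a, B (tbasis a) =
    (Num.sqrt (bcoef (q i) (a i) / bcoef (q i) (j :: a i)))%:C *:
       tbasis (dfwith a i (j :: a i)).
  apply: (@orth_extend _ _ _ _ tbasis _ (fun a => (is_short a)%:R)
    (fun a => bcoef (q i) (a i) / bcoef (q i) (j :: a i) *
      (is_short (dfwith a i (j :: a i)))%:R) (Num.sqrt (q i [:: j])^-1)).
  - exact: tbasis_total.
  - exact: sqrtr_ge0.
  - by move=> a b; rewrite tbasis_orth; case: eqP => _; rewrite ?mul0r// mul1r; case: is_short.
  - move=> a b; rewrite innerZl innerZr conjR tbasis_orth.
    have b0 v : 0 < bcoef (q i) v by exact: bcoef_gt0.
    have [->|ab] := eqVneq a b.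
      rewrite eqxx mul1r mulrA -rmorphM -expr2 sqr_sqrtr ?divr_ge0 ?(ltW (b0 _))//.
      by rewrite [RHS]rmorphM /=; congr (_ * _); case: is_short.
    rewrite mul0r; case: eqP => [e|_]; last by rewrite !mulr0.
    case/eqP: ab; apply/functional_extensionality_dep => l.
    have := f_equal (fun f => f l) e; have [->|li] := eqVneq l i.
      by rewrite !dfwithin => -[].
    have il : i != l by rewrite eq_sym.
    by rewrite !dfwithout.
  - move=> a; case sa : (is_short (dfwith a i (j :: a i))).
      have -> : is_short a by apply: (@is_short_suffix _ _ [:: j]).
      by rewrite mulr1; exact: shift_weight_le.
    by rewrite mulr0 mulr_ge0 ?sqr_ge0.
pose X : optuple n H := fun i j => projT1 (cid (ex i j)).
by exists X => i j a; exact: (projT2 (cid (ex i j))).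
Qed.

End TruncatedModel.

(** * Power series and the theorem *)

Section PartialSums.
Context {R : realType} {k : nat} {n : 'I_k -> nat}.
Context {K H : hilbertType R} (T : htensor K H).
Variables (r : 'I_k -> R) (A : multiword n -> 'B(K)).

Definition words_of (J : {fset {ffun 'I_k -> nat}}) : seq (multiword n) :=
  flatten [seq [seq word_of a | a : Lambda n p] | p : {ffun 'I_k -> nat} <- J].

Definition scaled_coef (g : multiword n) : 'B(K) :=
  (\prod_(i < k) r i ^+ size (g i))%:C *: A g.

Lemma partial_sum_words (X : optuple n H) J :
  partial_sum (homogeneous_part T A (scale_tuple r X)) J =
  \sum_(g <- words_of J) tensop T (scaled_coef g) (multimonomial X g).
Proof.
rewrite /partial_sum -(big_seq_fsetE _ J xpredT (homogeneous_part T A (scale_tuple r X))).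
rewrite /words_of big_flatten big_map /=; apply: eq_bigr => p _.
rewrite /homogeneous_part big_map big_enum /=; apply: eq_bigr => a _.
by rewrite multimonomial_scale tensopZZ.
Qed.

End PartialSums.

Lemma scale_tuple_comp (R : realType) (k : nat) (n : 'I_k -> nat)
    (H : hilbertType R) (r s : 'I_k -> R) (X : optuple n H) :
  scale_tuple r (scale_tuple s X) = scale_tuple (fun i => r i * s i) X.
Proof.
apply/functional_extensionality_dep => i; apply/functional_extensionality_dep => j.
by rewrite /scale_tuple scalerA -rmorphM.
Qed.

Section Series.
Context {R : realType} {k : nat} {n : 'I_k -> nat}.
Variables (q : forall i, ncpoly R (n i)).
Hypothesis hq : forall i, positive_regular (q i).
Variables (rho : 'I_k -> R) (K : hilbertType R) (A : multiword n -> 'B(K)).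
Hypothesis hrho : forall i, 0 < rho i.
Hypothesis hF : free_holomorphic rho q A.
Variable r : 'I_k -> R.
Hypothesis hr : forall i, 0 < r i < rho i.

(** rX is rho times the multiple of X by the numbers r_i / rho_i < 1, which
    lies in the open polydomain even if X is in the closed one. *)
Lemma series_limit (H : hilbertType R) (T : htensor K H) (X : optuple n H) :
  polydomain_closed q X -> forall e : R, 0 < e ->
  \forall J \near totally, nrm (series_value T A (scale_tuple r X) -
     partial_sum (homogeneous_part T A (scale_tuple r X)) J) < e.
Proof.
have FF : Filter (@totally {ffun 'I_k -> nat}) by exact: totally_filter.
move=> XD; apply/cvg_nrmP; rewrite /series_value /summability.sum.
have s01 i : 0 <= r i / rho i < 1.
  have /andP[r0 rr] := hr i.
  by rewrite divr_ge0 ?ltW//= ltr_pdivrMr// mul1r.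
have := @hF H T _ (scaled_polydomain hq (proj1 XD) s01 XD).
rewrite /series_converges scale_tuple_comp.
have -> : (fun i => rho i * (r i / rho i)) = r; last by [].
by apply/funext => i; rewrite mulrC divfK// gt_eqF.
Qed.

Lemma series_nrm_le (H H' : hilbertType R) (T : htensor K H) (T' : htensor K H')
    (X : optuple n H) (X' : optuple n H') :
  polydomain_closed q X -> polydomain_closed q X' ->
  (forall J, nrm (partial_sum (homogeneous_part T A (scale_tuple r X)) J) <=
     nrm (partial_sum (homogeneous_part T' A (scale_tuple r X')) J)) ->
  nrm (series_value T A (scale_tuple r X)) <=
  nrm (series_value T' A (scale_tuple r X')).
Proof.
move=> XD XD' h; apply/ler_addgt0Pr => e e0.
have e20 : 0 < e / 2 by rewrite divr_gt0.
have FF : ProperFilter (@totally {ffun 'I_k -> nat}) by exact: totally_filter.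
have [J [/ltW h1 /ltW h2]] := filter_ex (filterI (series_limit T XD e20) (series_limit T' XD' e20)).
set F := series_value T _ _ in h1 *; set F' := series_value T' _ _ in h2 *.
set P := partial_sum _ J in h1; set P' := partial_sum _ J in h2.
have FP : nrm F <= nrm (F - P) + nrm P by rewrite -{1}[F](subrK P) nrmD.
have PF : nrm P' <= nrm (F' - P') + nrm F'.
  by rewrite nrm_distC -{1}[P'](subrK F') nrmD.
by have := h J; rewrite -/P -/P'; lra.
Qed.

(** The partial sums are polynomials, to which the von Neumann inequality
    applies. *)
Lemma series_nrm_universal (F2 : forall i, fock R (n i)) (T2 : hbigtensor F2)
    (KT : htensor K T2) (H : hilbertType R) (T : htensor K H) (X : optuple n H) :
  polydomain_closed q X ->
  nrm (series_value T A (scale_tuple r X)) <=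
  nrm (series_value KT A (scale_tuple r (universal_model q T2))).
Proof.
move=> XD; apply: series_nrm_le => // [|J].
  exact: universal_model_closed.
rewrite !partial_sum_words.
exact: (von_neumann hq KT (ubasis_orth T2) (universal_modelE hq T2) T XD).
Qed.

Lemma Msup_ub (H : hilbertType R) (T : htensor K H) (X : optuple n H) :
  polydomain_closed q X ->
  ((nrm (series_value T A (scale_tuple r X)))%:E <= Msup r q A)%E.
Proof.
move=> XD; apply: ereal_sup_ubound; exists H, T, X; split=> //.
exact: polydomain_closed_closure.
Qed.

Lemma Msup_universal (F2 : forall i, fock R (n i)) (T2 : hbigtensor F2)
    (KT : htensor K T2) :
  Msup r q A = (nrm (series_value KT A (scale_tuple r (universal_model q T2))))%:E.
Proof.
apply/eqP; rewrite eq_le Msup_ub ?andbT; last exact: universal_model_closed.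
apply: ge_ereal_sup => _ [H [T [X [clX ->]]]]; rewrite lee_fin.
exact/series_nrm_universal/closure_polydomain_closed.
Qed.

End Series.

(** The Cauchy-Schwarz inequality for the form of D, at x and D x. *)
Lemma nrm_bop_ge0 (R : realType) (H : hilbertType R) (D : 'B(H)) (L : R) :
  0 <= L -> bop_ge0 D ->
  (forall x, complex.Re (inner (D x) x) <= L * nrm x ^+ 2) -> nrm D <= L.
Proof.
move=> L0 D0 h; rewrite nrm_bop; apply: opnorm_lub => x x1.
have := cauchy_schwarz D0 x (D x).
rewrite -(ge0_ReE (D0 x)) -(ge0_ReE (D0 (D x))) inner_sqr conjR -!rmorphM lecR.
set m := nrm (D x) => cs.
have m0 : 0 <= m by exact: nrm_ge0.
have [->//|mn0] := eqVneq m 0.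
have mp : 0 < m by rewrite lt_neqAle eq_sym mn0.
have x2 : nrm x ^+ 2 <= 1 by rewrite exprn_ile1// nrm_ge0.
have hx : complex.Re (inner (D x) x) <= L.
  by apply: le_trans (h x) _; rewrite -[leRHS]mulr1 ler_wpM2l.
have : m ^+ 2 * m ^+ 2 <= L * (L * m ^+ 2).
  by apply: le_trans cs _; apply: ler_pM; rewrite ?Re_ge0.
rewrite mulrA ler_pM2r ?exprn_gt0// -expr2.
by rewrite ler_pXn2r ?nnegrE.
Qed.

Section CoefficientBound.
Context {R : realType} {k : nat} {n : 'I_k -> nat}.
Variables (q : forall i, ncpoly R (n i)).
Hypothesis hq : forall i, positive_regular (q i).
Variables (rho : 'I_k -> R) (K : hilbertType R) (A : multiword n -> 'B(K)).
Hypothesis hrho : forall i, 0 < rho i.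
Hypothesis hF : free_holomorphic rho q A.
Variable r : 'I_k -> R.
Hypothesis hr : forall i, 0 < r i < rho i.
Variable p : {ffun 'I_k -> nat}.

Let H := ell2 (short_words (n := n) p) (complex_line R).
Let T : htensor K H := ell2_htensor (short_words p) K.

Section Truncated.
Variable X : optuple n H.
Arguments X : clear implicits.
Hypothesis XE : forall i (j : 'I_(n i)) a, X i j (tbasis (R := R) p a) =
  (Num.sqrt (bcoef (q i) (a i) / bcoef (q i) (j :: a i)))%:C *:
     tbasis p (dfwith a i (j :: a i)).

Let XD : polydomain_closed q X.
Proof.
exact: (model_polydomain_closed hq (tbasis_orth p) (@tbasis_total _ _ _ p)
  (@is_short_suffix _ _ p) XE).
Qed.

Let F := series_value T A (scale_tuple r X).

Let index (alpha : Lambda n p) : short_words p :=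
  [ffun i => Bseq (eq_leq (size_tuple (alpha i)))].

Let mw_of_index alpha : mw_of (index alpha) = word_of alpha.
Proof. by apply/functional_extensionality_dep => i; rewrite /mw_of ffunE. Qed.

Let word_of_inj (p' : {ffun 'I_k -> nat}) : injective (@word_of k n p').
Proof.
move=> a b ab; apply/ffunP => i; apply/val_inj.
exact: (f_equal (fun f => f i) ab).
Qed.

Let rp := \prod_(i < k) r i ^+ p i.

(** Distinct monomials send e_0 to multiples of distinct basis vectors, so
    that a single term contributes to each component. *)
Let coor_partial_sum x (alpha : Lambda n p) (J : {fset {ffun 'I_k -> nat}}) :
  p \in J ->
  coor (partial_sum (homogeneous_part T A (scale_tuple r X)) J
          (tens T x (tbasis p (mw_nil (n := n))))) (index alpha) =
  (rp * Num.sqrt (mcoef q (word_of alpha))^-1)%:C *: A (word_of alpha) x.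
Proof.
move=> pJ.
have term (p' : {ffun 'I_k -> nat}) (b : Lambda n p') :
   coor (tensop T (A (word_of b)) (multimonomial (scale_tuple r X) (word_of b))
          (tens T x (tbasis p (mw_nil (n := n))))) (index alpha) =
   (((\prod_(i < k) r i ^+ p' i) * Num.sqrt (mcoef q (word_of b))^-1)%:C *
     (word_of alpha == word_of b)%:R) *: A (word_of b) x.
  rewrite multimonomial_scale tensopZ bopZE tensopE (model_multimonomial hq XE).
  have -> : mcoef q (mw_nil (n := n)) = 1 by rewrite /mcoef big1.
  have -> : mw_cat (word_of b) mw_nil = word_of b.
    by apply/functional_extensionality_dep => i; rewrite /mw_cat cats0.
  rewrite div1r coorZ [tens T _ _]/(ell2_tens _ _) coor_tens coorZ coor_tbasis mw_of_index.
  rewrite scalerA mulrA rmorphM; congr (_ * _ * _ *: _); congr (_%:C).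
  by apply: eq_bigr => i _; rewrite size_tuple.
have coor_sum (I : Type) (s : seq I) (P : I -> T) a :
    coor (\sum_(i <- s) P i) a = \sum_(i <- s) coor (P i) a.
  elim: s => [|i s IH]; first by rewrite !big_nil coor0.
  by rewrite !big_cons coorD IH.
move: (tens T x _) term => u term.
rewrite /partial_sum -(big_seq_fsetE _ J xpredT (homogeneous_part T A (scale_tuple r X))).
rewrite bop_sumE coor_sum (bigD1_seq p) ?fset_uniq//= [X in _ + X]big1 => [|p' pp'].
  rewrite addr0 /homogeneous_part bop_sumE coor_sum (bigD1 alpha)//= [X in _ + X]big1 => [|b ba].
    by rewrite addr0 term eqxx mulr1.
  by rewrite term (inj_eq (@word_of_inj p)) eq_sym (negbTE ba) mulr0 scale0r.
rewrite /homogeneous_part bop_sumE coor_sum big1// => b _; rewrite term.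
case: eqP => [e|_]; last by rewrite mulr0 scale0r.
case/eqP: pp'; apply/ffunP => i.
by have := f_equal (fun f => size (f i)) e; rewrite /word_of !size_tuple.
Qed.

Let coor_series x (alpha : Lambda n p) :
  coor (F (tens T x (tbasis p (mw_nil (n := n))))) (index alpha) =
  (rp * Num.sqrt (mcoef q (word_of alpha))^-1)%:C *: A (word_of alpha) x.
Proof.
set u := tens T x _; apply/eqP; rewrite -subr_eq0; apply/eqP/nrm0_eq0/le_anti.
rewrite nrm_ge0 andbT; apply/ler_addgt0Pr => e e0; rewrite add0r.
have u1 : 0 < nrm u + 1 by rewrite ltr_wpDl ?nrm_ge0.
have d0 : 0 < e / (nrm u + 1) by rewrite divr_gt0.
have FF : ProperFilter (@totally {ffun 'I_k -> nat}) by exact: totally_filter.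
have pJ : (@totally {ffun 'I_k -> nat}) 
    [set J : {fset {ffun 'I_k -> nat}} | p \in J].
  by exists [fset p]%fset => // J /= /fsubsetP; apply; rewrite in_fset1.
have [J [/= hJ /ltW h]] := filter_ex (filterI pJ (series_limit hq hrho hF hr T XD d0)).
rewrite -(coor_partial_sum x alpha hJ) -coorB -bopBE.
apply: le_trans (nrm_coor_le _ _) _.
apply: le_trans (opnormP _ _) _; rewrite -nrm_bop.
apply: (@le_trans _ _ (e / (nrm u + 1) * (nrm u + 1))); last by rewrite divfK ?gt_eqF.
by apply: ler_pM; rewrite ?nrm_ge0// lerDl.
Qed.

Let G : 'B(K) := \sum_(alpha : Lambda n p)
   ((mcoef q (word_of alpha))^-1)%:C *: (adj (A (word_of alpha)) * A (word_of alpha)).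

(** The square of the norm of F(rX)(x (x) e_0) is at least the sum of the
    squares of the norms of its components of multidegree p. *)
Lemma coefficient_bound : Num.sqrt (nrm G) <= rp^-1 * nrm F.
Proof.
have rp0 : 0 < rp.
  by apply: prodr_gt0 => i _; rewrite exprn_gt0//; case/andP: (hr i).
have m0 g : 0 <= (mcoef q g)^-1 by rewrite invr_ge0 ltW// mcoef_gt0.
have AA (B : 'B(K)) : bop_ge0 (adj B * B).
  by move=> x; rewrite bop_mulE adj_inner inner_sqr ler0c sqr_ge0.
have G0 : bop_ge0 G by apply: bop_ge0_sum => a _; exact: bop_ge0Z.
rewrite -[leRHS]ger0_norm ?mulr_ge0 ?nrm_ge0 ?invr_ge0 ?(ltW rp0)//.
rewrite -sqrtr_sqr ler_wsqrtr//; apply: nrm_bop_ge0 => // [|x]; first exact: sqr_ge0.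
pose u := tens T x (tbasis p (mw_nil (n := n))).
have uE : nrm u = nrm x.
  apply/eqP; rewrite -(@eqrXn2 _ 2) ?nrm_ge0//; apply/eqP/(@complexI R).
  rewrite -!inner_sqr inner_tens tbasis_orth eqxx /=.
  have -> : is_short p (mw_nil (n := n)) by apply/forallP.
  by rewrite mulr1.
have GE : rp ^+ 2 * complex.Re (inner (G x) x) =
    \sum_(alpha : Lambda n p) nrm (coor (F u) (index alpha)) ^+ 2.
  have -> : inner (G x) x = (\sum_(alpha : Lambda n p)
      (mcoef q (word_of alpha))^-1 * nrm (A (word_of alpha) x) ^+ 2)%:C.
    rewrite bop_sumE inner_suml rmorph_sum; apply: eq_bigr => a _.
    by rewrite bopZE innerZl bop_mulE adj_inner inner_sqr -rmorphM.
  rewrite ReC mulr_sumr; apply: eq_bigr => a _.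
  rewrite coor_series nrmZ nrm_real ger0_norm ?mulr_ge0 ?sqrtr_ge0 ?(ltW rp0)//.
  by rewrite !exprMn sqr_sqrtr ?m0// mulrA.
have rp2 : 0 < rp ^+ 2 by rewrite exprn_gt0.
rewrite -(ler_pM2l rp2) GE -uE.
have -> : rp ^+ 2 * ((rp^-1 * nrm F) ^+ 2 * nrm u ^+ 2) = (nrm F * nrm u) ^+ 2.
  by field; rewrite gt_eqF.
apply: (@le_trans _ _ (nrm (F u) ^+ 2)); last first.
  by rewrite ler_pXn2r ?nnegrE ?mulr_ge0 ?nrm_ge0// [nrm F]nrm_bop opnormP.
have index_inj : injective index.
  by move=> a b ab; apply: (@word_of_inj p); rewrite -!mw_of_index ab.
rewrite [X in _ <= X ^+ 2]nrm_ell2 ell2norm_sqr.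
rewrite -(big_imset (fun a => nrm (coor (F u) a) ^+ 2) (h := index) (A := predT)); last first.
  by move=> a b _ _; exact: index_inj.
rewrite [leRHS](bigID (mem (index @: predT))) /= lerDl.
by apply: sumr_ge0 => a _; exact: sqr_ge0.
Qed.

End Truncated.

Lemma coefficient_bound_Msup :
  ((Num.sqrt (nrm (\sum_(alpha : Lambda n p)
      ((mcoef q (word_of alpha))^-1)%:C *:
        (adj (A (word_of alpha)) * A (word_of alpha)))))%:E
   <= ((\prod_(i < k) r i ^+ p i)^-1)%:E * Msup r q A)%E.
Proof.
have [X XE] := truncated_shift_ex hq p.
have XD : polydomain_closed q X.
  exact: (model_polydomain_closed hq (tbasis_orth p) (@tbasis_total _ _ _ p)
    (@is_short_suffix _ _ p) XE).
have rp0 : 0 < (\prod_(i < k) r i ^+ p i)^-1.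
  by rewrite invr_gt0; apply: prodr_gt0 => i _; rewrite exprn_gt0//; case/andP: (hr i).
apply: (@le_trans _ _ ((\prod_(i < k) r i ^+ p i)^-1%:E *
    (nrm (series_value T A (scale_tuple r X)))%:E)%E).
  by rewrite -EFinM lee_fin; exact: coefficient_bound.
by rewrite lee_pmul2l//; exact: Msup_ub.
Qed.

End CoefficientBound.

Theorem theorem2p7 (R : realType) (k : nat) (hk : (0 < k)%N)
    (n : 'I_k -> nat) (hn : forall i, (0 < n i)%N)
    (q : forall i, ncpoly R (n i)) (hq : forall i, positive_regular (q i))
    (rho : 'I_k -> R) (hrho : forall i, 0 < rho i)
    (K : hilbertType R) (A : multiword n -> 'B(K))
    (hF : free_holomorphic rho q A)
    (r : 'I_k -> R) (hr : forall i, 0 < r i < rho i) :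
  (forall p : 'I_k -> nat,
     ((Num.sqrt (nrm (\sum_(alpha : Lambda n p)
        ((\prod_(i < k) bcoef (q i) (word_of alpha i))^-1)%:C *:
           (adj (A (word_of alpha)) * A (word_of alpha)))))%:E
      <= ((\prod_(i < k) r i ^+ p i)^-1)%:E * Msup r q A)%E) /\
  (forall (F2 : forall i, fock R (n i)) (T : hbigtensor F2) (KT : htensor K T),
     Msup r q A =
       (nrm (series_value KT A (scale_tuple r (universal_model q T))))%:E).
Proof.
split=> [p|F2 T KT]; last exact: (Msup_universal hq hrho hF hr).
have := coefficient_bound_Msup hq hrho hF hr [ffun i => p i].
have -> : ([ffun i => p i] : 'I_k -> nat) = p by apply/funext => i; rewrite ffunE.
exact.
Qed.
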